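(* Let $L>0$ be a finite number such that $$\frac{24}{L^2}-1=2A^2>0,$$ and let $\mathcal{S}_L=\{(x,y)\in\mathbb{R}^2:\ x\in(0,L),\ y\in\mathbb{R}\}$. Consider the problem $$u_t+(1+u)u_x+u_{xxx}+u_{xyy}=0\quad\text{for }(x,y)\in\mathcal{S}_L,\ t>0,$$ $$u(0,y,t)=u(L,y,t)=u_x(L,y,t)=0,\quad y\in\mathbb{R},\ t>0,$$ $$u(x,y,0)=u_0(x,y),\quad (x,y)\in\mathcal{S}_L.$$ If $$\left((1+x),u_0^2\right)<9\,\frac{(24-L^2)^2}{2^9L^2},$$ then a regular solution $u$ to this problem satisfies, for all $t>0$, $$\|u\|^2(t)\le\left((1+x),u^2\right)(t)\le e^{-\varrho t}\left((1+x),u_0^2\right),\qquad \varrho=\frac{24-L^2}{2L^2(1+L)}.$$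
   Context: Subscripts denote partial derivatives. $(\cdot,\cdot)$ and $\|\cdot\|$ are the inner product and the norm of $L^2(\mathcal{S}_L)$; thus $\left((1+x),u^2\right)(t)=\int_{\mathcal{S}_L}(1+x)u^2(x,y,t)\,dx\,dy$ and $\|u\|^2(t)=\int_{\mathcal{S}_L}u^2(x,y,t)\,dx\,dy$. A regular solution is a real-valued function $u$ satisfying the equation almost everywhere and the boundary and initial conditions in the sense of traces, and such that for every finite $T>0$: $u\in L^\infty(0,T;H^2(\mathcal{S}_L))\cap L^2(0,T;H^3(\mathcal{S}_L))$, $\Delta u_x\in L^\infty(0,T;L^2(\mathcal{S}_L))\cap L^2(0,T;H^1(\mathcal{S}_L))$ and $u_t\in L^\infty(0,T;L^2(\mathcal{S}_L))\cap L^2(0,T;H^1(\mathcal{S}_L))$, where $\Delta=\partial_x^2+\partial_y^2$. *)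

(* Defs.v *)
From HB Require Import structures.
From mathcomp Require Import all_boot all_order all_algebra.
From mathcomp Require Import all_classical all_reals all_analysis.

Set Implicit Arguments.
Unset Strict Implicit.
Unset Printing Implicit Defensive.

Import Order.TTheory GRing.Theory Num.Theory.
Import numFieldNormedType.Exports.

Local Open Scope classical_set_scope.
Local Open Scope ring_scope.

Definition strip (R : realType) (L : R) : set (R * R) :=
  [set p | 0 < p.1 < L].

(* Space-time points are (t, (x, y)). *)
Definition cylinder (R : realType) (L : R) : set (R * (R * R)) :=
  [set z | 0 < z.1 /\ strip L z.2].

(* The sigma-finiteness instance of the library for products of measures is
   shadowed by the one for subprobabilities, hence this lemma. *)
Lemma product_sigma_finite d1 d2 (T1 : measurableType d1)
    (T2 : measurableType d2) (R : realType)
    (m1 : {sigma_finite_measure set T1 -> \bar R})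
    (m2 : {sigma_finite_measure set T2 -> \bar R}) :
  sigma_finite setT (m1 \x m2)%E.
Proof.
have /sigma_finiteP[F [TF ndF Foo]] := sigma_finiteT m1.
have /sigma_finiteP[G [TG ndG Goo]] := sigma_finiteT m2.
exists (fun n => F n `*` G n).
  rewrite -setXTT TF TG predeqE => -[x y]; split.
    move=> [/= [n _ Fnx] [k _ Gky]]; exists (maxn n k) => //; split.
    - by move: x Fnx; exact/subsetPset/ndF/leq_maxl.
    - by move: y Gky; exact/subsetPset/ndG/leq_maxr.
  by move=> [n _ []/= ? ?]; split; exists n.
move=> k; have [? ?] := Foo k; have [? ?] := Goo k.
split; first exact: measurableX.
by rewrite product_measure1E// lte_mul_pinfty// ge0_fin_numE.
Qed.

Notation leb1 R := (@lebesgue_measure R).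

Definition leb2 (R : realType) := (leb1 R \x leb1 R)%E.
Arguments leb2 R : clear implicits.
HB.instance Definition _ (R : realType) := Measure.on (leb2 R).
HB.instance Definition _ (R : realType) := Measure_isSigmaFinite.Build _ _ _
  (leb2 R) (product_sigma_finite (leb1 R) (leb1 R)).

Definition leb3 (R : realType) := (leb1 R \x leb2 R)%E.
Arguments leb3 R : clear implicits.
HB.instance Definition _ (R : realType) := Measure.on (leb3 R).
HB.instance Definition _ (R : realType) := Measure_isSigmaFinite.Build _ _ _
  (leb3 R) (product_sigma_finite (leb1 R) (leb2 R)).

(* Iterated directional derivative along the vectors of w. *)
Definition iterD (R : realType) (V : normedModType R) (w : seq V)
    (f : V -> R) : V -> R :=
  foldr (fun v g => 'D_v g) f w.

(* C_c^oo(U): all iterated directional derivatives exist and are continuous,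
   and the support is a compact subset of U. *)
Definition test_fun (R : realType) (V : normedModType R) (U : set V)
    (phi : V -> R) : Prop :=
  (forall w : seq V, continuous (iterD w phi) /\
     forall p v, derivable (iterD w phi) p v) /\
  exists K : set V,
    [/\ compact K, K `<=` U & forall p, ~ K p -> phi p = 0].

(* The classical derivative \partial_x^i \partial_y^j f. *)
Definition pderiv (R : realType) (i j : nat) (f : R * R -> R) : R * R -> R :=
  @iterD R (R * R)%type (nseq i (1, 0) ++ nseq j (0, 1)) f.

Definition L2norm (R : realType) (L : R) (f : R * R -> R) : \bar R :=
  ('N[leb2 R]_2%:E [EFin \o (f \_ (strip L))])%E.

Definition L2fun (R : realType) (L : R) (f : R * R -> R) : Prop :=
  measurable_fun (strip L) f /\ (L2norm L f < +oo)%E.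

(* f and g belong to L^2(S_L) and g is the distributional derivative
   \partial_x^i \partial_y^j f on S_L. *)
Definition weakD (R : realType) (L : R) (i j : nat) (f g : R * R -> R) : Prop :=
  [/\ L2fun L f, L2fun L g &
      forall phi : R * R -> R, test_fun (strip L) phi ->
        \int[leb2 R]_(p in strip L) (f p * pderiv i j phi p) =
        (-1) ^+ (i + j) * \int[leb2 R]_(p in strip L) (g p * phi p)].

(* f belongs to H^k(S_L), with weak derivatives
   D i j = \partial_x^i \partial_y^j f for i + j <= k. *)
Definition Hderivs (R : realType) (L : R) (k : nat) (f : R * R -> R)
    (D : nat -> nat -> R * R -> R) : Prop :=
  forall i j, (i + j <= k)%N -> weakD L i j f (D i j).

(* The H^k(S_L) norm of a function, in terms of its derivatives D i j. *)
Definition Hnorm (R : realType) (L : R) (k : nat)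
    (D : nat -> nat -> R * R -> R) : \bar R :=
  ((\sum_(i < k.+1) \sum_(j < k.+1 | (i + j <= k)%N) L2norm L (D i j) ^+ 2)
     `^ 2^-1)%E.

(* The Bochner space L^p(0, T; H^k(S_L)), and L^p(0, T; L^2(S_L)) when k = 0.
   As H^k(S_L) is separable, strong measurability of t |-> f t amounts to
   joint measurability of the spatial derivatives of f. *)
Definition LpH (R : realType) (L : R) (p : \bar R) (k : nat) (T : R)
    (f : R -> R * R -> R) : Prop :=
  exists D : R -> nat -> nat -> R * R -> R,
    [/\ forall i j, (i + j <= k)%N ->
          measurable_fun (`]0, T[ `*` strip L) (fun z => D z.1 i j z.2),
        {ae leb1 R, forall t, 0 < t < T -> Hderivs L k (f t) (D t)} &
        ('N[leb1 R]_p [(fun t => Hnorm L k (D t)) \_ (`]0%R, T[ : set R)] < +oo)%E].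

(* ut is the distributional derivative of u with respect to t on
   (0, +oo) x S_L. *)
Definition weak_dt (R : realType) (L : R) (u ut : R -> R * R -> R) : Prop :=
  forall phi : R * (R * R) -> R, test_fun (cylinder L) phi ->
    \int[leb3 R]_(z in cylinder L)
      (u z.1 z.2 * 'D_((1, (0, 0)) : R * (R * R)) phi z) =
    - \int[leb3 R]_(z in cylinder L) (ut z.1 z.2 * phi z).

(* g is the trace of f \in H^1(S_L) on the line x = a, for a = 0 or a = L: the
   trace operator is the continuous extension to H^1(S_L) of the restriction
   phi |-> phi (a, .), phi \in C_c^oo(R^2). *)
Definition has_trace (R : realType) (L a : R) (f : R * R -> R) (g : R -> R) :
    Prop :=
  exists (D : nat -> nat -> R * R -> R) (phi : nat -> R * R -> R),
    [/\ Hderivs L 1 f D,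
        forall n, test_fun [set: R * R] (phi n),
        Hnorm L 1 (fun i j p => pderiv i j (phi n) p - D i j p)
          @[n --> \oo] --> 0%E &
        ('N[leb1 R]_2%:E [(fun y => (phi n (a, y) - g y)%:E)])%E
          @[n --> \oo] --> 0%E].

Definition jointly_measurable (R : realType) (L : R) (f : R -> R * R -> R) :
    Prop :=
  measurable_fun (cylinder L) (fun z => f z.1 z.2).

(* u t is the profile (x, y) |-> u(x, y, t); only t > 0 matters.  By
   rs_u_Linf_H2 and rs_ut_Linf_L2, u has a representative continuous in time
   with values in L^2(S_L); rs_cont says that u is this representative, so
   that u t is meaningful for every t > 0, and rs_init is the trace
   condition at t = 0. *)
Record solution_data (R : realType) (L : R) (u0 : R * R -> R)
    (u ut ux uxxx uxyy : R -> R * R -> R) : Prop := SolutionData {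
  rs_meas_u : jointly_measurable L u;
  rs_meas_ut : jointly_measurable L ut;
  rs_meas_ux : jointly_measurable L ux;
  rs_meas_uxxx : jointly_measurable L uxxx;
  rs_meas_uxyy : jointly_measurable L uxyy;
  rs_u_Linf_H2 : forall T, 0 < T -> LpH L +oo%E 2 T u;
  rs_u_L2_H3 : forall T, 0 < T -> LpH L 2%:E 3 T u;
  rs_ut : weak_dt L u ut;
  rs_ut_Linf_L2 : forall T, 0 < T -> LpH L +oo%E 0 T ut;
  rs_ut_L2_H1 : forall T, 0 < T -> LpH L 2%:E 1 T ut;
  rs_dx : {ae leb1 R, forall t, 0 < t ->
    [/\ weakD L 1 0 (u t) (ux t), weakD L 3 0 (u t) (uxxx t) &
        weakD L 1 2 (u t) (uxyy t)]};
  rs_Dux_Linf_L2 : forall T, 0 < T ->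
    LpH L +oo%E 0 T (fun t p => uxxx t p + uxyy t p);
  rs_Dux_L2_H1 : forall T, 0 < T ->
    LpH L 2%:E 1 T (fun t p => uxxx t p + uxyy t p);
  rs_eqn : {ae leb3 R, forall z, cylinder L z ->
    ut z.1 z.2 + (1 + u z.1 z.2) * ux z.1 z.2 + uxxx z.1 z.2 + uxyy z.1 z.2
    = 0};
  rs_bdry : {ae leb1 R, forall t, 0 < t ->
    [/\ has_trace L 0 (u t) (cst 0), has_trace L L (u t) (cst 0) &
        has_trace L L (ux t) (cst 0)]};
  rs_cont : forall t, 0 < t ->
    L2norm L (fun p => u s p - u t p) @[s --> t] --> 0%E;
  rs_init : L2norm L (fun p => u s p - u0 p) @[s --> 0^'+] --> 0%E
}.

Definition regular_solution (R : realType) (L : R) (u0 : R * R -> R)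
    (u : R -> R * R -> R) : Prop :=
  exists ut ux uxxx uxyy, solution_data L u0 u ut ux uxxx uxyy.

(* Main.v *)
Require Import Defs.
From mathcomp Require Import all_boot all_order all_algebra.
From mathcomp Require Import all_classical all_reals all_analysis.
From mathcomp Require Import measurable_realfun ess_sup_inf ring lra.
Set Implicit Arguments.
Unset Strict Implicit.
Unset Printing Implicit Defensive.
Import Order.TTheory GRing.Theory Num.Theory.
Import numFieldNormedType.Exports.
Local Open Scope classical_set_scope.
Local Open Scope ring_scope.

(* Multiplying the equation by 2 (1 + x) u and integrating by parts gives, for
   almost every t, with the weighted energy E = ((1 + x), u^2),
     E' + 3 |u_x|^2 + |u_y|^2 + u_x(0, .)^2 <= |u|^2 + (2 / 3) |u|_3^3.
   The boundary conditions give the Poincare inequality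
   |u|^2 <= (L^2 / 8) |u_x|^2 and the anisotropic Ladyzhenskaya inequality, hence
   |u|_3^12 <= 16 |u|^8 |u_x|^2 |u_y|^2.  As long as E stays below the threshold
   the right-hand side is absorbed, up to E' <= - A^2 |u|^2 <= - (A^2 / (1 + L)) E;
   so E decreases, never reaches the threshold, and decays exponentially.

   To justify these computations for distributional derivatives, one tests with
   tensor products: by Fubini and du Bois-Reymond, almost every slice of u in x,
   in y or in t is an absolutely continuous function of one variable, and all
   the integrations by parts are done on slices.  A zero trace means that almost
   every slice in x vanishes at the corresponding end. *)

(** The weight makes the equation dissipative: integrated by parts against the third-order terms,
    the [x] in [1 + x] leaves [3 |u_x|^2 + |u_y|^2], while the [1] yields the boundary term, which
    has the good sign. Apart from the cubic term the only loss is [|u|^2], due to the transport term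
    [u_x].

    The number 24 is 3 times 8: with the Poincare constant [L^2 / 8], one has [3 |u_x|^2 - |u|^2 >=
    (24 / L^2 - 1) |u|^2 = 2 A^2 |u|^2]. Half of this is kept as the decay; the other half, together
    with [|u_y|^2], must absorb the cubic term, and the threshold on the energy is what this takes.
    As [1 <= 1 + x <= 1 + L], returning from [|u|^2] to the energy divides the rate by [1 + L].

    The obstacle throughout is null sets. A weak identity tested with one function holds on slices
    off a null set that depends on this function, so all test functions are drawn from countable
    families. In time, the differential inequality holds almost everywhere and only below the
    threshold, and nothing is known of [u] at time 0 itself, only of its limit from the right. *)

(* The library hint for this filter does not fire when the points of the
   measure space have type R instead of measurableTypeR R. *)
Lemma ae_lebesgue_filter (R : realType) :
  Filter (almost_everywhere (@lebesgue_measure R)).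
Proof. exact: (@ae_filter_ringOfSetsType _ (measurableTypeR R)). Qed.

Lemma ae_leb2_filter (R : realType) : Filter (almost_everywhere (leb2 R)).
Proof.
exact: (@ae_filter_ringOfSetsType _ (measurableTypeR R * measurableTypeR R)%type).
Qed.

Lemma ae_leb3_filter (R : realType) : Filter (almost_everywhere (leb3 R)).
Proof.
exact: (@ae_filter_ringOfSetsType _
  (measurableTypeR R * (measurableTypeR R * measurableTypeR R))%type).
Qed.

#[global] Hint Extern 0 (Filter (nbhs (almost_everywhere _))) =>
  (first [exact: ae_lebesgue_filter|exact: ae_leb2_filter|exact: ae_leb3_filter]) : typeclass_instances.
#[global] Hint Extern 0 (Filter (almost_everywhere _)) =>
  (first [exact: ae_lebesgue_filter|exact: ae_leb2_filter|exact: ae_leb3_filter]) : typeclass_instances.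

(** * Measure theory *)

Section measure_lemmas.
Context d (T : measurableType d) (R : realType).
Variable mu : {measure set T -> \bar R}.

Lemma integrable_measurable (D : set T) (f : T -> R) :
  mu.-integrable D (EFin \o f) -> measurable_fun D f.
Proof. by move=> /measurable_int /measurable_EFinP. Qed.

Lemma EFin_Rintegral (D : set T) (f : T -> R) : measurable D ->
  mu.-integrable D (EFin \o f) ->
  (\int[mu]_(x in D) f x)%:E = (\int[mu]_(x in D) (f x)%:E)%E.
Proof. by move=> mD fi; rewrite /Rintegral fineK//; exact: integrable_fin_num. Qed.

Lemma le_integrable_normr (D : set T) (f g : T -> R) : measurable D ->
  measurable_fun D f -> (forall x, D x -> `|f x| <= g x) ->
  mu.-integrable D (EFin \o g) -> mu.-integrable D (EFin \o f).
Proof.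
move=> mD mf fg; apply: le_integrable => //; first exact/measurable_EFinP.
by move=> x Dx /=; rewrite lee_fin (le_trans (fg x Dx))// ler_norm.
Qed.

Lemma ge0_integrableP (D : set T) (f : T -> R) : measurable_fun D f ->
  (forall x, D x -> 0 <= f x) ->
  mu.-integrable D (EFin \o f) <-> (\int[mu]_(x in D) (f x)%:E < +oo)%E.
Proof.
move=> mf f0; have E : (\int[mu]_(x in D) (f x)%:E = \int[mu]_(x in D) `|(f x)%:E|)%E.
  by apply: eq_integral => x /set_mem Dx /=; rewrite ger0_norm// f0.
split=> [/integrableP[_]|]; first by rewrite E.
by rewrite E => h; apply/integrableP; split => //; exact/measurable_EFinP.
Qed.

Lemma integrable_funM (D : set T) (f g : T -> R) (M : R) : measurable D ->
  mu.-integrable D (EFin \o f) -> measurable_fun D g ->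
  (forall x, D x -> `|g x| <= M) -> mu.-integrable D (EFin \o (fun x => f x * g x)).
Proof.
move=> mD fi mg gM.
apply: (@le_integrable_normr D _ (fun x => M * `|f x|)) => //.
- by apply: measurable_funM => //; exact: integrable_measurable fi.
- by move=> x Dx; rewrite normrM mulrC ler_wpM2r// gM.
- have := integrableZl mD M (integrable_norm fi).
  by apply: eq_integrable.
Qed.

Lemma integrable_funD (D : set T) (f g : T -> R) : measurable D ->
  mu.-integrable D (EFin \o f) -> mu.-integrable D (EFin \o g) ->
  mu.-integrable D (EFin \o (fun x => f x + g x)).
Proof. by move=> mD fi gi; have := integrableD mD fi gi; apply: eq_integrable. Qed.

Lemma integrable_funB (D : set T) (f g : T -> R) : measurable D ->
  mu.-integrable D (EFin \o f) -> mu.-integrable D (EFin \o g) ->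
  mu.-integrable D (EFin \o (fun x => f x - g x)).
Proof. by move=> mD fi gi; have := integrableB mD fi gi; apply: eq_integrable. Qed.

Lemma integrable_funZ (D : set T) (f : T -> R) (k : R) : measurable D ->
  mu.-integrable D (EFin \o f) -> mu.-integrable D (EFin \o (fun x => k * f x)).
Proof. by move=> mD fi; have := integrableZl mD k fi; apply: eq_integrable. Qed.

Lemma ae_eq_Rintegral (D : set T) (f g : T -> R) : measurable D ->
  measurable_fun D f -> measurable_fun D g ->
  {ae mu, forall x, D x -> f x = g x} ->
  \int[mu]_(x in D) f x = \int[mu]_(x in D) g x.
Proof.
move=> mD mf mg fg; rewrite /Rintegral; congr fine; apply: ae_eq_integral => //.
- exact/measurable_EFinP.
- exact/measurable_EFinP.
- by apply: filterS fg => x h Dx; rewrite h.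
Qed.

Lemma ae_eq_integrable (D : set T) (f g : T -> R) : measurable D ->
  measurable_fun D g ->
  {ae mu, forall x, D x -> f x = g x} ->
  mu.-integrable D (EFin \o f) -> mu.-integrable D (EFin \o g).
Proof.
move=> mD mg fg fi; apply/integrableP; split; first exact/measurable_EFinP.
rewrite (_ : (\int[mu]_(x in D) _ = \int[mu]_(x in D) `|(f x)%:E|)%E).
  by case/integrableP : fi.
have mf := integrable_measurable fi.
apply: ae_eq_integral => //.
- by apply/measurable_EFinP/measurableT_comp.
- by apply/measurable_EFinP/measurableT_comp.
- by apply: filterS fg => x h Dx /=; rewrite h.
Qed.

(** Replacing [g] by the maximum of [f] and [g], to which it is almost everywhere equal, makes the
    inequality hold pointwise. *)
Lemma ae_le_Rintegral (D : set T) (f g : T -> R) : measurable D ->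
  mu.-integrable D (EFin \o f) -> mu.-integrable D (EFin \o g) ->
  {ae mu, forall x, D x -> f x <= g x} ->
  \int[mu]_(x in D) f x <= \int[mu]_(x in D) g x.
Proof.
move=> mD fi gi fg.
have mf := integrable_measurable fi; have mg := integrable_measurable gi.
have mi : mu.-integrable D (EFin \o (fun x => Num.max (f x) (g x))).
  apply: (@le_integrable_normr D _ (fun x => `|f x| + `|g x|)) => //.
  - exact: measurable_maxr.
  - move=> x _; case: (leP (f x) (g x)) => _; by rewrite ?lerDl ?lerDr.
  - by apply: integrable_funD => //; exact: integrable_norm.
rewrite [leRHS](@ae_eq_Rintegral D _ (fun x => Num.max (f x) (g x)))//.
- by apply: le_Rintegral => // x _; rewrite le_max lexx.
- exact: measurable_maxr.
- by apply: filterS fg => x h Dx; apply/esym/max_idPr/h.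
Qed.

Lemma integrable_restrictT (D : set T) (f : T -> R) : measurable D ->
  mu.-integrable D (EFin \o f) <-> mu.-integrable setT (EFin \o (f \_ D)).
Proof.
move=> mD; rewrite (_ : EFin \o (f \_ D) = (EFin \o f) \_ D).
  exact: integrable_mkcond.
by rewrite restrict_EFin.
Qed.

Lemma Rintegral_ge0_eq0 (D : set T) (f : T -> R) : measurable D ->
  mu.-integrable D (EFin \o f) -> (forall x, D x -> 0 <= f x) ->
  \int[mu]_(x in D) f x = 0 -> {ae mu, forall x, D x -> f x = 0}.
Proof.
move=> mD fi f0 h.
have mf : measurable_fun D (EFin \o f) by exact: measurable_int fi.
have := (ae_eq_integral_abs mu mD mf).1.
rewrite (_ : (\int[mu]_(x in D) _ = 0)%E) => [/(_ erefl)|].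
  by apply: filterS => x hx Dx; have [] := hx Dx.
transitivity (\int[mu]_(x in D) (f x)%:E)%E; last by rewrite -EFin_Rintegral// h.
by apply: eq_integral => x /set_mem Dx /=; rewrite ger0_norm// f0.
Qed.

End measure_lemmas.

(** * Square-integrable functions and the Cauchy-Schwarz inequality *)

Section L2.
Context d (T : measurableType d) (R : realType).
Variable mu : {measure set T -> \bar R}.

Definition L2 (D : set T) (f : T -> R) :=
  measurable_fun D f /\ mu.-integrable D (EFin \o (fun x => f x ^+ 2)).

Implicit Types (f g : T -> R) (D : set T).

Lemma L2_prod D f g : measurable D -> L2 D f -> L2 D g ->
  mu.-integrable D (EFin \o (fun x => f x * g x)).
Proof.
move=> mD [mf fi] [mg gi].
apply: (@le_integrable_normr _ _ _ _ D _ (fun x => f x ^+ 2 + g x ^+ 2)) => //.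
- exact: measurable_funM.
- move=> x _; rewrite normrM -(real_normK (num_real (f x))).
  rewrite -(real_normK (num_real (g x))).
  have := sqr_ge0 (`|f x| - `|g x|); rewrite sqrrB.
  have := normr_ge0 (f x); have := normr_ge0 (g x); nra.
- exact: integrable_funD.
Qed.

Lemma L2D D f g : measurable D -> L2 D f -> L2 D g -> L2 D (fun x => f x + g x).
Proof.
move=> mD lf lg; have fg := L2_prod mD lf lg.
case: lf lg => mf fi [mg gi]; split; first exact: measurable_funD.
have := integrable_funD mD (integrable_funD mD fi (integrable_funZ 2 mD fg)) gi.
by apply: eq_integrable => // x _ /=; congr EFin; ring.
Qed.

Lemma L2M D f g (M : R) : measurable D -> L2 D f -> measurable_fun D g ->
  (forall x, D x -> `|g x| <= M) -> L2 D (fun x => f x * g x).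
Proof.
move=> mD [mf fi] mg gM; split; first exact: measurable_funM.
have := @integrable_funM _ _ _ mu D _ (fun x => g x ^+ 2) (M ^+ 2) mD fi.
move=> /(_ (measurable_funX _ mg)) h.
apply: eq_integrable (h _) => //; first by move=> x _ /=; rewrite exprMn.
by move=> x Dx; rewrite normrX lerXn2r ?nnegrE ?gM// (le_trans _ (gM x Dx)).
Qed.

Lemma L2Z D f (k : R) : measurable D -> L2 D f -> L2 D (fun x => k * f x).
Proof.
move=> mD lf; under eq_fun do rewrite mulrC.
by apply: (@L2M D f (cst k) `|k|).
Qed.

Lemma L2B D f g : measurable D -> L2 D f -> L2 D g -> L2 D (fun x => f x - g x).
Proof.
move=> mD lf lg; have := L2D mD lf (L2Z (-1) mD lg).
by under eq_fun do rewrite mulN1r.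
Qed.

Lemma L2_norm D f : L2 D f -> L2 D (fun x => `|f x|).
Proof.
move=> [mf fi]; split; first exact: measurableT_comp.
by under eq_fun do rewrite /= real_normK ?num_real//.
Qed.

Lemma Rintegral_sqr_ge0 D f : 0 <= \int[mu]_(x in D) f x ^+ 2.
Proof. by apply: Rintegral_ge0 => x _; exact: sqr_ge0. Qed.

(** The quadratic form [s, t |-> \int (s f + t g)^2] is nonnegative; its value at [s = - C], [t = A]
    is [A (A B - C^2)]. *)
Lemma cauchy_schwarz D f g : measurable D -> L2 D f -> L2 D g ->
  (\int[mu]_(x in D) (f x * g x)) ^+ 2 <=
  (\int[mu]_(x in D) f x ^+ 2) * (\int[mu]_(x in D) g x ^+ 2).
Proof.
move=> mD lf lg; have fg := L2_prod mD lf lg.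
have [mf fi] := lf; have [mg gi] := lg.
set A := \int[mu]_(x in D) f x ^+ 2; set B := \int[mu]_(x in D) g x ^+ 2.
set C := \int[mu]_(x in D) (f x * g x).
have P (s t : R) : 0 <= s ^+ 2 * A + 2 * s * t * C + t ^+ 2 * B.
  have <- : \int[mu]_(x in D) (s * f x + t * g x) ^+ 2 =
      s ^+ 2 * A + 2 * s * t * C + t ^+ 2 * B.
    rewrite /A /B /C -!RintegralZl// -!RintegralD//.
    - by apply: eq_Rintegral => x _; ring.
    - by apply: integrable_funD => //; apply: integrable_funZ.
    - exact: integrable_funZ.
    - exact: integrable_funZ.
    - exact: integrable_funZ.
  exact: Rintegral_sqr_ge0.
have A0 : 0 <= A := Rintegral_sqr_ge0 _ _.
have B0 : 0 <= B := Rintegral_sqr_ge0 _ _.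
have [A00|A00] := eqVneq A 0.
  (* With [A = 0] and [t = 1] the form is affine in [s], and this [s] would give it the value -1
     unless [C = 0]. *)
  have := P (- (B + 1) / (2 * C)) 1; rewrite A00.
  have [->|C0] := eqVneq C 0; first by rewrite mul0r expr0n.
  have -> : (- (B + 1) / (2 * C)) ^+ 2 * 0 + 2 * (- (B + 1) / (2 * C)) * 1 * C + 1 ^+ 2 * B = -1.
    by field.
  by rewrite ler0N1.
have A1 : 0 < A by rewrite lt_def A00.
have := P (- C) A.
have -> : (- C) ^+ 2 * A + 2 * - C * A * C + A ^+ 2 * B = A * (A * B - C ^+ 2) by ring.
by rewrite pmulr_rge0// subr_ge0.
Qed.

End L2.
Arguments L2 {d T R} mu D f.

(** * The Fubini theorem for real-valued integrals *)

Section fubini.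
Context d1 d2 (T1 : measurableType d1) (T2 : measurableType d2) (R : realType).
Variable m1 : {sigma_finite_measure set T1 -> \bar R}.
Variable m2 : {sigma_finite_measure set T2 -> \bar R}.
Variable f : T1 * T2 -> R.
Hypothesis fi : (m1 \x m2)%E.-integrable setT (EFin \o f).

Lemma ae_slice1 : {ae m1, forall x, m2.-integrable setT (EFin \o (fun y => f (x, y)))}.
Proof. exact: ae_integrable1 fi. Qed.

Lemma ae_slice2 : {ae m2, forall y, m1.-integrable setT (EFin \o (fun x => f (x, y)))}.
Proof. exact: ae_integrable2 fi. Qed.

Lemma measurable_Rslice1 : measurable_fun setT (fun x => \int[m2]_y f (x, y)).
Proof. by apply: measurableT_comp => //; exact: measurable_fubini_F fi. Qed.

Lemma measurable_Rslice2 : measurable_fun setT (fun y => \int[m1]_x f (x, y)).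
Proof. by apply: measurableT_comp => //; exact: measurable_fubini_G fi. Qed.

(** On the null set of non-integrable slices the real integral takes a default value, unrelated to
    the extended one; the transfer of the library results to real integrals goes through this almost
    everywhere equality. *)
Lemma ae_fubini_F : {ae m1, forall x, setT x ->
  fubini_F m2 (EFin \o f) x = (\int[m2]_y f (x, y))%:E}.
Proof. by apply: filterS ae_slice1 => x h _; rewrite EFin_Rintegral. Qed.

Lemma ae_fubini_G : {ae m2, forall y, setT y ->
  fubini_G m1 (EFin \o f) y = (\int[m1]_x f (x, y))%:E}.
Proof. by apply: filterS ae_slice2 => x h _; rewrite EFin_Rintegral. Qed.

Lemma integrable_Rslice1 : m1.-integrable setT (EFin \o (fun x => \int[m2]_y f (x, y))).
Proof.
have /integrableP[mF Fi] := integrable_fubini_F fi.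
have mG := measurable_Rslice1.
apply/integrableP; split; first exact/measurable_EFinP.
rewrite (_ : (\int[m1]_x _ = \int[m1]_x `|fubini_F m2 (EFin \o f) x|)%E)//.
apply: ae_eq_integral => //.
- by apply/measurable_EFinP/measurableT_comp.
- exact: measurableT_comp.
- by apply: filterS ae_fubini_F => x /[apply] /= ->.
Qed.

Lemma integrable_Rslice2 : m2.-integrable setT (EFin \o (fun y => \int[m1]_x f (x, y))).
Proof.
have mG := measurable_Rslice2.
have mf := measurable_int _ fi.
apply/integrableP; split; first exact/measurable_EFinP.
apply: le_lt_trans ((integrable21ltyP m1 m2 mf).1 fi).
apply: ae_ge0_le_integral => //.
- by apply/measurable_EFinP/measurableT_comp.
- by move=> *; exact: integral_ge0.
- apply: (measurable_fun_fubini_tonelli_G (abse \o (EFin \o f))) => //.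
  exact: measurableT_comp.
- by move=> z; exact: abse_ge0.
- apply: filterS ae_slice2 => y hy _ /=.
  rewrite -[`|_|%:E]/(`|(_)%:E|)%E EFin_Rintegral//; apply: le_abse_integral => //.
  exact: measurable_int hy.
Qed.

Lemma Rfubini1 : \int[m1]_x \int[m2]_y f (x, y) = \int[(m1 \x m2)%E]_z f z.
Proof.
rewrite /Rintegral; congr fine; rewrite -(integral12_prod_meas1 fi).
apply: ae_eq_integral => //.
- exact/measurable_EFinP/measurable_Rslice1.
- exact: (measurable_fubini_F fi).
- by apply: filterS ae_fubini_F => x /[apply] ->.
Qed.

Lemma Rfubini2 : \int[m2]_y \int[m1]_x f (x, y) = \int[(m1 \x m2)%E]_z f z.
Proof.
rewrite /Rintegral; congr fine; rewrite -(integral21_prod_meas1 fi).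
apply: ae_eq_integral => //.
- exact/measurable_EFinP/measurable_Rslice2.
- exact: (measurable_fubini_G fi).
- by apply: filterS ae_fubini_G => x /[apply] ->.
Qed.

Lemma Rfubini : \int[m1]_x \int[m2]_y f (x, y) = \int[m2]_y \int[m1]_x f (x, y).
Proof. by rewrite Rfubini1 Rfubini2. Qed.

End fubini.

Section ae_product.
Context d1 d2 (T1 : measurableType d1) (T2 : measurableType d2) (R : realType).
Variable m1 : {sigma_finite_measure set T1 -> \bar R}.
Variable m2 : {sigma_finite_measure set T2 -> \bar R}.

(** The measures of the sections of a null set [N] integrate to the measure of [N], so almost all of
    these sections are null. *)
Lemma ae_prod1 (P : T1 * T2 -> Prop) : {ae (m1 \x m2)%E, forall z, P z} ->
  {ae m1, forall x, {ae m2, forall y, P (x, y)}}.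
Proof.
move=> [N [mN N0 PN]].
have : {ae m1, forall x, setT x -> m2 (xsection N x) = 0%E}.
  have := (ae_eq_integral_abs m1 measurableT (measurable_fun_xsection m2 mN)).1.
  apply; rewrite -[RHS]N0 /product_measure1.
  by apply: eq_integral => x _ /=; rewrite gee0_abs.
apply: filterS => x /(_ I) h; exists (xsection N x); split => //.
  exact: measurable_xsection.
by move=> y /= Pxy; rewrite /xsection/= inE; apply: PN.
Qed.

Lemma ae_prod2 (P : T1 * T2 -> Prop) : {ae (m1 \x m2)%E, forall z, P z} ->
  {ae m2, forall y, {ae m1, forall x, P (x, y)}}.
Proof.
move=> [N [mN N0 PN]].
have : {ae m2, forall x, setT x -> m1 (ysection N x) = 0%E}.
  have := (ae_eq_integral_abs m2 measurableT (measurable_fun_ysection m1 mN)).1.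
  apply; rewrite -[RHS]N0.
  (* The product measure is defined through sections in one variable; uniqueness allows sections in
     the other. *)
  have -> : (m1 \x m2)%E N = (m1 \x^ m2)%E N.
    by apply: (@product_measure_unique _ _ _ _ _ m1 m2 (m1 \x^ m2)%E) => // A B mA mB; exact: product_measure2E.
  rewrite /product_measure2.
  by apply: eq_integral => x _ /=; rewrite gee0_abs.
apply: filterS => x /(_ I) h; exists (ysection N x); split => //.
  exact: measurable_ysection.
by move=> y /= Pxy; rewrite /ysection/= inE; apply: PN.
Qed.

(** Measurability of [P] is what allows the measure of its complement to be computed from the
    sections. *)
Lemma prod_ae1 (P : set (T1 * T2)) : measurable P ->
  {ae m1, forall x, {ae m2, forall y, P (x, y)}} ->
  {ae (m1 \x m2)%E, forall z, P z}.
Proof.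
move=> mP h; exists (~` P); split => //; first exact: measurableC.
rewrite /product_measure1 (@ae_eq_integral _ _ _ m1 setT (cst 0%E))//.
- by rewrite integral0.
- exact/measurable_fun_xsection/measurableC.
- apply: filterS h => x [N [mN N0 NP]] _ /=.
  apply/eqP; rewrite -measure_le0 -N0 le_measure// ?inE//.
  + exact/measurable_xsection/measurableC.
  + by move=> y; rewrite /xsection/= inE => ?; exact: NP.
Qed.

Lemma prod_ae2 (P : set (T1 * T2)) : measurable P ->
  {ae m2, forall y, {ae m1, forall x, P (x, y)}} ->
  {ae (m1 \x m2)%E, forall z, P z}.
Proof.
move=> mP h; exists (~` P); split => //; first exact: measurableC.
have -> : (m1 \x m2)%E (~` P) = (m1 \x^ m2)%E (~` P).
  apply: (@product_measure_unique _ _ _ _ _ m1 m2 (m1 \x^ m2)%E) => //; last exact: measurableC.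
  by move=> A B mA mB; exact: product_measure2E.
rewrite /product_measure2 (@ae_eq_integral _ _ _ m2 setT (cst 0%E))//.
- by rewrite integral0.
- exact/measurable_fun_ysection/measurableC.
- apply: filterS h => x [N [mN N0 NP]] _ /=.
  apply/eqP; rewrite -measure_le0 -N0 le_measure// ?inE//.
  + exact/measurable_ysection/measurableC.
  + by move=> y; rewrite /ysection/= inE => ?; exact: NP.
Qed.

End ae_product.

Section tensor.
Context d1 d2 (T1 : measurableType d1) (T2 : measurableType d2) (R : realType).
Variable m1 : {sigma_finite_measure set T1 -> \bar R}.
Variable m2 : {sigma_finite_measure set T2 -> \bar R}.

Lemma integrable_tensor (f : T1 -> R) (g : T2 -> R) :
  m1.-integrable setT (EFin \o f) -> m2.-integrable setT (EFin \o g) ->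
  (m1 \x m2)%E.-integrable setT (EFin \o (fun z => f z.1 * g z.2)).
Proof.
move=> fi gi; have mf := integrable_measurable fi; have mg := integrable_measurable gi.
apply/integrable12ltyP.
  apply/measurable_EFinP/measurable_funM.
  - exact: measurableT_comp mf measurable_fst.
  - exact: measurableT_comp mg measurable_snd.
have gfin : (\int[m2]_y `|(g y)%:E| < +oo)%E by case/integrableP : gi.
have g0 : (0 <= \int[m2]_y `|(g y)%:E|)%E by exact: integral_ge0.
rewrite (_ : (\int[m1]_x _ = \int[m1]_x (`|(f x)%:E| * \int[m2]_y `|(g y)%:E|))%E).
  rewrite ge0_integralZr//.
  - by apply: lte_mul_pinfty => //; [exact: integral_ge0|rewrite ge0_fin_numE//; [case/integrableP : fi|exact: integral_ge0]].
  - by apply/measurable_EFinP/measurableT_comp.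
apply: eq_integral => x _ /=; rewrite -ge0_integralZl//.
- by apply: eq_integral => y _; rewrite normrM EFinM.
- by apply/measurable_EFinP/measurableT_comp.
Qed.

End tensor.

(** * Absolutely continuous functions on an interval *)

Section calculus.
Context {R : realType}.
Notation mu := (@lebesgue_measure R).
Implicit Types (a b c x y : R) (f g F G : R -> R).

Lemma restrictE0 (T : Type) (D : set T) (f : T -> R) (x : T) :
  (f \_ D) x = if x \in D then f x else 0.
Proof. exact: patchE. Qed.

Lemma restrict_itvE a b f x :
  (f \_ `[a, b]) x = if a <= x <= b then f x else 0.
Proof. by rewrite patchE mem_setE in_itv. Qed.

(* F is absolutely continuous on [a, b], with derivative f. *)
Definition isint a b F f :=
  mu.-integrable `[a, b] (EFin \o f) /\
  forall x, a <= x <= b -> F x = F a + \int[mu]_(s in `[a, x]) f s.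

Lemma integrable_itvT a b f : mu.-integrable `[a, b] (EFin \o f) ->
  mu.-integrable setT (EFin \o (f \_ `[a, b])).
Proof. by move=> fi; exact: (@integrable_restrictT _ _ _ mu `[a, b] f (measurable_itv _)).1. Qed.

Lemma integrable_sub_itv a b c d' f : a <= c -> d' <= b ->
  mu.-integrable `[a, b] (EFin \o f) -> mu.-integrable `[c, d'] (EFin \o f).
Proof.
move=> ac db; apply: integrableS => //.
by move=> x /=; rewrite !in_itv/= => /andP[cx xd]; rewrite (le_trans ac)//= (le_trans xd).
Qed.

Lemma Rintegral_itv_cat a c b f : a <= c <= b -> mu.-integrable `[a, b] (EFin \o f) ->
  \int[mu]_(s in `[a, b]) f s =
  \int[mu]_(s in `[a, c]) f s + \int[mu]_(s in `[c, b]) f s.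
Proof.
move=> /andP[ac cb] fi.
rewrite -(@Rintegral_itv_obnd_cbnd _ c); last first.
  apply: integrableS fi => //.
  by move=> x /=; rewrite !in_itv/= => /andP[cx ->]; rewrite (le_trans ac)// ltW.
by rewrite -(@Rintegral_itvB _ f (BLeft a) (BRight b))// addrC subrK.
Qed.

Lemma Rintegral_itv0 a f : \int[mu]_(s in `[a, a]) f s = 0.
Proof. by rewrite set_itv1 Rintegral_set1. Qed.

Lemma isint_itv a b F f : isint a b F f -> forall x y, a <= x -> x <= y -> y <= b ->
  F y = F x + \int[mu]_(s in `[x, y]) f s.
Proof.
move=> [fi FE] x y ax xy yb; rewrite (FE y) ?(le_trans ax xy)//.
rewrite (FE x) ?ax ?(le_trans xy)// -addrA; congr (_ + _).
by apply: Rintegral_itv_cat; [rewrite ax|exact: integrable_sub_itv fi].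
Qed.

Lemma isint_sub a b c d' F f : a <= c -> c <= d' -> d' <= b ->
  isint a b F f -> isint c d' F f.
Proof.
move=> ac cd db Ff; split; first by apply: integrable_sub_itv Ff.1.
by move=> x /andP[cx xd]; apply: (isint_itv Ff) => //; exact: le_trans db.
Qed.

Lemma isint_bounded a b F f : a <= b -> isint a b F f ->
  exists2 M, 0 <= M & forall x, a <= x <= b -> `|F x| <= M.
Proof.
move=> ab [fi FE]; exists (`|F a| + \int[mu]_(s in `[a, b]) `|f s|).
  by rewrite addr_ge0// Rintegral_ge0.
move=> x /andP[ax xb]; rewrite FE ?ax// (le_trans (ler_normD _ _))// lerD2l.
have fxi : mu.-integrable `[a, x] (EFin \o f) by exact: integrable_sub_itv fi.
rewrite (le_trans (le_normr_Rintegral _ fxi))//.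
rewrite (@Rintegral_itv_cat a x b) ?ax//; first by rewrite lerDl Rintegral_ge0.
exact: integrable_norm.
Qed.

Lemma isint_continuous a b F f : a <= b -> isint a b F f ->
  {within `[a, b], continuous F}.
Proof.
move=> ab [fi FE].
have h := parameterized_integral_continuous ab fi.
have h' : {within `[a, b], continuous (fun x => F a + \int[mu]_(s in `[a, x]) f s)}.
  by move=> x; apply: cvgD; [exact: cvg_cst|exact: h].
apply: subspace_eq_continuous h' => x; rewrite inE/= in_itv/= => xab.
first [exact: FE|exact/esym/FE].
Qed.

Lemma isint_measurable a b F f : a <= b -> isint a b F f -> measurable_fun `[a, b] F.
Proof. by move=> ab Ff; apply: subspace_continuous_measurable_fun => //; exact: isint_continuous Ff. Qed.

Lemma isint_integrable a b F f : a <= b -> isint a b F f ->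
  mu.-integrable `[a, b] (EFin \o F).
Proof.
move=> ab Ff; apply: continuous_compact_integrable; first exact: segment_compact.
exact: isint_continuous Ff.
Qed.

Lemma integrable_isintM a b F f g : a <= b -> isint a b F f ->
  mu.-integrable `[a, b] (EFin \o g) ->
  mu.-integrable `[a, b] (EFin \o (fun x => g x * F x)).
Proof.
move=> ab Ff gi; have [M _ FM] := isint_bounded ab Ff.
by apply: (@integrable_funM _ _ _ _ _ _ _ M) => //; exact: isint_measurable Ff.
Qed.

Let tri1 : measurable_fun [set: (measurableTypeR R) * (measurableTypeR R)]
  (fun z => ((z.2 <= z.1)%R : nat)%:R : R).
Proof.
apply: (@measurableT_comp _ _ _ _ _ _ (fun b : bool => (b : nat)%:R : R)) => //.
by apply: measurable_fun_ler; [exact: measurable_snd|exact: measurable_fst].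
Qed.

(** The left-hand side is the integral of [f(s) g(r)] over the square [[a, x]^2]. The diagonal cuts
    the square into two triangles, and Fubini turns each of them into one of the terms on the right:
    integration by parts without differentiating any primitive. *)
Let prim_mul a x f g : a <= x -> mu.-integrable `[a, x] (EFin \o f) ->
  mu.-integrable `[a, x] (EFin \o g) ->
  (\int[mu]_(s in `[a, x]) f s) * (\int[mu]_(s in `[a, x]) g s) =
  \int[mu]_(s in `[a, x]) (f s * \int[mu]_(r in `[a, s]) g r) +
  \int[mu]_(s in `[a, x]) (g s * \int[mu]_(r in `[a, s]) f r).
Proof.
move=> ax fi gi.
pose f0 := f \_ `[a, x]; pose g0 := g \_ `[a, x].
have f0i : mu.-integrable setT (EFin \o f0) := integrable_itvT fi.
have g0i : mu.-integrable setT (EFin \o g0) := integrable_itvT gi.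
have ki := integrable_tensor f0i g0i.
pose k := (fun z : R * R => f0 z.1 * g0 z.2).
pose t := (fun z : R * R => ((z.2 <= z.1)%R : nat)%:R : R).
have t1 z : `|t z| <= 1.
  by rewrite /t; case: (z.2 <= z.1); rewrite /= ?normr0 ?normr1 ?ler01.
pose h := (fun z : R * R => k z * t z).
pose h' := (fun z : R * R => k z - h z).
have hi : (mu \x mu)%E.-integrable setT (EFin \o h).
  exact: (@integrable_funM _ _ _ (mu \x mu)%E setT k t 1 measurableT ki tri1).
have h'i : (mu \x mu)%E.-integrable setT (EFin \o h') by exact: integrable_funB.
have E1 : \int[mu]_(s in `[a, x]) (f s * \int[mu]_(r in `[a, s]) g r) =
    \int[(mu \x mu)%E]_z h z.
  rewrite -(Rfubini1 hi) [LHS]Rintegral_mkcond; apply: eq_Rintegral => s _.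
  rewrite /h /k /t /= /f0 !restrict_itvE; case: ifPn => [/andP[as_ sx]|sax]; last first.
    rewrite (_ : (fun _ => _) = cst 0) ?Rintegral_cst ?mul0r//.
    by apply/funext => r; rewrite !mul0r.
  under [RHS]eq_Rintegral do rewrite -mulrA.
  rewrite RintegralZl//; last first.
    apply: (@integrable_funM _ _ _ mu setT g0 (fun r => t (s, r)) 1) => //.
    exact: measurableT_comp tri1 (measurable_pair1 s).
  congr (_ * _); rewrite [LHS]Rintegral_mkcond; apply: eq_Rintegral => r _.
  rewrite /g0 !restrict_itvE; case: (leP a r) => //= ar; last by rewrite mul0r.
  case: (leP r s) => rs; last by rewrite mulr0.
  by rewrite (le_trans rs sx) mulr1.
have E2 : \int[mu]_(s in `[a, x]) (g s * \int[mu]_(r in `[a, s]) f r) =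
    \int[(mu \x mu)%E]_z h' z.
  rewrite -(Rfubini2 h'i) [LHS]Rintegral_mkcond; apply: eq_Rintegral => s _.
  rewrite /h' /h /k /t /= /g0 !restrict_itvE; case: ifPn => [/andP[as_ sx]|sax]; last first.
    rewrite (_ : (fun _ => _) = cst 0) ?Rintegral_cst ?mul0r//.
    by apply/funext => r; rewrite !(mulr0, mul0r) subr0.
  (* The second triangle excludes the diagonal, hence the open interval; the point [s] is added back
     as a null set. *)
  transitivity (\int[mu]_r (g s * (f0 \_ `]-oo, s[) r)); last first.
    apply: eq_Rintegral => r _; rewrite restrictE0 mem_setE in_itv/= ltNge.
    by rewrite -/(f0 r); case: (s <= r) => /=; ring.
  rewrite RintegralZl//; last first.
    by apply: (@integrable_restrictT _ _ _ mu _ f0 (measurable_itv _)).1; apply: integrableS f0i.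
  congr (_ * _); rewrite -Rintegral_itv_bndo_bndc; last first.
    apply: integrableS fi => // r /=; rewrite !in_itv/= => /andP[-> rs].
    by rewrite (le_trans (ltW rs)).
  rewrite [LHS]Rintegral_mkcond; apply: eq_Rintegral => r _.
  rewrite /f0 !restrictE0 !mem_setE !in_itv/= andbC; case: ltP => //= rs.
  by rewrite (le_trans (ltW rs) sx) andbT.
rewrite E1 E2 -RintegralD//.
transitivity (\int[(mu \x mu)%E]_z k z); last first.
  by apply: eq_Rintegral => z _; rewrite /h' addrC subrK.
rewrite -(Rfubini1 ki) /= Rintegral_mkcond -RintegralZr//.
apply: eq_Rintegral => s _; rewrite RintegralZl//; congr (_ * _).
exact: (@Rintegral_mkcond _ _ _ mu).
Qed.

(** Writing [F] and [G] as their values at [a] plus primitives, every term is linear except the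
    product of the two primitives, which is [prim_mul]. *)
Lemma isintM a b F f G g : a <= b -> isint a b F f -> isint a b G g ->
  isint a b (fun x => F x * G x) (fun x => f x * G x + g x * F x).
Proof.
move=> ab Ff Gg; have [fi FE] := Ff; have [gi GE] := Gg.
split.
  by apply: integrable_funD => //; [exact: (integrable_isintM ab Gg)|exact: (integrable_isintM ab Ff)].
move=> x /andP[ax xb].
have Ffx : isint a x F f by apply: isint_sub Ff.
have Ggx : isint a x G g by apply: isint_sub Gg.
have [fxi _] := Ffx; have [gxi _] := Ggx.
have prim_isint h : mu.-integrable `[a, x] (EFin \o h) ->
    isint a x (fun y => \int[mu]_(s in `[a, y]) h s) h.
  by move=> hi; split => // y _; rewrite Rintegral_itv0 add0r.
have Pf := integrable_isintM ax (prim_isint _ fxi) gxi.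
have Pg := integrable_isintM ax (prim_isint _ gxi) fxi.
transitivity (F a * G a + \int[mu]_(s in `[a, x])
   ((G a * f s + F a * g s) + (f s * (\int[mu]_(r in `[a, s]) g r) +
     g s * (\int[mu]_(r in `[a, s]) f r)))); last first.
  congr (_ + _); apply: eq_Rintegral => s; rewrite inE/= in_itv/= => /andP[as_ sx].
  rewrite (FE s) ?as_ ?(le_trans sx)// (GE s) ?as_ ?(le_trans sx)//; ring.
rewrite RintegralD//; [|by apply: integrable_funD => //; exact: integrable_funZ|exact: integrable_funD].
rewrite RintegralD//; [|exact: integrable_funZ|exact: integrable_funZ].
rewrite RintegralD// -prim_mul// !RintegralZl//.
rewrite (FE x) ?ax// (GE x) ?ax//; ring.
Qed.

Lemma isint_cst a b c : isint a b (cst c) (cst 0).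
Proof.
split; last by move=> x _; rewrite Rintegral_cst// mul0r addr0.
apply: eq_integrable (integrable0 _ _) => //.
Qed.

Lemma isint_id a b : isint a b id (cst 1).
Proof.
split.
  apply: continuous_compact_integrable; first exact: segment_compact.
  by move=> x; exact: cvg_cst.
move=> x /andP[ax _]; rewrite Rintegral_cst//= mul1r lebesgue_measure_itv/= lte_fin.
case: ltP => [_|xa]; first by rewrite -EFinB/= addrC subrK.
by rewrite /= addr0; apply/eqP; rewrite eq_le ax xa.
Qed.

Lemma isintD a b F f G g : isint a b F f -> isint a b G g ->
  isint a b (fun x => F x + G x) (fun x => f x + g x).
Proof.
move=> [fi FE] [gi GE]; split; first exact: integrable_funD.
move=> x /andP[ax xb]; rewrite RintegralD//; [|exact: integrable_sub_itv fi|exact: integrable_sub_itv gi].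
by rewrite FE ?ax// GE ?ax// addrACA.
Qed.

Lemma isintZ a b F f c : isint a b F f ->
  isint a b (fun x => c * F x) (fun x => c * f x).
Proof.
move=> [fi FE]; split; first exact: integrable_funZ.
move=> x /andP[ax xb]; rewrite RintegralZl//; last exact: integrable_sub_itv fi.
by rewrite FE ?ax// mulrDr.
Qed.

Lemma isintB a b F f G g : isint a b F f -> isint a b G g ->
  isint a b (fun x => F x - G x) (fun x => f x - g x).
Proof.
move=> Ff /(isintZ (-1)) Gg; have := isintD Ff Gg.
by under eq_fun do rewrite mulN1r; under [X in isint _ _ _ X]eq_fun do rewrite mulN1r.
Qed.

Lemma isint_eq a b F f G g : isint a b F f ->
  (forall x, a <= x <= b -> F x = G x) ->
  (forall x, a <= x <= b -> f x = g x) -> isint a b G g.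
Proof.
move=> [fi FE] FG fg; split.
  apply: eq_integrable fi => // x; rewrite inE/= in_itv/= => xab.
  by rewrite /= fg.
move=> x /andP[ax xb]; have ab := le_trans ax xb.
rewrite -!FG ?ax ?lexx// FE ?ax//; congr (_ + _); apply: eq_Rintegral => s.
by rewrite inE/= in_itv/= => /andP[as_ sx]; rewrite fg ?as_ ?(le_trans sx).
Qed.

Lemma isint_ae a b F f g : isint a b F f -> measurable_fun `[a, b] g ->
  {ae mu, forall x, a <= x <= b -> f x = g x} -> isint a b F g.
Proof.
move=> [fi FE] mg fg.
have gi : mu.-integrable `[a, b] (EFin \o g).
  exact: (@ae_eq_integrable _ _ _ mu `[a, b] f g).
split=> // x /andP[ax xb]; rewrite FE ?ax//; congr (_ + _).
have fx : mu.-integrable `[a, x] (EFin \o f) by apply: integrable_sub_itv fi.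
have gx : mu.-integrable `[a, x] (EFin \o g) by apply: integrable_sub_itv gi.
apply: ae_eq_Rintegral => //.
- exact: integrable_measurable fx.
- exact: integrable_measurable gx.
- apply: filterS fg => y h; rewrite /= in_itv/= => /andP[ay yx].
  by rewrite h// ay (le_trans yx).
Qed.

Lemma isint_total a b F f : a <= b -> isint a b F f ->
  \int[mu]_(s in `[a, b]) f s = F b - F a.
Proof. by move=> ab [_ FE]; rewrite (FE b) ?ab ?lexx//; ring. Qed.

Lemma isint_deriv a b F f : a <= b -> continuous f ->
  (forall x, is_derive x 1 F (f x)) -> isint a b F f.
Proof.
move=> ab cf Ff.
split.
  apply: continuous_compact_integrable; first exact: segment_compact.
  exact: continuous_subspaceT.
have cF : continuous F.
  by move=> x; apply: differentiable_continuous; apply/derivable1_diffP; apply: ex_derive.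
move=> x /andP[]; rewrite le_eqVlt => /predU1P[<- _|ax xb].
  by rewrite Rintegral_itv0 addr0.
rewrite /Rintegral (@continuous_FTC2 _ f F a x)//=.
- by ring.
- exact: continuous_subspaceT.
- split.
  + by move=> y _; exact: ex_derive.
  + exact/cvg_at_right_filter/cF.
  + exact/cvg_at_left_filter/cF.
- by move=> y _; rewrite derive1E; exact: derive_val.
Qed.

End calculus.
Arguments isint {R}.

(** * Smooth functions and bumps *)

Section smooth.
Context {R : realType}.
Implicit Types (V W : normedModType R).

(** Grading smoothness by the order, and not by words of directions as in [test_fun], gives an
    induction that passes through the product rule. *)
Fixpoint smoothn V (n : nat) (f : V -> R) : Prop :=
  continuous f /\
  if n is n'.+1 then
    (forall p v, derivable f p v) /\ forall v, smoothn n' ('D_v f)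
  else True.

Definition smooth V (f : V -> R) := forall n, smoothn n f.

Lemma smoothnW V n (f : V -> R) : smoothn n.+1 f -> smoothn n f.
Proof.
elim: n f => [|n ih] f; first by move=> [].
move=> [cf [df sf]]; split => //; split => // v.
exact: ih.
Qed.

Lemma smooth_derive V (f : V -> R) v : smooth f -> smooth ('D_v f).
Proof. by move=> sf n; have [_ [_]] := sf n.+1; apply. Qed.

Lemma smooth_continuous V (f : V -> R) : smooth f -> continuous f.
Proof. by move=> /(_ 0%N) []. Qed.

Lemma smooth_derivable V (f : V -> R) p v : smooth f -> derivable f p v.
Proof. by move=> /(_ 1%N) [_ [+ _]]; apply. Qed.

Lemma smooth_iterD V (f : V -> R) (w : seq V) : smooth f -> smooth (Defs.iterD w f).
Proof. by move=> sf; elim: w => [//|v w ih] /=; exact: smooth_derive. Qed.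

Lemma smooth_test_fun V (f : V -> R) : smooth f ->
  forall w : seq V, continuous (Defs.iterD w f) /\ forall p v, derivable (Defs.iterD w f) p v.
Proof.
move=> sf w; have sw := @smooth_iterD V f w sf.
by split; [exact: smooth_continuous|move=> p v; exact: smooth_derivable].
Qed.

Lemma smoothnD V n (f g : V -> R) : smoothn n f -> smoothn n g ->
  smoothn n (fun x => f x + g x).
Proof.
elim: n f g => [|n ih] f g [cf sf] [cg sg].
  by split => // x; apply: cvgD; [exact: cf|exact: cg].
split; first by move=> x; apply: cvgD; [exact: cf|exact: cg].
case: sf sg => df sf [dg sg]; split => [p v|v].
  exact: (derivableD (df p v) (dg p v)).
rewrite (_ : 'D_v _ = fun x => 'D_v f x + 'D_v g x).
  exact: ih (sf v) (sg v).
by apply/funext => x; exact: (deriveD (df x v) (dg x v)).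
Qed.

Lemma smoothn0 V n : smoothn n (fun _ : V => 0 : R).
Proof.
elim: n => [|n ih]; split => //; try by move=> x; exact: cvg_cst.
split => [p v|v]; first exact: derivable_cst.
rewrite (_ : 'D_v _ = fun=> 0)//.
by apply/funext => x; exact: derive_cst.
Qed.

Lemma smoothn_cst V n (k : R) : smoothn n (fun _ : V => k : R).
Proof.
case: n => [|n]; split => //; try by move=> x; exact: cvg_cst.
split => [p v|v]; first exact: derivable_cst.
rewrite (_ : 'D_v _ = fun=> 0); first exact: smoothn0.
by apply/funext => x; exact: derive_cst.
Qed.

Lemma smoothnM V n (f g : V -> R) : smoothn n f -> smoothn n g ->
  smoothn n (fun x => f x * g x).
Proof.
elim: n f g => [|n ih] f g /[dup] sf' [cf sf] /[dup] sg' [cg sg].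
  by split => // x; apply: cvgM; [exact: cf|exact: cg].
split; first by move=> x; apply: cvgM; [exact: cf|exact: cg].
case: sf sg => df sf [dg sg]; split => [p v|v].
  exact: (derivableM (df p v) (dg p v)).
rewrite (_ : 'D_v _ = fun x => f x * 'D_v g x + g x * 'D_v f x).
  by apply: smoothnD; apply: ih; [exact: smoothnW sf'|exact: sg|exact: smoothnW sg'|exact: sf].
by apply/funext => x; exact: (deriveM (df x v) (dg x v)).
Qed.

Lemma smoothnZ V n (f : V -> R) k : smoothn n f -> smoothn n (fun x => k * f x).
Proof. by apply: smoothnM; exact: smoothn_cst. Qed.

Lemma smoothM V (f g : V -> R) : smooth f -> smooth g -> smooth (fun x => f x * g x).
Proof. by move=> sf sg n; exact: smoothnM. Qed.

(** [A0] is the linear part of [A], so the two difference quotients are the same function of [h]; no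
    regularity of [f] is involved. *)
Lemma derive_affine V W (A A0 : V -> W) (f : W -> R) p v :
  (forall h u q, A (h *: u + q) = h *: A0 u + A q) ->
  (derivable f (A p) (A0 v) -> derivable (f \o A) p v) *
  ('D_v (f \o A) p = 'D_(A0 v) f (A p)).
Proof.
move=> AE; have E : (fun h => h^-1 *: (((f \o A) \o shift p) (h *: v) - (f \o A) p)) =
    (fun h => h^-1 *: ((f \o shift (A p)) (h *: A0 v) - f (A p))).
  by apply/funext => h /=; rewrite AE.
by split; rewrite /derivable /derive E.
Qed.

Lemma smoothn_affine V W n (A A0 : V -> W) (f : W -> R) : continuous A ->
  (forall h u q, A (h *: u + q) = h *: A0 u + A q) ->
  smoothn n f -> smoothn n (fun x => f (A x)).
Proof.
move=> cA AE; elim: n f => [|n ih] f [cf sf].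
  by split => // x; apply: continuous_comp; [exact: cA|exact: cf].
split; first by move=> x; apply: continuous_comp; [exact: cA|exact: cf].
case: sf => df sf; split => [p v|v].
  by apply: (derive_affine f p v AE).1; exact: df.
rewrite (_ : 'D_v _ = fun x => 'D_(A0 v) f (A x)).
  exact: ih (sf (A0 v)).
by apply/funext => x; exact: (derive_affine f x v AE).2.
Qed.

Lemma is_derive1_dir (f : R -> R) (x df v : R) : is_derive x 1 f df ->
  derivable f x v /\ 'D_v f x = v * df.
Proof.
move=> [fd fE].
have dff : differentiable f x by exact/derivable1_diffP.
split; first exact: diff_derivable.
rewrite deriveE// -[in LHS](mulr1 v) -[v * 1]/(v *: (1 : R)) linearZ/=.
by rewrite -deriveE// fE.
Qed.

Lemma smoothn_derive1 n (f f' : R -> R) : (forall x : R, is_derive x 1 f (f' x)) ->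
  smoothn n f' -> smoothn n.+1 f.
Proof.
move=> ff' sf'; split.
  move=> x; apply: differentiable_continuous; apply/derivable1_diffP.
  exact: ex_derive.
split => [p v|v]; first by have [] := is_derive1_dir v (ff' p).
rewrite (_ : 'D_v f = fun x => v * f' x); first exact: smoothnZ.
by apply/funext => x; have [] := is_derive1_dir v (ff' x).
Qed.

Lemma smooth_derive1 (f f' : R -> R) : (forall x : R, is_derive x 1 f (f' x)) ->
  smooth f' -> smooth f.
Proof. by move=> ff' sf n; exact: smoothnW (smoothn_derive1 ff' (sf n)). Qed.

Lemma smooth_is_derive (f : R -> R) (x : R) : smooth f -> is_derive x 1 f ('D_1 f x).
Proof. by move=> sf; apply: DeriveDef => //; exact: smooth_derivable. Qed.

End smooth.

Section bump.
Context {R : realType}.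
Implicit Types (x y : R) (k n : nat).

(** The family [x^(-k) exp(-1/x)] contains the usual flat function as [k = 0] and is stable under
    differentiation up to linear combinations, so smoothness is a plain induction on the order, for
    all [k] at once. *)
Definition fexp k x : R := if 0 < x then x^-1 ^+ k * expR (- x^-1) else 0.

Lemma fexp0 k x : x <= 0 -> fexp k x = 0.
Proof. by rewrite /fexp leNgt => /negbTE ->. Qed.

(** [expR y] is the power [k.+1] of [expR (y / k.+1%:R)], which is at least [1 + y / k.+1%:R]. *)
Lemma expR_ge_pow k y : 0 <= y -> (y / k.+1%:R) ^+ k.+1 <= expR y.
Proof.
move=> y0; rewrite -[in leRHS](@divfK _ k.+1%:R _ y) ?pnatr_eq0//.
rewrite [in leRHS]mulrC expRM_natl lerXn2r ?nnegrE ?expR_ge0 ?divr_ge0//.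
by rewrite (le_trans _ (expR_ge1Dx _))// lerDr.
Qed.

Lemma pow_le_expR k : exists2 M : R, 0 <= M & forall y, 0 <= y -> y ^+ k.+1 <= M * expR y.
Proof.
exists (k.+1%:R ^+ k.+1); first by rewrite exprn_ge0.
move=> y y0; have := expR_ge_pow k y0.
by rewrite expr_div_n ler_pdivrMr ?exprn_gt0// mulrC.
Qed.

(** A quadratic bound gives derivative 0 at the origin, the only point where the rules of
    differentiation do not apply. *)
Lemma fexp_sqr k : exists2 M, 0 <= M & forall x, `|fexp k x| <= M * x ^+ 2.
Proof.
have [M M0 HM] := pow_le_expR k.+1; exists M => // x.
rewrite /fexp; case: ifPn => x0; last by rewrite normr0 mulr_ge0 ?sqr_ge0.
have y0 : 0 < x^-1 by rewrite invr_gt0.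
rewrite ger0_norm ?mulr_ge0 ?exprn_ge0 ?expR_ge0 ?(ltW y0)//.
rewrite expRN ler_pdivrMr ?expR_gt0//.
have := HM _ (ltW y0); rewrite -addn2 exprD => h.
have x2 : 0 < x ^+ 2 by rewrite exprn_gt0.
rewrite -(@ler_pM2r _ (x^-1 ^+ 2)) ?exprn_gt0//; apply: le_trans h _.
rewrite exprVn (_ : M * x ^+ 2 * expR x^-1 / x ^+ 2 = M * expR x^-1)//.
by field; rewrite gt_eqF.
Qed.

Lemma is_derive_fexp k x : is_derive x 1 (fexp k) (fexp k.+2 x - k%:R * fexp k.+1 x).
Proof.
have [x0|x0|->] := ltgtP x 0.
- rewrite !fexp0 ?ltW// mulr0 subr0.
  apply: (@near_eq_is_derive _ _ _ (cst 0)).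
  near=> y; rewrite /= fexp0//; apply/ltW; near: y.
  exact: lt_nbhsl.
- apply: (@near_eq_is_derive _ _ _ (fun x => x^-1 ^+ k * expR (- x^-1))).
    near=> y; rewrite /fexp ifT//; near: y; exact: lt_nbhsr.
  have xn : x != 0 by rewrite gt_eqF.
  have dV : is_derive x 1 (fun x : R => x^-1) (- x ^- 2).
    by have := is_deriveV xn (is_derive_id x 1); rewrite scaler1.
  have dk : is_derive x 1 (fun x : R => x^-1 ^+ k) (- k%:R * x^-1 ^+ k.+1).
    have := is_deriveX k dV; rewrite exprfctE => h; apply: is_derive_eq h _.
    case: k => [|k]; first by rewrite !mul0r scale0r oppr0 mul0r.
    rewrite /= -[_ *: _]/(_ * _) -exprVn !exprS; ring.
  have de : is_derive x 1 (fun x : R => expR (- x^-1)) (x^-1 ^+ 2 * expR (- x^-1)).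
    have dN : is_derive x 1 (fun x : R => - x^-1) (- - x ^- 2) by exact: is_deriveN dV.
    have := @is_derive1_comp _ expR (fun x : R => - x^-1) x _ _ (is_derive_expR _) dN.
    by move=> h; apply: is_derive_eq h _; rewrite opprK exprVn mulrC.
  have := is_deriveM dk de; move=> h; apply: is_derive_eq h _.
  rewrite /fexp x0 -![_ *: _]/(_ * _) !exprS; ring.
- rewrite !fexp0// mulr0 subr0.
  have [M M0 HM] := fexp_sqr k.
  have cv : (fun h : R => h^-1 *: ((fexp k \o shift 0) (h *: 1) - fexp k 0)) @ 0^' --> (0 : R).
    apply/cvgrPdist_le => e e0; near=> h.
    have hn : h != 0 by near: h; exact: nbhs_dnbhs_neq.
    rewrite sub0r normrN /= addr0 (fexp0 k (lexx 0)) subr0 -[h *: 1]/(h * 1) mulr1.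
    rewrite -[_ *: _]/(_ * _) normrM normfV ler_pdivrMl ?normr_gt0//.
    apply: le_trans (HM h) _; rewrite -(real_normK (num_real h)) expr2 mulrA [leRHS]mulrC.
    apply: ler_wpM2r => //.
    have : `|h| < e / (M + 1).
      by near: h; apply: dnbhs0_lt; rewrite divr_gt0// ltr_wpDl.
    rewrite ltr_pdivlMr ?ltr_wpDl// mulrDr mulr1 => hh.
    by apply/ltW/(le_lt_trans _ hh); rewrite mulrC lerDl.
  by apply: DeriveDef; [apply/cvg_ex; exists 0|exact: cvg_lim cv].
Unshelve. all: by end_near. Qed.

Lemma smooth_fexp k : smooth (fexp k).
Proof.
move=> n; elim: n k => [|n ih] k.
  split => // x; apply: differentiable_continuous; apply/derivable1_diffP.
  by have [] := is_derive_fexp k x.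
apply: smoothn_derive1; first exact: is_derive_fexp.
rewrite (_ : (fun _ => _) = (fun x => fexp k.+2 x + (- k%:R) * fexp k.+1 x)).
  by apply: smoothnD => //; exact: smoothnZ.
by apply/funext => x; rewrite mulNr.
Qed.

(* [exp (- 1 / (n x))] tends to 1 for [x > 0]: as n grows these bumps tend
   boundedly to the indicator function of ]a, b[. *)
Definition smooth_step a b n x : R :=
  fexp 0 (n.+1%:R * (x - a)) * fexp 0 (n.+1%:R * (b - x)).

End bump.

Section Rintegral_dominated_convergence.
Context d (T : measurableType d) (R : realType).
Variable mu : {measure set T -> \bar R}.

Lemma Rintegral_dct (D : set T) (f_ : nat -> T -> R) (f g : T -> R) : measurable D ->
  (forall n, measurable_fun D (f_ n)) -> measurable_fun D f ->
  mu.-integrable D (EFin \o g) ->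
  (forall x, D x -> f_ n x @[n --> \oo] --> f x) ->
  (forall n x, D x -> `|f_ n x| <= g x) ->
  \int[mu]_(x in D) f_ n x @[n --> \oo] --> \int[mu]_(x in D) f x.
Proof.
move=> mD mf_ mf gi fc fg.
have h1 n : measurable_fun D (EFin \o f_ n) by exact/measurable_EFinP.
have h2 : measurable_fun D (EFin \o f) by exact/measurable_EFinP.
have h3 : {ae mu, forall x, D x -> (EFin \o f_ n) x @[n --> \oo] --> (EFin \o f) x}.
  by apply: aeW => x Dx; apply: cvg_EFin; [exact: nearW|exact: fc].
have h4 : {ae mu, forall x n, D x -> (`|(EFin \o f_ n) x| <= (EFin \o g) x)%E}.
  by apply: aeW => x n Dx; rewrite lee_fin fg.
have [fi _] := dominated_convergence mD h1 h2 h3 gi h4.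
by rewrite -EFin_Rintegral// => /fine_cvg.
Qed.

End Rintegral_dominated_convergence.

Section bump_theory.
Context {R : realType}.
Notation mu := (@lebesgue_measure R).
Implicit Types (a b x y : R).

Lemma fexp_ge0 k x : 0 <= fexp k x.
Proof.
rewrite /fexp; case: ifPn => // x0.
by rewrite mulr_ge0 ?expR_ge0// exprn_ge0// invr_ge0 ltW.
Qed.

Lemma fexp_le1 x : fexp 0 x <= 1.
Proof.
rewrite /fexp; case: ifPn => // x0.
by rewrite expr0 mul1r -expR0 ler_expR oppr_le0 invr_ge0 ltW.
Qed.

Lemma bump_bounds a b n x : 0 <= smooth_step a b n x <= 1.
Proof. by rewrite /smooth_step mulr_ge0 ?fexp_ge0//= mulr_ile1 ?fexp_ge0 ?fexp_le1. Qed.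

Lemma bump_out a b n x : ~~ (a < x < b) -> smooth_step a b n x = 0.
Proof.
rewrite negb_and -!leNgt /smooth_step => /orP[xa|bx].
  by rewrite fexp0 ?mul0r// pmulr_rle0// subr_le0.
by rewrite [X in _ * X]fexp0 ?mulr0// pmulr_rle0// subr_le0.
Qed.

Lemma smooth_bump a b n : smooth (smooth_step a b n).
Proof.
apply: smoothM => m.
  apply: (@smoothn_affine _ _ _ _ (fun x => n.+1%:R * (x - a)) (fun x => n.+1%:R * x) (fexp 0)).
  - by move=> x; apply: cvgM; [exact: cvg_cst|apply: cvgB; [exact: cvg_id|exact: cvg_cst]].
  - by move=> h u q; rewrite -![_ *: _]/(_ * _); ring.
  - exact: smooth_fexp.
apply: (@smoothn_affine _ _ _ _ (fun x => n.+1%:R * (b - x)) (fun x => - (n.+1%:R * x)) (fexp 0)).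
- by move=> x; apply: cvgM; [exact: cvg_cst|apply: cvgB; [exact: cvg_cst|exact: cvg_id]].
- by move=> h u q; rewrite -![_ *: _]/(_ * _); ring.
- exact: smooth_fexp.
Qed.

Lemma fexp_cvg1 x : 0 < x -> fexp 0 (n.+1%:R * x) @[n --> \oo] --> (1 : R).
Proof.
move=> x0.
have -> : (fun n : nat => fexp 0 (n.+1%:R * x)) = (fun n => expR (- (n.+1%:R^-1 * x^-1))).
  by apply/funext => n; rewrite /fexp mulr_gt0// expr0 mul1r invfM.
have h : (fun n : nat => - (n.+1%:R^-1 * x^-1)) @ \oo --> (0 : R).
  rewrite -oppr0 -(mul0r x^-1); apply: cvgN; apply: cvgM; last exact: cvg_cst.
  exact: cvg_harmonic.
rewrite -[X in _ --> X]expR0; exact: (continuous_cvg _ (@continuous_expR R 0) h).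
Qed.

Lemma bump_cvg a b x : smooth_step a b n x @[n --> \oo] --> (\1_(`]a, b[ : set R) x : R).
Proof.
rewrite indicE mem_setE in_itv /=; have [/andP[ax xb]|xab] := boolP (a < x < b).
  rewrite /smooth_step -[X in _ --> X](mulr1 (1 : R)).
  by apply: cvgM; apply: fexp_cvg1; rewrite subr_gt0.
by under eq_fun do rewrite bump_out//; exact: cvg_cst.
Qed.

(** The support is confined to one segment [[c, d]] of []a, b[]. Nothing forces [c <= d], so that
    the zero function qualifies for all [a] and [b]. *)
Definition test1 a b (f : R -> R) := smooth f /\
  exists c d, [/\ a < c, d < b & forall x, ~~ (c <= x <= d) -> f x = 0].

Lemma test1_out a b f x : test1 a b f -> ~~ (a < x < b) -> f x = 0.
Proof.
move=> [_ [c [d [ac db h]]]] xab; apply: h; apply: contra xab => /andP[cx xd].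
by rewrite (lt_le_trans ac)//= (le_lt_trans xd).
Qed.

Lemma test1_bump a b c d n : a < c -> d < b -> test1 a b (smooth_step c d n).
Proof.
move=> ac db; split; first exact: smooth_bump.
exists c, d; split => // x xcd; apply: bump_out; apply: contra xcd.
by move=> /andP[? ?]; rewrite !ltW.
Qed.

Lemma test1_0 a b : test1 a b (fun=> 0).
Proof.
split; first by move=> n; exact: smoothn0.
by exists (a + 1), (b - 1); split => //; rewrite ?ltrDl// ltrBlDr ltrDl.
Qed.

Lemma test1D a b f g : test1 a b f -> test1 a b g -> test1 a b (fun x => f x + g x).
Proof.
move=> [sf [c [d [ac db f0]]]] [sg [c' [d' [ac' db' g0]]]]; split.
  by move=> n; apply: smoothnD; [exact: sf|exact: sg].
exists (Num.min c c'), (Num.max d d'); split.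
- by rewrite lt_min ac.
- by rewrite gt_max db.
move=> x xcd; rewrite f0 ?g0 ?addr0//; apply: contra xcd.
  by move=> /andP[? ?]; rewrite ge_min le_max; apply/andP; split; apply/orP; right.
by move=> /andP[? ?]; rewrite ge_min le_max; apply/andP; split; apply/orP; left.
Qed.

Lemma test1Z a b f k : test1 a b f -> test1 a b (fun x => k * f x).
Proof.
move=> [sf [c [d [ac db f0]]]]; split; first by move=> n; exact: smoothnZ.
by exists c, d; split => // x /f0 ->; rewrite mulr0.
Qed.

Lemma near_out (c d x : R) : ~~ (c <= x <= d) -> \forall y \near x, ~~ (c <= y <= d).
Proof.
rewrite negb_and -!ltNge => /orP[xc|dx].
  by near=> y; rewrite negb_and -ltNge; apply/orP; left; near: y; exact: lt_nbhsl.
by near=> y; rewrite negb_and -!ltNge; apply/orP; right; near: y; exact: lt_nbhsr.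
Unshelve. all: by end_near. Qed.

Lemma test1_derive a b f : test1 a b f -> test1 a b ('D_1 f).
Proof.
move=> [sf [c [d [ac db f0]]]]; split; first exact: smooth_derive.
exists c, d; split => // x xcd.
have : is_derive x 1 f 0.
  apply: (@near_eq_is_derive _ _ _ (cst 0)).
  by apply: filterS (near_out xcd) => y /f0.
by move=> h; exact: derive_val.
Qed.

Lemma test1_bounded a b f : test1 a b f -> exists2 M, 0 <= M & forall x, `|f x| <= M.
Proof.
move=> tf; have [ab|ba] := ltP a b; last first.
  exists 0 => // x; rewrite (test1_out tf) ?normr0//; apply/negP => /andP[ax xb].
  by have := lt_trans ax xb; rewrite ltNge ba.
have sf := tf.1.
have Ff : isint a b f ('D_1 f).
  apply: isint_deriv => //; first exact: ltW.
    exact/smooth_continuous/smooth_derive.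
  by move=> x; exact: smooth_is_derive.
have [M M0 HM] := isint_bounded (ltW ab) Ff; exists M => // x.
have [xab|xab] := boolP (a <= x <= b); first exact: HM.
rewrite (test1_out tf) ?normr0//; apply: contra xab.
by move=> /andP[? ?]; rewrite !ltW.
Qed.

Lemma test1_measurable a b f : test1 a b f -> measurable_fun setT f.
Proof. by move=> [sf _]; apply: continuous_measurable_fun; exact: smooth_continuous. Qed.

Lemma isint_test1 a b f c d : c <= d -> test1 a b f -> isint c d f ('D_1 f).
Proof.
move=> cd [sf _]; apply: isint_deriv => //; first exact/smooth_continuous/smooth_derive.
by move=> x; exact: smooth_is_derive.
Qed.

(** The primitive from [a] vanishes to the left of the support of [k], and also to its right because
    the total integral is 0; it keeps the bounds [c] and [d]. *)
Lemma test1_prim a b k : a < b -> test1 a b k -> \int[mu]_(s in `[a, b]) k s = 0 ->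
  exists2 th, test1 a b th & 'D_1 th = k.
Proof.
move=> ab tk k0; have [sk [c [d [ac db kout]]]] := tk.
have ck := smooth_continuous sk.
have ki x y : mu.-integrable `[x, y] (EFin \o k).
  by apply: continuous_compact_integrable; [exact: segment_compact|exact: continuous_subspaceT].
pose th x := \int[mu]_(s in `[a, x]) k s.
have th0 x : ~~ (c <= x <= d) -> th x = 0.
  move=> xcd; have [xc|cx] := ltP x c.
    rewrite /th (_ : \int[mu]_(s in _) k s = \int[mu]_(s in `[a, x]) (0 : R)).
      by rewrite Rintegral_cst// mul0r.
    apply: eq_Rintegral => s; rewrite inE/= in_itv/= => /andP[_ sx].
    by apply: kout; rewrite negb_and -ltNge (le_lt_trans sx).
  have dx : d < x by move: xcd; rewrite cx/= -ltNge.
  have h y z : d < y -> \int[mu]_(s in `[y, z]) k s = 0.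
    move=> dy; rewrite (_ : \int[mu]_(s in _) k s = \int[mu]_(s in `[y, z]) (0 : R)).
      by rewrite Rintegral_cst// mul0r.
    apply: eq_Rintegral => s; rewrite inE/= in_itv/= => /andP[ys _].
    by apply: kout; rewrite negb_and -!ltNge (lt_le_trans dy)// orbT.
  have [xb|bx] := leP x b.
    have := k0; rewrite (@Rintegral_itv_cat _ a x b)// ?xb ?andbT ?(ltW (lt_le_trans ac cx))//.
    by rewrite (h x b dx) addr0.
  by rewrite /th (@Rintegral_itv_cat _ a b x) ?(ltW ab) ?(ltW bx)// k0 (h b x db) addr0.
have dth x : is_derive x 1 th (k x).
  have [xc|cx] := ltP x c.
    rewrite kout; last by rewrite negb_and -ltNge xc.
    apply: (@near_eq_is_derive _ _ _ (cst 0)).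
    near=> y; rewrite th0// negb_and -ltNge; apply/orP; left.
    by near: y; exact: lt_nbhsl.
  have [] := @continuous_FTC1_closed _ k a x (x + 1) _ (ki _ _) _ (ck x).
  - by rewrite ltrDl.
  - exact: lt_le_trans cx.
  - by move=> h1 h2; apply: (DeriveDef h1); rewrite -derive1E.
exists th.
  split; first by apply: (smooth_derive1 dth).
  by exists c, d.
by apply/funext => x; exact: derive_val.
Unshelve. all: by end_near. Qed.

(** A countable family, indexed through [pickle] by rational endpoints and a sharpness [n]; letting
    [n] grow gives the indicator functions of all rational intervals well inside []a, b[]. *)
Definition bumpf a b (i : nat) : R -> R :=
  if unpickle i is Some (q, r, n) then
    if (a < ratr q) && (ratr r < b) then smooth_step (ratr q) (ratr r) n else fun=> 0
  else (fun=> 0).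

Lemma test1_bumpf a b i : test1 a b (bumpf a b i).
Proof.
rewrite /bumpf; case: unpickle => [[[q r] n]|]; last exact: test1_0.
case: ifPn => [/andP[aq rb]|_]; [exact: test1_bump|exact: test1_0].
Qed.

(** By dominated convergence [k] has integral 0 over rational intervals. Its primitive, being
    continuous, is then constant on []a, b[], and by Lebesgue differentiation [k] is almost
    everywhere the derivative of this primitive. *)
Lemma fundamental1 a b k : a < b -> mu.-integrable `[a, b] (EFin \o k) ->
  (forall i, \int[mu]_(x in `[a, b]) (k x * bumpf a b i x) = 0) ->
  {ae mu, forall x, a <= x <= b -> k x = 0}.
Proof.
move=> ab ki kb.
have mk := integrable_measurable ki.
have k0 (q r : rat) : a < ratr q -> ratr q < ratr r :> R -> ratr r < b ->
    \int[mu]_(x in `[(ratr q : R), ratr r]) k x = 0.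
  move=> aq qr rb.
  have kn n : \int[mu]_(x in `[a, b]) (k x * smooth_step (ratr q) (ratr r) n x) = 0.
    have := kb (pickle (q, r, n)); rewrite /bumpf pickleK aq rb.
    by [].
  have mb n : measurable_fun setT (smooth_step (ratr q : R) (ratr r) n).
    by apply: continuous_measurable_fun; exact: smooth_continuous (smooth_bump _ _ _).
  have : \int[mu]_(x in `[a, b]) (k x * smooth_step (ratr q) (ratr r) n x) @[n --> \oo] -->
      \int[mu]_(x in `[a, b]) (k x * \1_(`]ratr q, ratr r[ : set R) x).
    apply: (@Rintegral_dct _ _ _ mu _ _ _ (fun x => `|k x|)) => //.
    - by move=> n; apply: measurable_funM => //; exact: measurable_funTS (mb n).
    - by apply: measurable_funM => //; exact: measurable_indic.
    - exact: integrable_norm.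
    - by move=> x _; apply: cvgM; [exact: cvg_cst|exact: bump_cvg].
    - move=> n x _; rewrite normrM ler_piMr// ger0_norm;
        by have /andP[] := bump_bounds (ratr q) (ratr r) n x.
  under eq_fun do rewrite kn.
  move=> /(cvg_unique _ (@cvg_cst _ _ _ _ _)) => /(_ _) h.
  rewrite -Rintegral_itv_obnd_cbnd; last first.
    by apply: integrableS ki => // x /=; rewrite !in_itv/= => /andP[qx xr];
       rewrite ltW ?(lt_trans aq)//= (le_trans xr)// ltW.
  rewrite -Rintegral_itv_bndo_bndc; last first.
    by apply: integrableS ki => // x /=; rewrite !in_itv/= => /andP[qx xr];
       rewrite ltW ?(lt_trans aq)//= ltW// (lt_trans xr).
  rewrite Rintegral_mkcond [RHS]h// [RHS]Rintegral_mkcond; apply: eq_Rintegral => x _.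
  rewrite !restrictE0 !mem_setE !in_itv/= indicE mem_setE in_itv/=.
  have [/andP[qx xr]|_] := boolP (ratr q < x < ratr r); last by rewrite mulr0 if_same.
  by rewrite ltW ?(lt_trans aq)//= ltW ?(lt_trans xr)// mulr1.
pose K x := \int[mu]_(s in `[a, x]) k s.
have Kk : isint a b K k by split => // x _; rewrite /K Rintegral_itv0 add0r.
have cK : {in `]a, b[, continuous K}.
  by have := isint_continuous (ltW ab) Kk; move=> /(continuous_within_itvP _ ab)[].
have [q0 /[!in_itv]/= /andP[aq0 q0b]] := rat_in_itvoo ab.
have Kq (r : rat) : a < ratr r < b -> K (ratr r) = K (ratr q0).
  move=> /andP[ar rb]; have [qr|rq|->//] := ltgtP (ratr q0 : R) (ratr r).
    by rewrite (isint_itv Kk (ltW aq0) (ltW qr) (ltW rb)) k0// addr0.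
  by rewrite (isint_itv Kk (ltW ar) (ltW rq) (ltW q0b)) k0// addr0.
have KE x : a < x < b -> K x = K (ratr q0).
  move=> /andP[ax xb]; apply: contrapT => /eqP; rewrite -subr_eq0 -normr_gt0 => e0.
  have /cvgrPdist_lt /(_ _ e0) : K y @[y --> x] --> K x by apply: cK; rewrite in_itv/= ax.
  move=> /nbhs_ballP[d /= d0 hd].
  have xdb : x < Num.min (x + d) b by rewrite lt_min ltrDl d0 xb.
  have [r] := rat_in_itvoo xdb.
  rewrite in_itv/= lt_min => /andP[xr /andP[rd rb]].
  have hb : `|x - ratr r| < d by rewrite ltr0_norm ?subr_lt0// opprB ltrBlDl.
  by have := hd _ hb; rewrite /= Kq ?ltxx// (lt_trans ax).
pose k1 := k \_ `[a, b].
have k1i : mu.-integrable setT (EFin \o k1) := integrable_itvT ki.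
have k1l : locally_integrable setT k1 by exact: open_integrable_locally openT k1i.
have k1s y : mu.-integrable [set` Interval (BLeft a) (BRight y)] (EFin \o k1).
  exact: integrableS k1i.
have := @FTC1 _ k1 (BLeft a) k1s k1l.
have mab : mu.-negligible [set a; b].
  apply: negligibleU.
  - by exists [set a]; split => //; exact: lebesgue_measure_set1.
  - by exists [set b]; split => //; exact: lebesgue_measure_set1.
move=> h; have hab : {ae mu, forall x, ~ [set a; b] x}.
  by apply: negligibleS mab => x /= /contrapT.
near=> x => /andP[ax xb].
have xab : ~ [set a; b] x by near: x; exact: hab.
have {}ax : a < x by rewrite lt_neqAle ax andbT; apply/eqP => ax'; apply: xab; left.
have {}xb : x < b by rewrite lt_neqAle xb andbT; apply/eqP => ax'; apply: xab; right.
have : derivable (fun y => \int[mu]_(t in `[a, y]) k1 t) x 1 /\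
   derive1 (fun y => \int[mu]_(t in `[a, y]) k1 t) x = k1 x.
  have hx : (a%:E < x%:E)%E -> derivable (fun y => \int[mu]_(t in `[a, y]) k1 t) x 1 /\
    derive1 (fun y => \int[mu]_(t in `[a, y]) k1 t) x = k1 x. by near: x; exact: h.
  by apply: hx; rewrite lte_fin.
move=> [_]; have -> : k1 x = k x by rewrite /k1 restrict_itvE (ltW ax) (ltW xb).
move=> <-; rewrite derive1E.
have : is_derive x 1 (fun y => \int[mu]_(t in `[a, y]) k1 t) 0.
  apply: (@near_eq_is_derive _ _ _ (cst (K (ratr q0)))).
  near=> y; have ay : a < y by near: y; exact: lt_nbhsr.
  have yb : y < b by near: y; exact: lt_nbhsl.
  rewrite /= -(KE y) ?ay//; apply: eq_Rintegral => s; rewrite inE/= in_itv/= => /andP[as_ sy].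
  by rewrite /k1 restrict_itvE as_ (le_trans sy)// ltW.
by move=> hd; exact: derive_val.
Unshelve. all: by end_near. Qed.

(** If all bumps had integral 0, [fundamental1] would make the constant 1 vanish almost everywhere.
    This spares computing the integral of any bump. *)
Lemma exists_unit_test1 a b : a < b ->
  exists2 f, test1 a b f & \int[mu]_(x in `[a, b]) f x = 1.
Proof.
move=> ab.
have [i ni] : exists i, \int[mu]_(x in `[a, b]) bumpf a b i x != 0.
  apply: contrapT => /forallNP h.
  have : {ae mu, forall x, a <= x <= b -> (1 : R) = 0}.
    apply: (@fundamental1 a b (fun=> 1)) => //; first exact: (isint_id a b).1.
    move=> i; have /negP /negPn /eqP := h i => <-.
    by apply: eq_Rintegral => x _; rewrite mul1r.
  move=> [N [mN N0 Nab]].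
  have : (mu `[a, b] <= mu N)%E.
    apply: le_measure; rewrite ?inE// => x /=; rewrite in_itv/= => xab.
    by apply: Nab => /(_ xab) /eqP; rewrite oner_eq0.
  rewrite N0 lebesgue_measure_itv/= lte_fin ab -EFinB lee_fin leNgt.
  by rewrite subr_gt0 ab.
exists (fun x => (\int[mu]_(x in `[a, b]) bumpf a b i x)^-1 * bumpf a b i x).
  exact/test1Z/test1_bumpf.
rewrite RintegralZl//; first by rewrite mulVf.
have [sb _] := test1_bumpf a b i.
apply: continuous_compact_integrable; [exact: segment_compact|].
exact/continuous_subspaceT/smooth_continuous.
Qed.

(** A bump minus its integral times [eta] has integral 0, hence is the derivative of a test function
    by [test1_prim]. *)
Lemma exists_test_family a b : a < b -> exists2 th : nat -> R -> R,
  forall i, test1 a b (th i) &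
  exists2 eta, test1 a b eta /\ \int[mu]_(x in `[a, b]) eta x = 1 &
  forall i, 'D_1 (th i) =
    (fun x => bumpf a b i x - (\int[mu]_(s in `[a, b]) bumpf a b i s) * eta x).
Proof.
move=> ab; have [eta teta eta1] := exists_unit_test1 ab.
have ti f : test1 a b f -> mu.-integrable `[a, b] (EFin \o f).
  move=> [sf _]; apply: continuous_compact_integrable; first exact: segment_compact.
  exact/continuous_subspaceT/smooth_continuous.
have h i : {th | test1 a b th /\ 'D_1 th =
    (fun x => bumpf a b i x - (\int[mu]_(s in `[a, b]) bumpf a b i s) * eta x)}.
  apply: cid; set c := \int[mu]_(s in _) _.
  have tk : test1 a b (fun x => bumpf a b i x - c * eta x).
    have := test1D (test1_bumpf a b i) (test1Z (- c) teta).
    by under [X in test1 a b X -> _]eq_fun do rewrite mulNr.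
  have [|th tth dth] := test1_prim ab tk; last by exists th.
  rewrite RintegralB//; [|exact/ti/test1_bumpf|exact/ti/test1Z].
  by rewrite RintegralZl ?eta1 ?mulr1 ?subrr//; exact: ti.
exists (fun i => sval (h i)); first by move=> i; case: (svalP (h i)).
by exists eta => // i; case: (svalP (h i)).
Qed.

(** The zero family is a default for [b <= a], so that no proof of [a < b] appears in the
    statements. *)
Definition test_family a b : nat -> R -> R :=
  if pselect (a < b) is left ab then
    sval (cid2 (exists_test_family ab)) else fun=> fun=> 0.

Lemma test_familyP a b i : test1 a b (test_family a b i).
Proof.
rewrite /test_family; case: pselect => [ab|_]; last exact: test1_0.
by case: cid2.
Qed.

(* du Bois-Reymond, with a countable set of test functions so that it can be
   applied to almost every slice of a function of several variables. *)
Lemma du_bois_reymond a b f g : a < b ->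
  mu.-integrable `[a, b] (EFin \o f) -> mu.-integrable `[a, b] (EFin \o g) ->
  (forall i, \int[mu]_(x in `[a, b]) (f x * 'D_1 (test_family a b i) x +
                                      g x * test_family a b i x) = 0) ->
  exists c, {ae mu, forall x, a <= x <= b -> f x = c + \int[mu]_(s in `[a, x]) g s}.
Proof.
move=> ab fi gi; rewrite /test_family; case: pselect => // ab'.
case: cid2 => th tth [eta [teta eta1] dth] /= h.
pose G x := \int[mu]_(s in `[a, x]) g s.
have Gg : isint a b G g by split => // x _; rewrite /G Rintegral_itv0 add0r.
have Gi := isint_integrable (ltW ab) Gg.
have fGi : mu.-integrable `[a, b] (EFin \o (fun x => f x - G x)) by exact: integrable_funB.
have tM k t : test1 a b t -> mu.-integrable `[a, b] (EFin \o k) ->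
    mu.-integrable `[a, b] (EFin \o (fun x => k x * t x)).
  move=> tt ki; have [M _ HM] := test1_bounded tt.
  apply: (@integrable_funM _ _ _ mu _ k t M) => //.
  exact: measurable_funTS (test1_measurable tt).
(* As [eta] has integral 1, this is the constant that makes [f - G - c] orthogonal to [eta]. *)
pose c := \int[mu]_(x in `[a, b]) ((f x - G x) * eta x).
exists c.
(* Integrating the term in [g] by parts, [f - G] is orthogonal to every ['D_1 (th i)]. These are
   bumps corrected by multiples of [eta], so [f - G - c] is orthogonal to all bumps. *)
have h1 i : \int[mu]_(x in `[a, b]) ((f x - G x) * 'D_1 (th i) x) = 0.
  have tth' := test1_derive (tth i).
  have := isint_total (ltW ab) (isintM (ltW ab) Gg (isint_test1 (ltW ab) (tth i))).
  rewrite (test1_out (tth i)) ?ltxx ?andbF// (test1_out (tth i)) ?ltxx// !mulr0 subr0 => h2.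
  rewrite -[RHS]subr0 -{1}(h i) -[X in _ = _ - X]h2 -RintegralB//.
  - by apply: eq_Rintegral => x _; ring.
  - by apply: integrable_funD => //; exact: tM.
  - apply: integrable_funD => //; first exact: tM.
    by apply: eq_integrable (tM G _ tth' Gi) => // x _ /=; rewrite mulrC.
have : {ae mu, forall x, a <= x <= b -> f x - G x - c = 0}.
  have ci k : mu.-integrable `[a, b] (EFin \o (fun=> k)).
    by apply: continuous_compact_integrable; [exact: segment_compact|move=> x; exact: cvg_cst].
  apply: fundamental1 => //; first exact: integrable_funB.
  move=> i; have dE x := congr1 (@^~ x) (dth i).
  have := h1 i; under eq_Rintegral do rewrite dE; set b_ := bumpf a b i; set d := \int[mu]_(s in `[a, b]) b_ s => h2.
  have tb : test1 a b b_ := test1_bumpf a b i.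
  have cb : \int[mu]_(x in `[a, b]) (c * b_ x) = c * d.
    rewrite RintegralZl//.
    by apply: eq_integrable (tM (fun=> 1) b_ tb (ci 1)) => // x _ /=; rewrite mul1r.
  have : \int[mu]_(x in `[a, b]) ((f x - G x) * b_ x) - d * c = 0.
    rewrite -h2 /c -RintegralZl//; last exact: tM.
    rewrite -RintegralB//; [|exact: tM|by apply: integrable_funZ => //; exact: tM].
    by apply: eq_Rintegral => x _; ring.
  rewrite mulrC -cb => <-; rewrite -RintegralB//; [|exact: tM|exact: (tM (fun=> c))].
  by apply: eq_Rintegral => x _; ring.
by apply: filterS => x h2 /h2 /eqP; rewrite subr_eq0 subr_eq addrC => /eqP.
Qed.

End bump_theory.

(** * Slicing of weak derivatives *)

Section measurable_slices.
Context d1 d2 (T1 : measurableType d1) (T2 : measurableType d2) (R : realType).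
Variable m1 : {sigma_finite_measure set T1 -> \bar R}.
Variable m2 : {sigma_finite_measure set T2 -> \bar R}.

(** Even without integrability the integral is a difference of two Tonelli integrals, of the
    positive and of the negative part, each measurable in [y]. *)
Lemma measurable_Rintegral2 (f : T1 * T2 -> R) : measurable_fun setT f ->
  measurable_fun setT (fun y => \int[m1]_x f (x, y)).
Proof.
move=> mf; have mF : measurable_fun setT (EFin \o f) by exact/measurable_EFinP.
apply: measurableT_comp => //.
rewrite (_ : (fun y => _) =
   ((fun y => \int[m1]_x (((EFin \o f)^\+)%E (x, y)) -
              \int[m1]_x (((EFin \o f)^\-)%E (x, y)))%E)); last first.
  apply/funext => y; rewrite [LHS]integralE /=.
  by congr (_ - _)%E; apply: eq_integral => x _; rewrite !(funeposE, funenegE).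
apply: emeasurable_funB.
- apply: (measurable_fun_fubini_tonelli_G ((EFin \o f)^\+)%E) => //.
  exact: measurable_funepos.
- apply: (measurable_fun_fubini_tonelli_G ((EFin \o f)^\-)%E) => //.
  exact: measurable_funeneg.
Qed.

Lemma L2_slice2 (f : T1 * T2 -> R) : L2 (m1 \x m2)%E setT f ->
  {ae m2, forall y, L2 m1 setT (fun x => f (x, y))}.
Proof.
move=> [mf fi]; have := ae_slice2 fi; apply: filterS => y hy; split => //.
exact: measurableT_comp mf (measurable_pair2 y).
Qed.

Lemma L2_slice1 (f : T1 * T2 -> R) : L2 (m1 \x m2)%E setT f ->
  {ae m1, forall x, L2 m2 setT (fun y => f (x, y))}.
Proof.
move=> [mf fi]; have := ae_slice1 fi; apply: filterS => y hy; split => //.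
exact: measurableT_comp mf (measurable_pair1 y).
Qed.

Lemma L2_tensor (f : T1 -> R) (g : T2 -> R) : L2 m1 setT f -> L2 m2 setT g ->
  L2 (m1 \x m2)%E setT (fun z => f z.1 * g z.2).
Proof.
move=> [mf fi] [mg gi]; split.
  apply: measurable_funM.
  - exact: measurableT_comp mf measurable_fst.
  - exact: measurableT_comp mg measurable_snd.
apply: eq_integrable (integrable_tensor fi gi) => // z _ /=.
by rewrite exprMn.
Qed.

End measurable_slices.

Section L2_finite.
Context d (T : measurableType d) (R : realType).
Variable mu : {measure set T -> \bar R}.

Lemma L2_bounded_support (B : set T) (f : T -> R) (M : R) : measurable B ->
  (mu B < +oo)%E -> measurable_fun setT f -> (forall x, `|f x| <= M) ->
  L2 mu setT (fun x => f x * \1_B x).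
Proof.
move=> mB Bfin mf fM; split.
  by apply: measurable_funM => //; exact: measurable_indic.
have i1 : mu.-integrable setT (EFin \o (\1_B : T -> R)).
  apply/ge0_integrableP.
  - have := @measurable_indic _ T R setT B mB; apply.
  - by move=> x _; rewrite indicE ler0n.
  by rewrite integral_indic// setIT.
have := integrable_funZ (M ^+ 2) measurableT i1.
apply: le_integrable_normr => //.
  by apply: measurable_funX; apply: (measurable_funM mf); exact: measurable_indic.
move=> x _; rewrite exprMn normrM normrX.
rewrite indicE; case: (x \in B); last by rewrite expr0n normr0 !mulr0.
by rewrite expr1n normr1 !mulr1 lerXn2r ?nnegrE ?fM// (le_trans _ (fM x)).
Qed.

Lemma L2_integrable (B : set T) (f : T -> R) : measurable B ->
  (mu B < +oo)%E -> L2 mu setT f -> mu.-integrable B (EFin \o f).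
Proof.
move=> mB Bfin lf.
have l1 : L2 mu setT (fun x => 1 * \1_B x).
  by apply: (@L2_bounded_support B (fun=> 1) 1) => // x; rewrite normr1.
apply/(integrable_restrictT _ _ mB).
apply: eq_integrable (L2_prod measurableT lf l1) => // x _ /=.
rewrite restrictE0 mul1r indicE; case: (x \in B); by rewrite ?mulr1 ?mulr0.
Qed.

End L2_finite.

Section slicing.
Context d (T : measurableType d) (R : realType).
Notation mu := (@lebesgue_measure R).
Variable m2 : {sigma_finite_measure set T -> \bar R}.

(** What is needed of the transverse variable in order to pass from integrals to almost every slice.
    It is kept abstract because this variable is a real number for slices in x or in y, and a point
    of the plane for slices in t. *)
Definition separating (B : set T) (psi : nat -> T -> R) :=
  [/\ measurable B, (m2 B < +oo)%E,
    forall j, measurable_fun setT (psi j) /\ exists2 M : R, 0 <= M & forall x, `|psi j x| <= M &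
    forall F, m2.-integrable B (EFin \o F) ->
    (forall j, \int[m2]_(w in B) (F w * psi j w) = 0) ->
    {ae m2, forall w, B w -> F w = 0}].

(** For fixed [i] the integral in [x] is a function [F i] of [w] orthogonal to all [psi j], hence
    null almost everywhere on [B]. There are countably many [i], so one null set serves them all,
    and off it [du_bois_reymond] applies to the slice. The constant [c] depends on [w], in a way
    about which nothing is claimed. *)
Lemma slicing (a b : R) (B : set T) (psi : nat -> T -> R) (f g : R * T -> R) :
  a < b -> separating B psi ->
  L2 (mu \x m2)%E setT f -> L2 (mu \x m2)%E setT g ->
  (forall i j, \int[(mu \x m2)%E]_z
     ((f z * 'D_1 (test_family a b i) z.1 + g z * test_family a b i z.1) *
      (psi j z.2 * \1_(`[a, b] `*` B) z)) = 0) ->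
  {ae m2, forall w, B w -> exists c, {ae mu, forall x, a <= x <= b ->
     f (x, w) = c + \int[mu]_(s in `[a, x]) g (s, w)}}.
Proof.
move=> ab [mB Bfin psib Bsep] lf lg h.
have abfin : (mu `[a, b] < +oo)%E by rewrite lebesgue_measure_itv/= lte_fin ab -EFinB ltry.
have lb j k : test1 a b k ->
    L2 (mu \x m2)%E setT (fun z => (k z.1 * \1_(`[a, b]) z.1) * (psi j z.2 * \1_B z.2)).
  move=> tk; have [mp [M M0 pM]] := psib j; have [N N0 kN] := test1_bounded tk.
  apply: (@L2_tensor _ _ _ _ _ mu m2 (fun x => k x * \1_(`[a, b]) x) (fun w => psi j w * \1_B w)).
  - exact: (@L2_bounded_support _ _ _ mu `[a, b] k N (measurable_itv _) abfin (test1_measurable tk) kN).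
  - exact: (L2_bounded_support mB Bfin mp pM).
have lb1 k : test1 a b k ->
    L2 (mu \x m2)%E setT (fun z => (k z.1 * \1_(`[a, b]) z.1) * (1 * \1_B z.2)).
  move=> tk; have [N N0 kN] := test1_bounded tk.
  apply: (@L2_tensor _ _ _ _ _ mu m2 (fun x => k x * \1_(`[a, b]) x) (fun w => 1 * \1_B w)).
  - exact: (@L2_bounded_support _ _ _ mu `[a, b] k N (measurable_itv _) abfin (test1_measurable tk) kN).
  - apply: (@L2_bounded_support _ _ _ m2 B (fun=> 1) 1) => //.
    by move=> x; rewrite normr1.
pose th := test_family a b; have tth i : test1 a b (th i) := test_familyP a b i.
pose H i z := f z * ('D_1 (th i) z.1 * \1_(`[a, b]) z.1) +
              g z * (th i z.1 * \1_(`[a, b]) z.1).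
have mH i : measurable_fun setT (H i).
  have mt k : test1 a b k -> measurable_fun setT (fun z : R * T => k z.1 * \1_(`[a, b]) z.1).
    move=> tk; apply: measurable_funM.
    - exact: measurableT_comp (test1_measurable tk) measurable_fst.
    - by apply: measurableT_comp measurable_fst; exact: measurable_indic.
  apply: measurable_funD; apply: measurable_funM; try exact: mt.
  - exact: lf.1.
  - exact: mt (test1_derive (tth i)).
  - exact: lg.1.
(* Used with [q = psi j] for the orthogonality and with [q = 1] for the integrability of the
   slices. *)
have Hint i (q : T -> R) : (forall k, test1 a b k ->
     L2 (mu \x m2)%E setT (fun z => (k z.1 * \1_(`[a, b]) z.1) * (q z.2 * \1_B z.2))) ->
    (mu \x m2)%E.-integrable setT (EFin \o (fun z => H i z * (q z.2 * \1_B z.2))).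
  move=> lq; have := integrable_funD measurableT
     (L2_prod measurableT lf (lq _ (test1_derive (tth i))))
     (L2_prod measurableT lg (lq _ (tth i))).
  by apply: eq_integrable => // z _ /=; congr EFin; rewrite /H; ring.
pose F i w := \int[mu]_x H i (x, w).
have Hae i : {ae m2, forall w, B w -> mu.-integrable setT (EFin \o (fun x => H i (x, w)))}.
  have := ae_slice2 (Hint i (fun=> 1) lb1); apply: filterS => w hw Bw.
  by apply: eq_integrable hw => // x _ /=; rewrite indicE mem_set// mul1r mulr1.
have FE i (q : T -> R) : (forall k, test1 a b k ->
     L2 (mu \x m2)%E setT (fun z => (k z.1 * \1_(`[a, b]) z.1) * (q z.2 * \1_B z.2))) ->
   {ae m2, forall w, setT w -> \int[mu]_x (H i (x, w) * (q w * \1_B w)) = F i w * (q w * \1_B w)}.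
  move=> lq; apply: filterS (Hae i) => w hw _.
  have [Bw|nBw] := pselect (B w); first by rewrite RintegralZr//; exact: hw.
  have -> : \1_B w = 0 :> R by rewrite indicE memNset.
  rewrite !mulr0; transitivity (\int[mu]_(x in setT) (0 : R)).
    by apply: eq_Rintegral => x _; rewrite mulr0.
  by rewrite /Rintegral integral0.
have mF i : measurable_fun setT (F i) := measurable_Rintegral2 mu (mH i).
have mq (q : T -> R) i : measurable_fun setT q -> measurable_fun setT (fun w => F i w * (q w * \1_B w)).
  by move=> mq; apply: measurable_funM => //; apply: measurable_funM => //; exact: measurable_indic.
have Fi i : m2.-integrable B (EFin \o F i).
  apply/(integrable_restrictT _ _ mB).
  have := ae_eq_integrable measurableT (mq (fun=> 1) i (measurable_cst _)) (FE i (fun=> 1) lb1)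
     (integrable_Rslice2 (Hint i (fun=> 1) lb1)).
  apply: eq_integrable => // w _ /=.
  by rewrite restrictE0 mul1r indicE; case: (w \in B); rewrite ?mulr1 ?mulr0.
have F0 i : {ae m2, forall w, B w -> F i w = 0}.
  apply: Bsep => // j.
  rewrite Rintegral_mkcond.
  transitivity (\int[m2]_w \int[mu]_x (H i (x, w) * (psi j w * \1_B w))).
    apply: ae_eq_Rintegral => //.
    - apply/(measurable_restrictT _ mB); apply: measurable_funTS.
      by apply: measurable_funM => //; case: (psib j).
    - exact: (measurable_Rslice2 (Hint i (psi j) (lb j))).
    - apply: filterS (FE i (psi j) (lb j)) => w /(_ I) -> _.
      by rewrite restrictE0 indicE; case: (w \in B); rewrite ?mulr1 ?mulr0.
  rewrite (Rfubini2 (Hint i (psi j) (lb j))) -[RHS](h i j); apply: eq_Rintegral => z _.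
  rewrite /H !indicE in_setX /=.
  by rewrite /th; case: (z.1 \in _); case: (z.2 \in B) => /=; ring.
have := ae_foralln F0.
have sf := L2_slice2 lf; have sg := L2_slice2 lg.
move=> F00; near=> w => Bw.
have Fw : forall i, B w -> F i w = 0 by near: w; exact: F00.
have fw : L2 mu setT (fun x => f (x, w)) by near: w; exact: sf.
have gw : L2 mu setT (fun x => g (x, w)) by near: w; exact: sg.
apply: (@du_bois_reymond _ a b (fun x => f (x, w)) (fun x => g (x, w))) => //.
- exact: (L2_integrable _ abfin fw).
- exact: (L2_integrable _ abfin gw).
move=> i; rewrite -(Fw i Bw) Rintegral_mkcond; apply: eq_Rintegral => x _.
by rewrite restrictE0 /H /= indicE /th; case: (x \in _); rewrite ?mulr1 ?mulr0 ?addr0.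
Unshelve. all: by end_near. Qed.

End slicing.

Lemma measurable_eq0 d (T : measurableType d) (R : realType) (f : T -> R) :
  measurable_fun setT f -> measurable [set x | f x = 0].
Proof.
move=> mf; have := mf measurableT [set 0] (measurable_set1 0).
by rewrite setTI.
Qed.

Section separation.
Context {R : realType}.
Notation mu := (@lebesgue_measure R).

Lemma lebesgue_itv_fin (a b : R) : (mu `[a, b] < +oo)%E.
Proof.
by rewrite lebesgue_measure_itv/= lte_fin; case: ifPn => // _; rewrite -EFinB ltry.
Qed.

Lemma bumpf_le1 (a b x : R) i : `|bumpf a b i x| <= 1.
Proof.
rewrite /bumpf; case: unpickle => [[[q r] n]|]; last by rewrite normr0.
case: ifPn => _; last by rewrite normr0.
by have /andP[h0 h1] := bump_bounds (ratr q) (ratr r) n x; rewrite ger0_norm.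
Qed.

Lemma separating1 (a b : R) : a < b -> separating mu `[a, b] (bumpf a b).
Proof.
move=> ab; split => //; first exact: lebesgue_itv_fin.
- move=> j; split; first exact: test1_measurable (test1_bumpf a b j).
  by exists 1 => // x; exact: bumpf_le1.
- move=> F Fi hF; have := fundamental1 ab Fi hF; apply: filterS => x h.
  by rewrite /= in_itv/= => /h.
Qed.

Definition bumpf2 (a b c d : R) (n : nat) (p : R * R) : R :=
  if unpickle n is Some (i, j) then bumpf a b i p.1 * bumpf c d j p.2 else 0.

Lemma measurable_bumpf2 a b c d n :
  measurable_fun [set: measurableTypeR R * measurableTypeR R] (bumpf2 a b c d n).
Proof.
rewrite /bumpf2; case: unpickle => [[i j]|]; last exact: measurable_cst.
apply: measurable_funM.
- exact: measurableT_comp (test1_measurable (test1_bumpf a b i)) measurable_fst.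
- exact: measurableT_comp (test1_measurable (test1_bumpf c d j)) measurable_snd.
Qed.

Lemma bumpf2_le1 a b c d n p : `|bumpf2 a b c d n p| <= 1.
Proof.
rewrite /bumpf2; case: unpickle => [[i j]|]; last by rewrite normr0.
by rewrite normrM mulr_ile1 ?bumpf_le1.
Qed.

(** [fundamental1] is applied twice: in [x] to the integrals over [y] against each bump, then, for
    each [x] off a null set common to all bumps, in [y] to the slice itself. *)
Lemma separating2 (a b c d : R) : a < b -> c < d ->
  separating (leb2 R) (`[a, b] `*` `[c, d]) (bumpf2 a b c d).
Proof.
move=> ab cd.
have mB : measurable (`[a, b] `*` `[c, d] : set (measurableTypeR R * measurableTypeR R)).
  exact: measurableX.
split => //.
- rewrite [X in (X < _)%E](_ : _ = (mu `[a, b] * mu `[c, d])%E).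
    2: exact: product_measure1E.
  apply: lte_mul_pinfty => //.
    by rewrite ge0_fin_numE// lebesgue_itv_fin.
  exact: lebesgue_itv_fin.
- move=> j; split; first exact: measurable_bumpf2.
  by exists 1 => // x; exact: bumpf2_le1.
move=> F Fi hF; pose F1 := F \_ (`[a, b] `*` `[c, d]).
have F1i : (mu \x mu)%E.-integrable setT (EFin \o F1).
  exact: (@integrable_restrictT _ _ _ (mu \x mu)%E _ F mB).1.
have FE x y : F1 (x, y) = if (a <= x <= b) && (c <= y <= d) then F (x, y) else 0.
  by rewrite /F1 restrictE0 in_setX/= !mem_setE !in_itv.
have mb j : measurable_fun [set: measurableTypeR R * measurableTypeR R] (fun z => bumpf c d j z.2).
  exact: measurableT_comp (test1_measurable (test1_bumpf c d j)) measurable_snd.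
have F1j j : (mu \x mu)%E.-integrable setT (EFin \o (fun z => F1 z * bumpf c d j z.2)).
  apply: (@integrable_funM _ _ _ (mu \x mu)%E setT F1 (fun z => bumpf c d j z.2) 1) => //.
  by move=> z _; exact: bumpf_le1.
have Kj j : {ae mu, forall x, a <= x <= b -> \int[mu]_y (F1 (x, y) * bumpf c d j y) = 0}.
  apply: (@fundamental1 _ a b (fun x => \int[mu]_y (F1 (x, y) * bumpf c d j y)) ab).
    by apply: integrableS (integrable_Rslice1 (F1j j)).
  move=> i; rewrite Rintegral_mkcond.
  have Gi : (mu \x mu)%E.-integrable setT
      (EFin \o (fun z => F1 z * bumpf c d j z.2 * bumpf a b i z.1)).
    apply: (@integrable_funM _ _ _ (mu \x mu)%E setT _ (fun z => bumpf a b i z.1) 1) => //.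
      exact: measurableT_comp (test1_measurable (test1_bumpf a b i)) measurable_fst.
    by move=> z _; exact: bumpf_le1.
  transitivity (\int[mu]_x \int[mu]_y (F1 (x, y) * bumpf c d j y * bumpf a b i x)).
    apply: ae_eq_Rintegral => //.
    - apply/(measurable_restrictT _ (measurable_itv _)).
      apply: measurable_funTS; apply: measurable_funM.
        exact: measurable_Rslice1 (F1j j).
      exact: test1_measurable (test1_bumpf a b i).
    - exact: measurable_Rslice1 Gi.
    - apply: filterS (ae_slice1 (F1j j)) => x hx _.
      rewrite RintegralZr//; rewrite restrict_itvE; case: ifPn => // xab.
      rewrite (test1_out (test1_bumpf a b i)) ?mulr0//.
      by apply: contra xab => /andP[? ?]; rewrite !ltW.
  rewrite (Rfubini1 Gi) -[RHS](hF (pickle (i, j))) [RHS]Rintegral_mkcond.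
  apply: eq_Rintegral => -[x y] _; rewrite /bumpf2 pickleK /= FE restrictE0 in_setX/=.
  rewrite !mem_setE !in_itv/=; case: ifPn => _; ring.
have Kall := ae_foralln Kj.
have F1ae := ae_slice1 F1i.
have : {ae (mu \x mu)%E, forall z, F1 z = 0}.
  apply: (@prod_ae1 _ _ _ _ _ mu mu [set z | F1 z = 0]).
    exact: measurable_eq0 (integrable_measurable F1i).
  near=> x.
  have hx : mu.-integrable setT (EFin \o (fun y => F1 (x, y))) by near: x; exact: F1ae.
  have h j : a <= x <= b -> \int[mu]_y (F1 (x, y) * bumpf c d j y) = 0.
    by move: j; near: x; exact: Kall.
  have [xab|xab] := boolP (a <= x <= b); last first.
    by apply: aeW => y /=; rewrite FE (negbTE xab).
  have : {ae mu, forall y, c <= y <= d -> F1 (x, y) = 0}.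
    apply: (@fundamental1 _ c d (fun y => F1 (x, y)) cd); first by apply: integrableS hx.
    move=> j; rewrite -[RHS](h j xab) Rintegral_mkcond; apply: eq_Rintegral => y _.
    by rewrite restrict_itvE !FE xab/=; case: (c <= y <= d); rewrite ?mul0r.
  apply: filterS => y /=; rewrite FE xab /=; case: ifPn => // ycd.
  by apply.
apply: filterS => -[x y] h [/= xab ycd]; rewrite -[RHS]h FE.
by move: xab ycd; rewrite !in_itv/= => -> ->.
Unshelve. all: by end_near. Qed.

End separation.

(** * Tensor products as test functions *)

Section tensor_tests.
Context {R : realType}.
Notation mu := (@lebesgue_measure R).
Implicit Types (al be th : R -> R) (L m : R).

Definition tens al be (p : R * R) : R := al p.1 * be p.2.

Definition dern (i : nat) (f : R -> R) : R -> R := iter i (fun g : R -> R => 'D_1 g) f.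

Lemma smooth_fst (V W : normedModType R) (f : V -> R) :
  smooth f -> smooth (fun p : V * W => f p.1).
Proof.
move=> sf n; apply: (@smoothn_affine _ _ _ _ (@fst V W) (@fst V W)) => //.
by move=> x; exact: cvg_fst.
Qed.

Lemma smooth_snd (V W : normedModType R) (f : W -> R) :
  smooth f -> smooth (fun p : V * W => f p.2).
Proof.
move=> sf n; apply: (@smoothn_affine _ _ _ _ (@snd V W) (@snd V W)) => //.
by move=> x; exact: cvg_snd.
Qed.

Lemma derive_tensor (V W : normedModType R) (f : V -> R) (g : W -> R) v w p :
  smooth f -> smooth g ->
  'D_((v, w) : V * W) (fun p : V * W => f p.1 * g p.2) p =
  'D_v f p.1 * g p.2 + f p.1 * 'D_w g p.2.
Proof.
move=> sf sg.
have df := (derive_affine (A := @fst V W) (A0 := @fst V W) f p (v, w) (fun _ _ _ => erefl)).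
have dg := (derive_affine (A := @snd V W) (A0 := @snd V W) g p (v, w) (fun _ _ _ => erefl)).
have df1 := df.1 (smooth_derivable sf); have dg1 := dg.1 (smooth_derivable sg).
have /= -> := deriveM df1 dg1.
by rewrite df.2 dg.2 -![_ *: _]/(_ * _) /= addrC mulrC.
Qed.

Lemma derive_0 (V : normedModType R) (f : V -> R) p : 'D_0 f p = 0.
Proof. exact: derive0. Qed.

Lemma derive_tens1 al be : smooth al -> smooth be ->
  'D_((1, 0) : R * R) (tens al be) = tens ('D_1 al) be.
Proof.
move=> sa sb; apply/funext => p; rewrite /tens derive_tensor// derive_0 mulr0 addr0.
by [].
Qed.

Lemma derive_tens2 al be : smooth al -> smooth be ->
  'D_((0, 1) : R * R) (tens al be) = tens al ('D_1 be).
Proof.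
move=> sa sb; apply/funext => p; rewrite /tens derive_tensor// derive_0 mul0r add0r.
by [].
Qed.

Lemma smooth_dern f i : smooth f -> smooth (dern i f).
Proof. by move=> sf; elim: i => [//|i ih]; exact: smooth_derive. Qed.

Lemma pderiv_tens i j al be : smooth al -> smooth be ->
  pderiv i j (tens al be) = tens (dern i al) (dern j be).
Proof.
move=> sa sb; rewrite /pderiv /Defs.iterD foldr_cat.
have -> : foldr (fun v (g : R * R -> R) => 'D_v g) (tens al be) (nseq j (0, 1)) = tens al (dern j be).
  elim: j => [//|j ih]; rewrite /= ih derive_tens2//; exact: smooth_dern.
elim: i => [//|i ih]; rewrite /= ih derive_tens1//; exact: smooth_dern.
Qed.

Lemma smooth_tens al be : smooth al -> smooth be -> smooth (tens al be).
Proof. by move=> sa sb; apply: smoothM; [exact: smooth_fst|exact: smooth_snd]. Qed.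

Lemma test_fun_tens L m al be : test1 0 L al -> test1 (- m) m be ->
  test_fun (strip L) (tens al be).
Proof.
move=> [sa [c [d [ac db a0]]]] [sb [c' [d' [_ _ b0]]]]; split.
  by apply: smooth_test_fun; exact: smooth_tens.
exists (`[c, d] `*` `[c', d']); split.
- by apply: compact_setX; exact: segment_compact.
- move=> [x y] [/=]; rewrite in_itv/= => /andP[cx xd] _.
  by rewrite /strip/= (lt_le_trans ac)//= (le_lt_trans xd).
- move=> [x y] h; rewrite /tens/=.
  have [xcd|xcd] := boolP (c <= x <= d); last by rewrite a0 ?mul0r.
  have [ycd|ycd] := boolP (c' <= y <= d'); last by rewrite b0 ?mulr0.
  by exfalso; apply: h; split; rewrite /= in_itv.
Qed.

Definition tens3 th al be (z : R * (R * R)) := th z.1 * tens al be z.2.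

Lemma test_fun_tens3 L m T th al be : test1 0 T th -> test1 0 L al ->
  test1 (- m) m be -> test_fun (cylinder L) (tens3 th al be).
Proof.
move=> [st [ct [dt [tc td t0]]]] [sa [c [d [ac db a0]]]] [sb [c' [d' [_ _ b0]]]]; split.
  apply: smooth_test_fun; apply: smoothM; first exact: smooth_fst.
  exact/smooth_snd/smooth_tens.
exists (`[ct, dt] `*` (`[c, d] `*` `[c', d'])); split.
- by apply: compact_setX; [|apply: compact_setX]; exact: segment_compact.
- move=> [t [x y]] [/=]; rewrite in_itv/= => /andP[ct' _] [/=]; rewrite in_itv/= => /andP[cx xd] _.
  split; rewrite /strip/=; first exact: lt_le_trans ct'.
  by rewrite (lt_le_trans ac)//= (le_lt_trans xd).
- move=> [t [x y]] h; rewrite /tens3 /tens/=.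
  have [tcd|tcd] := boolP (ct <= t <= dt); last by rewrite t0 ?mul0r.
  have [xcd|xcd] := boolP (c <= x <= d); last by rewrite a0 ?mul0r ?mulr0.
  have [ycd|ycd] := boolP (c' <= y <= d'); last by rewrite b0 ?mulr0.
  by exfalso; apply: h; split => /=; [|split]; rewrite /= in_itv.
Qed.

Lemma derive_tens3 th al be z : smooth th -> smooth al -> smooth be ->
  'D_((1, (0, 0)) : R * (R * R)) (tens3 th al be) z = tens3 ('D_1 th) al be z.
Proof.
move=> st sa sb.
rewrite /tens3 (derive_tensor _ _ _ st (smooth_tens sa sb)).
by rewrite -[(0, 0)]/(0 : R * R) derive_0 mulr0 addr0.
Qed.

Lemma test1_L2 a b f : test1 a b f -> L2 mu setT f.
Proof.
move=> tf; have [M M0 HM] := test1_bounded tf.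
have := @L2_bounded_support _ _ _ mu `[a, b] f M (measurable_itv _) (lebesgue_itv_fin a b) (test1_measurable tf) HM.
rewrite (_ : (fun x => _) = f)//; apply/funext => x.
rewrite indicE mem_setE in_itv/=; have [xab|xab] := boolP (a <= x <= b); first by rewrite mulr1.
by rewrite mulr0 (test1_out tf)//; apply: contra xab => /andP[? ?]; rewrite !ltW.
Qed.

Lemma L2_tens a b c d al be : test1 a b al -> test1 c d be -> L2 (leb2 R) setT (tens al be).
Proof. by move=> ta tb; exact: (L2_tensor (test1_L2 ta) (test1_L2 tb)). Qed.

End tensor_tests.

(** * Weak derivatives on the strip and their restrictions to lines *)

Section weak_derivatives.
Context {R : realType}.
Notation mu := (@lebesgue_measure R).
Implicit Types (L m : R) (f g : R * R -> R).

Lemma measurable_strip L : measurable (strip L : set (measurableTypeR R * measurableTypeR R)).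
Proof.
rewrite (_ : strip L = fst @^-1` `]0, L[).
  by rewrite -[X in measurable X]setTI; apply: measurable_fst.
by apply/seteqP; split => p; rewrite /strip/= in_itv.
Qed.

Lemma Lnorm2_lty d (T : measurableType d) (nu : {measure set T -> \bar R}) (f : T -> R) :
  ('N[nu]_2%:E [EFin \o f] < +oo)%E -> (\int[nu]_x ((f x) ^+ 2)%:E < +oo)%E.
Proof.
move=> h; rewrite (_ : (\int[nu]_x _)%E = ('N[nu]_2%:E [EFin \o f] `^ 2)%E).
  exact: poweR_lty.
rewrite poweR_Lnorm ?pnatr_eq0//; apply: eq_integral => x _ /=.
by rewrite powR_mulrn// real_normK// num_real.
Qed.

Lemma L2fun_L2 L f : L2fun L f -> L2 (leb2 R) setT (f \_ (strip L)).
Proof.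
move=> [mf h]; have mf0 : measurable_fun setT (f \_ (strip L)).
  by apply/(measurable_restrictT _ (measurable_strip L)).
split => //; apply/ge0_integrableP.
- exact: measurable_funX.
- by move=> x _; exact: sqr_ge0.
- exact: Lnorm2_lty.
Qed.

(** Tests that are products of a function of [x] and one of [y] are enough for slicing. The
    functions are meant to be extended by zero, so the integrals run over the plane. *)
Definition weak_tens L i j f g := forall m al be, 0 < m -> test1 0 L al -> test1 (- m) m be ->
  \int[leb2 R]_p (f p * tens (dern i al) (dern j be) p) =
  (-1) ^+ (i + j) * \int[leb2 R]_p (g p * tens al be p).

Lemma weakD_tens L i j f g : weakD L i j f g ->
  weak_tens L i j (f \_ (strip L)) (g \_ (strip L)).
Proof.
move=> [_ _ h] m al be m0 ta tb; have := h _ (test_fun_tens ta tb).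
rewrite pderiv_tens ?(proj1 ta) ?(proj1 tb)//; last 2 first.
  by case: ta.
  by case: tb.
have E (F : R * R -> R) : \int[leb2 R]_(p in strip L) F p = \int[leb2 R]_p (F \_ (strip L)) p.
  exact: Rintegral_mkcond.
rewrite !E => h1.
transitivity (\int[leb2 R]_x ((fun p => f p * tens (dern i al) (dern j be) p) \_ (strip L)) x).
  by apply: eq_Rintegral => p _; rewrite !restrictE0; case: ifPn => //; rewrite mul0r.
rewrite h1; congr (_ * _).
by apply: eq_Rintegral => p _; rewrite !restrictE0; case: ifPn => //; rewrite mul0r.
Qed.

(** The data relate each derivative to [v] only; this relates consecutive derivatives to one
    another. The identity for [f] tested with the derivative of [al] has the same left-hand side as
    the one for [g] tested with [al]. *)
Lemma weak_tens_x L i j v f g : 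
  weak_tens L i j v f -> weak_tens L i.+1 j v g -> weak_tens L 1 0 f g.
Proof.
move=> vf vg m al be m0 ta tb.
have := vf m _ _ m0 (test1_derive ta) tb; have := vg m _ _ m0 ta tb.
rewrite /dern iterSr /= -/(dern i _) -/(dern j _) => -> h.
rewrite expr1 -[LHS]mul1r -{1}(@sqrr_sign _ (i + j)) expr2 -mulrA -h.
by rewrite addSn exprS mulrA [X in X * _]mulrCA -expr2 sqrr_sign mulr1.
Qed.

Lemma weak_tens_y L i j v f g :
  weak_tens L i j v f -> weak_tens L i j.+1 v g -> weak_tens L 0 1 f g.
Proof.
move=> vf vg m al be m0 ta tb.
have := vf m _ _ m0 ta (test1_derive tb); have := vg m _ _ m0 ta tb.
rewrite /dern iterSr /= -/(dern i _) -/(dern j _) => -> h.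
rewrite expr1 -[LHS]mul1r -{1}(@sqrr_sign _ (i + j)) expr2 -mulrA -h.
by rewrite addnS exprS mulrA [X in X * _]mulrCA -expr2 sqrr_sign mulr1.
Qed.

Definition on_strip L f := forall p, ~~ (0 < p.1 < L) -> f p = 0.

Lemma restrict_on_strip L f : on_strip L (f \_ (strip L)).
Proof. by move=> p hp; rewrite restrictE0 memNset//; exact/negP. Qed.

Lemma swap_integrable (f : R * R -> R) : (leb2 R).-integrable setT (EFin \o f) ->
  (leb2 R).-integrable setT (EFin \o (fun p => f (p.2, p.1))) /\
  \int[leb2 R]_p f (p.2, p.1) = \int[leb2 R]_p f p.
Proof.
move=> fi; have mf := integrable_measurable fi.
have mf' : measurable_fun setT (fun p : measurableTypeR R * measurableTypeR R => f (p.2, p.1)).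
  apply: measurableT_comp mf _; apply/measurable_fun_pairP; split.
  - exact: measurable_snd.
  - exact: measurable_fst.
have fi' : (mu \x mu)%E.-integrable setT (EFin \o (fun p => f (p.2, p.1))).
  apply/integrable12ltyP; first exact/measurable_EFinP.
  apply/(integrable21ltyP mu mu (f := EFin \o f)) => //.
  exact/measurable_EFinP.
split => //.
by rewrite -[LHS](Rfubini1 fi') -[RHS](Rfubini2 fi).
Qed.

Lemma L2_swap f : L2 (leb2 R) setT f -> L2 (leb2 R) setT (fun p => f (p.2, p.1)).
Proof.
move=> [mf fi]; split; last exact: (swap_integrable fi).1.
apply: measurableT_comp mf _; apply/measurable_fun_pairP; split.
- exact: measurable_snd.
- exact: measurable_fst.
Qed.

Lemma ae_bigcup_itv (P : R -> Prop) :
  (forall n : nat, {ae mu, forall y, - n.+1%:R <= y <= n.+1%:R -> P y}) ->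
  {ae mu, forall y, P y}.
Proof.
move=> /ae_foralln; apply: filterS => y h.
apply: (h (Num.truncn `|y|)); have := truncnS_gt `|y|.
by move=> /ltW; rewrite ler_norml.
Qed.

Lemma slice_x L f g : 0 < L -> L2 (leb2 R) setT f -> L2 (leb2 R) setT g ->
  on_strip L f -> on_strip L g -> weak_tens L 1 0 f g ->
  {ae mu, forall y, exists c, {ae mu, forall x, 0 <= x <= L ->
     f (x, y) = c + \int[mu]_(s in `[0, x]) g (s, y)}}.
Proof.
move=> L0 lf lg fs gs w; apply: ae_bigcup_itv => n; set m := n.+1%:R.
have m0 : 0 < m by rewrite ltr0n.
have mm : - m < m by rewrite gtrN.
have := @slicing _ _ _ mu 0 L `[- m, m] _ f g L0 (separating1 mm) lf lg _.
move=> /(_ _)/wrap[].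
  move=> i j.
  have ta := test_familyP 0 L i; have tb := test1_bumpf (- m) m j.
  have lta := L2_tens (test1_derive ta) tb; have ltb := L2_tens ta tb.
  rewrite -[RHS](subrr (\int[leb2 R]_p (f p * tens ('D_1 (test_family 0 L i)) (bumpf (- m) m j) p))).
  rewrite {2}(w m _ _ m0 ta tb) expr1 mulN1r opprK -RintegralD//; last 2 first.
    exact: L2_prod.
    exact: L2_prod.
  apply: eq_Rintegral => -[x y] _; rewrite /tens/= indicE in_setX/= !mem_setE !in_itv/=.
  have [ym|ym] := boolP (- m <= y <= m); last first.
    by rewrite (test1_out tb) ?(mulr0, addr0, mul0r)//; apply: contra ym => /andP[? ?]; rewrite !ltW.
  have [xL|xL] := boolP (0 <= x <= L); first by rewrite /=; ring.
  have xL' : ~~ (0 < x < L) by apply: contra xL => /andP[? ?]; rewrite !ltW.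
  by rewrite (test1_out ta) ?(test1_out (test1_derive ta)) ?(mulr0, addr0, mul0r).
by apply: filterS => y h ym; apply: h; rewrite /= in_itv.
Qed.

(** [slicing] works in the first variable, whence the exchange of coordinates, and on a bounded
    interval, whence a constant that may depend on [n]. *)
Lemma slice_y L f g (n : nat) : 0 < L -> L2 (leb2 R) setT f -> L2 (leb2 R) setT g ->
  on_strip L f -> on_strip L g -> weak_tens L 0 1 f g ->
  {ae mu, forall x, exists c, {ae mu, forall y, - n.+1%:R <= y <= n.+1%:R ->
     f (x, y) = c + \int[mu]_(s in `[- n.+1%:R, y]) g (x, s)}}.
Proof.
move=> L0 lf lg fs gs w; set m := n.+1%:R.
have m0 : 0 < m by rewrite ltr0n.
have mm : - m < m by rewrite gtrN.
have := @slicing _ _ _ mu (- m) m `[0, L] _ (fun p => f (p.2, p.1)) (fun p => g (p.2, p.1))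
  mm (separating1 L0) (L2_swap lf) (L2_swap lg) _.
move=> /(_ _)/wrap[].
  move=> i j.
  have tb := test_familyP (- m) m i; have ta := test1_bumpf 0 L j.
  have lta := L2_tens ta (test1_derive tb); have ltb := L2_tens ta tb.
  have I1 := L2_prod measurableT lf lta; have I2 := L2_prod measurableT lg ltb.
  rewrite -[RHS](subrr (\int[leb2 R]_p (f p * tens (bumpf 0 L j) ('D_1 (test_family (- m) m i)) p))).
  rewrite {2}(w m _ _ m0 ta tb) expr1 mulN1r opprK -RintegralD//.
  rewrite -(swap_integrable (integrable_funD measurableT I1 I2)).2.
  apply: eq_Rintegral => -[x y] _; rewrite /tens/= indicE in_setX/= !mem_setE !in_itv/=.
  have [xm|xm] := boolP (- m <= x <= m); last first.
    have xm' : ~~ (- m < x < m) by apply: contra xm => /andP[? ?]; rewrite !ltW.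
    by rewrite (test1_out tb) ?(test1_out (test1_derive tb)) ?(mulr0, addr0, mul0r).
  have [yL|yL] := boolP (0 <= y <= L); first by rewrite /=; ring.
  by rewrite (test1_out ta) ?(mulr0, addr0, mul0r)//; apply: contra yL => /andP[? ?]; rewrite !ltW.
apply: filterS => x h; have [xL|xL] := boolP (0 <= x <= L).
  by apply: h; rewrite /= in_itv.
have xL' : ~~ (0 < x < L) by apply: contra xL => /andP[? ?]; rewrite !ltW.
exists 0; apply: aeW => y _; rewrite fs// add0r.
transitivity (\int[mu]_(s in `[- m, y]) (0 : R)); first by rewrite Rintegral_cst// mul0r.
by apply: eq_Rintegral => s _; rewrite gs.
Qed.

(** Traces and Bochner spaces each come with their own derivatives; this identifies them with those
    already at hand. The difference is orthogonal to all tensor bumps on each rectangle of an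
    exhaustion. *)
Lemma weak_tens_unique L i j v f g : 0 < L ->
  L2 (leb2 R) setT f -> L2 (leb2 R) setT g -> on_strip L f -> on_strip L g ->
  weak_tens L i j v f -> weak_tens L i j v g -> {ae leb2 R, forall p, f p = g p}.
Proof.
move=> L0 lf lg fs gs vf vg.
have lfg := L2B measurableT lf lg.
have H (n : nat) : {ae leb2 R, forall p, (`[0, L] `*` `[- n.+1%:R, n.+1%:R]) p -> f p - g p = 0}.
  set m := n.+1%:R; have m0 : 0 < m by rewrite ltr0n.
  have mm : - m < m by rewrite gtrN.
  have [mB Bfin _] := separating2 L0 mm.
  apply; first exact: L2_integrable.
  move=> k; rewrite /bumpf2; case: unpickle => [[a b]|]; last first.
    by under eq_Rintegral do rewrite mulr0; rewrite Rintegral_cst// mul0r.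
  have ta := test1_bumpf 0 L a; have tb := test1_bumpf (- m) m b.
  rewrite Rintegral_mkcond.
  have h : \int[leb2 R]_p (f p * tens (bumpf 0 L a) (bumpf (- m) m b) p) =
           \int[leb2 R]_p (g p * tens (bumpf 0 L a) (bumpf (- m) m b) p).
    have := vf m _ _ m0 ta tb; rewrite (vg m _ _ m0 ta tb) => /esym.
    by move=> /(mulrI _); apply; rewrite unitrX// unitrN1.
  have lt := L2_tens ta tb.
  rewrite -[RHS](subrr (\int[leb2 R]_p (f p * tens (bumpf 0 L a) (bumpf (- m) m b) p))).
  rewrite {2}h -RintegralB//; last 2 first.
    exact: L2_prod.
    exact: L2_prod.
  apply: eq_Rintegral => -[x y] _; rewrite /tens/= restrictE0 in_setX/= !mem_setE !in_itv/=.
  have [xL|xL] := boolP (0 <= x <= L); last first.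
    by rewrite (test1_out ta) ?(mulr0, mul0r, subr0)//; apply: contra xL => /andP[? ?]; rewrite !ltW.
  have [yL|yL] := boolP (- m <= y <= m); first by rewrite /=; ring.
  by rewrite (test1_out tb) ?(mulr0, mul0r, subr0)//; apply: contra yL => /andP[? ?]; rewrite !ltW.
have := ae_foralln H; apply: filterS => -[x y] h.
have [xL|xL] := boolP (0 < x < L); last by rewrite fs ?gs.
apply/eqP; rewrite -subr_eq0; apply/eqP.
apply: (h (Num.truncn `|y|)); split; rewrite /= in_itv/=.
  by case/andP: xL => ? ?; rewrite !ltW.
by have := truncnS_gt `|y|; move=> /ltW; rewrite ler_norml.
Qed.

End weak_derivatives.

(** * Inequalities on a line *)

Section line.
Context {R : realType}.
Notation mu := (@lebesgue_measure R).
Implicit Types (a b L x y : R) (f g v w : R -> R).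

Lemma ae_itv_ex a b (P : R -> Prop) : a < b ->
  {ae mu, forall x, a <= x <= b -> P x} -> exists2 x, a <= x <= b & P x.
Proof.
move=> ab [N [mN N0 NP]]; apply: contrapT => h.
have : (mu `[a, b] <= mu N)%E.
  apply: le_measure; rewrite ?inE// => x /=; rewrite in_itv/= => xab.
  by apply: NP => /= /(_ xab) Px; apply: h; exists x.
by rewrite N0 lebesgue_measure_itv/= lte_fin ab -EFinB lee_fin leNgt subr_gt0 ab.
Qed.

Lemma isint_prim a b f : mu.-integrable `[a, b] (EFin \o f) ->
  isint a b (fun x => \int[mu]_(s in `[a, x]) f s) f.
Proof. by move=> fi; split => // x _; rewrite Rintegral_itv0 add0r. Qed.

Lemma isint_prim_cst a b c f : mu.-integrable `[a, b] (EFin \o f) ->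
  isint a b (fun x => c + \int[mu]_(s in `[a, x]) f s) f.
Proof. by move=> fi; split => // x _; rewrite Rintegral_itv0 addr0. Qed.

Lemma isint_primr a b f : a <= b -> mu.-integrable `[a, b] (EFin \o f) ->
  isint a b (fun x => - \int[mu]_(s in `[x, b]) f s) f.
Proof.
move=> ab fi; split => // x xab; rewrite (Rintegral_itv_cat xab fi); ring.
Qed.

Lemma isint_ae_deriv a b F f g : isint a b F f -> a <= b ->
  (exists h, isint a b g h) ->
  {ae mu, forall x, a <= x <= b -> f x = g x} -> isint a b F g.
Proof.
move=> Ff ab [h gh] fg; apply: (isint_ae Ff) => //; exact: isint_measurable gh.
Qed.

(** In terms of the continuous representatives [W], [W1], [W2] of [v], [v1], [v2], the integrand is
    the derivative of [(1 + x) (W^2 + 2/3 W^3 + 2 W W2 - W1^2) - 2 W W1]. Since [W] vanishes at both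
    ends and [W1] at [L], the integral is [W1(0)^2]. The unknown value [c] of [W2] at 0 is
    multiplied by [W(0) = 0]. *)
Lemma line_ineq L c v v1 v2 v3 : 0 < L -> measurable_fun `[0, L] v ->
  mu.-integrable `[0, L] (EFin \o v1) -> mu.-integrable `[0, L] (EFin \o v2) ->
  mu.-integrable `[0, L] (EFin \o v3) ->
  {ae mu, forall x, 0 <= x <= L -> v x = \int[mu]_(s in `[0, x]) v1 s} ->
  {ae mu, forall x, 0 <= x <= L -> v x = - \int[mu]_(s in `[x, L]) v1 s} ->
  {ae mu, forall x, 0 <= x <= L -> v1 x = - \int[mu]_(s in `[x, L]) v2 s} ->
  {ae mu, forall x, 0 <= x <= L -> v2 x = c + \int[mu]_(s in `[0, x]) v3 s} ->
  0 <= \int[mu]_(x in `[0, L]) (2 * (1 + x) * v x * (v1 x + v x * v1 x + v3 x)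
          - 3 * v1 x ^+ 2 + v x ^+ 2 + 2 / 3 * v x ^+ 3).
Proof.
move=> L0 mv i1 i2 i3 e0 eL e1 e2; have L0' := ltW L0.
pose W x := \int[mu]_(s in `[0, x]) v1 s.
pose W1 x := - \int[mu]_(s in `[x, L]) v2 s.
pose W2 x := c + \int[mu]_(s in `[0, x]) v3 s.
have W0 : W 0 = 0 by rewrite /W Rintegral_itv0.
have WL : W L = 0.
  (* At a point where both representations of [v] hold, the integrals of [v1] to its left and to its
     right are opposite. *)
  have [x xL [h1 h2]] : exists2 x, 0 <= x <= L &
      (v x = \int[mu]_(s in `[0, x]) v1 s) /\ (v x = - \int[mu]_(s in `[x, L]) v1 s).
    by apply: ae_itv_ex => //; apply: filterS2 e0 eL => x h1 h2 xL; rewrite -h1// -h2.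
  rewrite /W (Rintegral_itv_cat xL i1) -h1 h2; ring.
have W1L : W1 L = 0 by rewrite /W1 Rintegral_itv0 oppr0.
have W2i : isint 0 L W2 v3 by exact: isint_prim_cst.
have W1i : isint 0 L W1 W2.
  by apply: isint_ae_deriv e2 => //; [exact: isint_primr|exists v3].
have Wi : isint 0 L W W1.
  by apply: isint_ae_deriv e1 => //; [exact: isint_prim|exists W2].
have Xi : isint 0 L (fun x => 1 + x) (fun x => 0 + 1).
  exact: isintD (isint_cst 0 L 1) (isint_id 0 L).
have WWi := isintM L0' Wi Wi.
have XWW := isintM L0' Xi WWi.
have XWWW := isintM L0' XWW Wi.
have XWW2 := isintM L0' (isintM L0' Xi Wi) W2i.
have XW1W1 := isintM L0' Xi (isintM L0' W1i W1i).
have WW1 := isintM L0' Wi W1i.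
have Hi := isintD (isintD XWW (isintZ (2 / 3) XWWW))
  (isintB (isintB (isintZ 2 XWW2) XW1W1) (isintZ 2 WW1)).
have tot := isint_total L0' Hi.
rewrite (_ : \int[mu]_(x in _) _ = \int[mu]_(s in `[0, L])
      (((0 + 1) * (W s * W s) + (W1 s * W s + W1 s * W s) * (1 + s) +
        2 / 3 *
        (((0 + 1) * (W s * W s) + (W1 s * W s + W1 s * W s) * (1 + s)) * W s +
         W1 s * ((1 + s) * (W s * W s)))) +
       (2 * (((0 + 1) * W s + W1 s * (1 + s)) * W2 s + v3 s * ((1 + s) * W s)) -
        ((0 + 1) * (W1 s * W1 s) + (W2 s * W1 s + W2 s * W1 s) * (1 + s)) -
        2 * (W1 s * W1 s + W2 s * W s)))).
  rewrite tot W0 WL W1L !(mulr0, mul0r, addr0, subr0, sub0r, add0r).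
  by rewrite opprK mul1r -expr2 sqr_ge0.
have mX : measurable_fun `[0, L] (fun x : R => x) by exact: measurable_id.
have m1 := integrable_measurable i1; have m3 := integrable_measurable i3.
apply: ae_eq_Rintegral => //.
- by repeat first [assumption | exact: measurable_cst | apply: measurable_funX |
    apply: measurable_funM | apply: measurable_funN | apply: measurable_funD].
- exact: integrable_measurable Hi.1.
- apply: filterS2 e0 e1 => x h0 h1; rewrite /= in_itv/= => xL.
  by rewrite h0// h1// -/(W x) -/(W1 x); field.
Qed.

Lemma L2_sub_itv a b x y f : a <= x -> y <= b -> L2 mu `[a, b] f -> L2 mu `[x, y] f.
Proof.
move=> ax yb [mf fi]; split; last exact: integrable_sub_itv fi.
apply: measurable_funS mf => // z /=; rewrite !in_itv/= => /andP[xz zy].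
by rewrite (le_trans ax)//= (le_trans zy).
Qed.

Lemma itv_cauchy_schwarz x y f : x <= y -> L2 mu `[x, y] f ->
  (\int[mu]_(s in `[x, y]) f s) ^+ 2 <= (y - x) * \int[mu]_(s in `[x, y]) f s ^+ 2.
Proof.
move=> xy lf; have l1 : L2 mu `[x, y] (fun=> 1).
  split => //; rewrite /= (_ : EFin \o _ = EFin \o cst 1); first exact: (isint_id x y).1.
  by apply/funext => z /=; rewrite expr1n.
have := @cauchy_schwarz _ _ _ mu _ _ _ (measurable_itv _) l1 lf.
have -> : \int[mu]_(z in `[x, y]) (1 ^+ 2 : R) = y - x.
  by rewrite -(isint_total xy (isint_id x y)); apply: eq_Rintegral => z _; rewrite expr1n.
by under eq_Rintegral do rewrite mul1r.
Qed.

(** Each half of the interval is estimated from its own end, by Cauchy-Schwarz: on the left half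
    [v(x)^2] is at most [x] times the integral of [v1^2] over this half, and integrating [x] up to
    [L / 2] gives [L^2 / 8]. *)
Lemma line_poincare L v v1 : 0 < L -> measurable_fun `[0, L] v ->
  L2 mu `[0, L] v1 ->
  {ae mu, forall x, 0 <= x <= L -> v x = \int[mu]_(s in `[0, x]) v1 s} ->
  {ae mu, forall x, 0 <= x <= L -> v x = - \int[mu]_(s in `[x, L]) v1 s} ->
  \int[mu]_(x in `[0, L]) (v x) ^+ 2 <= L ^+ 2 / 8 * \int[mu]_(x in `[0, L]) (v1 x) ^+ 2.
Proof.
move=> L0 mv l1 e0 eL; have L0' := ltW L0.
have i1 : mu.-integrable `[0, L] (EFin \o v1).
  have l2 : L2 mu `[0, L] (fun=> 1).
    split => //; rewrite /= (_ : EFin \o _ = EFin \o cst 1); first exact: (isint_id 0 L).1.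
    by apply/funext => z /=; rewrite expr1n.
  by apply: eq_integrable (@L2_prod _ _ _ mu _ _ _ (measurable_itv _) l2 l1) => // x _ /=; rewrite mul1r.
pose W x := \int[mu]_(s in `[0, x]) v1 s.
have Wi : isint 0 L W v1 by exact: isint_prim.
have vi : mu.-integrable `[0, L] (EFin \o (fun x => v x ^+ 2)).
  have WWi := isint_integrable L0' (isintM L0' Wi Wi).
  apply: (ae_eq_integrable _ _ _ WWi) => //; first exact: measurable_funX.
  by apply: filterS e0 => x h; rewrite /= in_itv/= => /h ->.
pose h := L / 2; have h0 : 0 <= h by rewrite divr_ge0.
have hL : h <= L by rewrite ler_pdivrMr// mulr_natr mulr2n lerDl.
have v12 := l1.2.
have hh : 0 <= h <= L by rewrite h0.
rewrite (Rintegral_itv_cat hh vi) (Rintegral_itv_cat hh v12) mulrDr lerD//.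
  set A := \int[mu]_(s in `[0, h]) v1 s ^+ 2.
  have xi : isint 0 h (fun x => A / 2 * (x * x)) (fun x => A / 2 * (1 * x + 1 * x)).
    by apply: isintZ; apply: isintM => //; exact: isint_id.
  have -> : L ^+ 2 / 8 * A = \int[mu]_(x in `[0, h]) (A / 2 * (1 * x + 1 * x)).
    by rewrite (isint_total h0 xi) /h; field.
  apply: ae_le_Rintegral => //; [exact: integrable_sub_itv vi|exact: xi.1|].
  apply: filterS e0 => x hx; rewrite /= in_itv/= => /andP[x0 xh].
  rewrite hx ?x0 ?(le_trans xh)//.
  have xL : x <= L := le_trans xh hL.
  apply: le_trans (itv_cauchy_schwarz x0 (L2_sub_itv (lexx 0) xL l1)) _.
  rewrite subr0 (_ : A / 2 * _ = x * A); last by field.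
  rewrite ler_wpM2l// /A (@Rintegral_itv_cat _ 0 x h); last 2 first.
  - by rewrite x0.
  - exact: integrable_sub_itv v12.
  by rewrite lerDl; exact: Rintegral_sqr_ge0.
set A := \int[mu]_(s in `[h, L]) v1 s ^+ 2.
have xi : isint h L (fun x => A * (L * x) - A / 2 * (x * x))
    (fun x => A * (L * 1) - A / 2 * (1 * x + 1 * x)).
  apply: isintB; first by apply/isintZ/isintZ; exact: isint_id.
  by apply: isintZ; apply: isintM => //; exact: isint_id.
have -> : L ^+ 2 / 8 * A = \int[mu]_(x in `[h, L]) (A * (L * 1) - A / 2 * (1 * x + 1 * x)).
  by rewrite (isint_total hL xi) /h; field.
apply: ae_le_Rintegral => //; [exact: integrable_sub_itv vi|exact: xi.1|].
apply: filterS eL => x hx; rewrite /= in_itv/= => /andP[hx' xL].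
have x0 : 0 <= x := le_trans h0 hx'.
rewrite hx ?x0// sqrrN.
apply: le_trans (itv_cauchy_schwarz xL (L2_sub_itv x0 (lexx L) l1)) _.
rewrite (_ : A * _ - _ = (L - x) * A); last by field.
rewrite ler_wpM2l ?subr_ge0// /A (@Rintegral_itv_cat _ h x L); last 2 first.
- by rewrite hx'.
- exact: integrable_sub_itv v12.
by rewrite lerDr; exact: Rintegral_sqr_ge0.
Qed.

(* [v ^ 2] is twice the integral of [v v'], from the end where [v] vanishes. *)
Lemma line_sup L v v1 : 0 < L -> L2 mu `[0, L] v -> L2 mu `[0, L] v1 ->
  {ae mu, forall x, 0 <= x <= L -> v x = \int[mu]_(s in `[0, x]) v1 s} ->
  {ae mu, forall x, 0 <= x <= L -> v x ^+ 2 <= 2 * \int[mu]_(s in `[0, L]) `|v s * v1 s|}.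
Proof.
move=> L0 lv l1 e0; have L0' := ltW L0.
have i1' : mu.-integrable `[0, L] (EFin \o v1).
  have l2 : L2 mu `[0, L] (fun=> 1).
    split => //; rewrite /= (_ : EFin \o _ = EFin \o cst 1); first exact: (isint_id 0 L).1.
    by apply/funext => z /=; rewrite expr1n.
  by apply: eq_integrable (@L2_prod _ _ _ mu _ _ _ (measurable_itv _) l2 l1) => // x _ /=; rewrite mul1r.
pose W x := \int[mu]_(s in `[0, x]) v1 s.
have Wi : isint 0 L W v1 by exact: isint_prim.
have vvi := @L2_prod _ _ _ mu _ _ _ (measurable_itv _) lv l1.
have WWi : isint 0 L (fun x => W x * W x) (fun x => 2 * (v x * v1 x)).
  apply: (isint_ae (isintM L0' Wi Wi)).
    by apply: measurable_funM => //; exact: integrable_measurable vvi.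
  by apply: filterS e0 => x h xL; rewrite (h xL) -/(W x); ring.
apply: filterS e0 => x h /[dup] xL /andP[x0 xL']; rewrite (h xL) -/(W x) expr2.
rewrite (WWi.2 x xL) {1}/W Rintegral_itv0 mul0r add0r.
have vx : mu.-integrable `[0, x] (EFin \o (fun s => v s * v1 s)) by exact: integrable_sub_itv vvi.
rewrite RintegralZl// ler_pM2l// (le_trans (ler_norm _))//.
rewrite (le_trans (le_normr_Rintegral _ vx))//.
rewrite (@Rintegral_itv_cat _ 0 x L) ?lerDl ?Rintegral_ge0//.
exact: integrable_norm.
Qed.

Lemma Rintegral_le_setT a b f : mu.-integrable setT (EFin \o f) -> (forall x, 0 <= f x) ->
  \int[mu]_(s in `[a, b]) f s <= \int[mu]_s f s.
Proof.
move=> fi f0; rewrite Rintegral_mkcond; apply: le_Rintegral => //.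
- by apply: (@integrable_itvT _ a b f); apply: integrableS fi.
- by move=> x _; rewrite restrict_itvE; case: ifPn.
Qed.

(** There is no end at which [v] is known to vanish. On [[- m, m]] one has [v(y)^2 <= v(z)^2 + Q]
    for almost all [y] and [z]; averaging over [z] bounds [v(y)^2] by [I / (2 m) + Q], and [m] tends
    to infinity. *)
Lemma real_line_sup v v1 : L2 mu setT v -> L2 mu setT v1 ->
  (forall n : nat, exists c, {ae mu, forall y, - n.+1%:R <= y <= n.+1%:R ->
     v y = c + \int[mu]_(s in `[- n.+1%:R, y]) v1 s}) ->
  {ae mu, forall y, v y ^+ 2 <= 2 * \int[mu]_s `|v s * v1 s|}.
Proof.
move=> lv l1 h.
have vvi := L2_prod measurableT lv l1; have vi := lv.2.
have ni := integrable_norm vvi.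
pose Q := 2 * \int[mu]_s `|v s * v1 s|; pose I := \int[mu]_s v s ^+ 2.
have I0 : 0 <= I by exact: Rintegral_sqr_ge0.
have H (n : nat) : {ae mu, forall y, - n.+1%:R <= y <= n.+1%:R ->
     v y ^+ 2 * (2 * n.+1%:R) <= I + Q * (2 * n.+1%:R)}.
  have [c e] := h n; set m := n.+1%:R.
  have m0 : 0 < m by rewrite ltr0n.
  have mm : - m < m by rewrite gtrN.
  pose F y := c + \int[mu]_(s in `[- m, y]) v1 s.
  have i1 : mu.-integrable `[- m, m] (EFin \o v1).
    exact: (@L2_integrable _ _ _ mu _ _ (measurable_itv _) (lebesgue_itv_fin _ _) l1).
  have Fi : isint (- m) m F v1 by exact: isint_prim_cst.
  have FFi : isint (- m) m (fun x => F x * F x) (fun x => 2 * (v x * v1 x)).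
    apply: (isint_ae (isintM (ltW mm) Fi Fi)).
      by apply: measurable_funM => //; apply: measurable_funTS; exact: integrable_measurable vvi.
    by apply: filterS e => x hx xm; rewrite (hx xm) -/(F x); ring.
  have FQ y z : - m <= y <= m -> - m <= z <= m -> F y * F y <= F z * F z + Q.
    have K p q : - m <= p -> p <= q -> q <= m -> `|\int[mu]_(s in `[p, q]) (2 * (v s * v1 s))| <= Q.
      move=> mp pq qm.
      have vpq : mu.-integrable `[p, q] (EFin \o (fun s => v s * v1 s)) by apply: integrableS vvi.
      rewrite RintegralZl// normrM ger0_norm// ler_pM2l//.
      rewrite (le_trans (le_normr_Rintegral _ vpq))//.
      exact: Rintegral_le_setT.
    move=> /andP[my ym] /andP[mz zm]; have [yz|/ltW zy] := leP y z.
      rewrite (isint_itv FFi my yz zm) -addrA lerDl -lerBlDl sub0r.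
      by rewrite (le_trans _ (K y z my yz zm))// -normrN ler_norm.
    rewrite (isint_itv FFi mz zy ym) lerD2l.
    by rewrite (le_trans _ (K z y mz zy ym))// ler_norm.
  have ee := e; apply: filterS e => y hy ym; rewrite (hy ym) -/(F y) expr2.
  have vim : mu.-integrable `[- m, m] (EFin \o (fun s => v s ^+ 2)) by apply: integrableS vi.
  have ci k : mu.-integrable `[- m, m] (EFin \o cst k).
    by apply: continuous_compact_integrable; [exact: segment_compact|move=> x; exact: cvg_cst].
  have cE (k : R) : \int[mu]_(s in `[- m, m]) k = k * (2 * m).
    rewrite Rintegral_cst//= lebesgue_measure_itv/= lte_fin mm -EFinB/=; ring.
  rewrite -[leLHS]cE.
  apply: (@le_trans _ _ (\int[mu]_(s in `[- m, m]) (v s ^+ 2 + Q))).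
    apply: ae_le_Rintegral => //; [exact: ci|by apply: integrable_funD => //; exact: ci|].
    apply: filterS ee => z hz; rewrite /= in_itv/= => zm.
    by rewrite (hz zm) -/(F z) expr2; exact: FQ.
  rewrite RintegralD//; last exact: ci.
  rewrite cE lerD2r; apply: Rintegral_le_setT => // s; exact: sqr_ge0.
have := ae_foralln H; apply: filterS => y hy; rewrite -/Q.
rewrite leNgt; apply/negP => Qy.
(* Large enough for [y] to lie in the interval and for [I] to be less than [k.+1%:R] times the
   excess [v y ^+ 2 - Q]. *)
pose k := Num.truncn (`|y| + I / (v y ^+ 2 - Q)).
have d0 : 0 < v y ^+ 2 - Q by rewrite subr_gt0.
have k1 : `|y| + I / (v y ^+ 2 - Q) < k.+1%:R := truncnS_gt _.
have yk : - k.+1%:R <= y <= k.+1%:R.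
  rewrite -ler_norml ltW// (le_lt_trans _ k1)// lerDl divr_ge0//; exact: ltW.
have := hy k yk; rewrite -lerBlDr -mulrBl leNgt => /negP; apply.
have : I / (v y ^+ 2 - Q) < k.+1%:R by rewrite (le_lt_trans _ k1)// lerDr.
rewrite ltr_pdivrMr// mulrC => /lt_le_trans; apply.
by rewrite ler_pM2l// ler_peMl// ler1n.
Qed.

(* No decay at infinity is known: one first multiplies by 1 - (y / n)^2. *)
Lemma real_line_ibp f f1 g g1 : L2 mu setT f -> L2 mu setT f1 ->
  L2 mu setT g -> L2 mu setT g1 ->
  (forall n : nat, exists c, {ae mu, forall y, - n.+1%:R <= y <= n.+1%:R ->
     f y = c + \int[mu]_(s in `[- n.+1%:R, y]) f1 s}) ->
  (forall n : nat, exists c, {ae mu, forall y, - n.+1%:R <= y <= n.+1%:R ->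
     g y = c + \int[mu]_(s in `[- n.+1%:R, y]) g1 s}) ->
  \int[mu]_y (f y * g1 y + f1 y * g y) = 0.
Proof.
move=> lf lf1 lg lg1 hf hg.
have fg1 := L2_prod measurableT lf lg1; have f1g := L2_prod measurableT lf1 lg.
have fg := L2_prod measurableT lf lg.
pose k y := f y * g1 y + f1 y * g y.
have ki : mu.-integrable setT (EFin \o k) by exact: integrable_funD.
have mk := integrable_measurable ki.
pose eta (n : nat) y : R := 1 - n.+1%:R ^- 2 * (y * y).
pose In n := \int[mu]_(y in `[- n.+1%:R, n.+1%:R]) (k y * eta n y).
have etab n y : - n.+1%:R <= y <= n.+1%:R -> 0 <= eta n y <= 1.
  move=> yn; have n0 : 0 < n.+1%:R :> R by rewrite ltr0n.
  rewrite /eta subr_ge0 gerBl mulr_ge0 ?invr_ge0 ?exprn_ge0//; last by rewrite -expr2 sqr_ge0.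
  rewrite andbT mulrC ler_pdivrMr ?exprn_gt0// mul1r -expr2.
  by rewrite -(real_normK (num_real y)) lerXn2r ?nnegrE ?ler_norml// ltW.
have meta n : measurable_fun setT (eta n).
  by apply: measurable_funB => //; apply: measurable_funM => //; apply: measurable_funM.
pose P := \int[mu]_y `|f y * g y|.
(* [eta n] vanishes at both ends, so only its derivative remains after integration by parts, and
   this is at most [2 / n.+1%:R] in absolute value. *)
have Ib (n : nat) : `|In n| <= 2 * P * n.+1%:R^-1.
  have [c ef] := hf n; have [d eg] := hg n; move: ef eg; rewrite /In; set m := n.+1%:R => ef eg.
  have m0 : 0 < m by rewrite ltr0n.
  have mm : - m < m by rewrite gtrN.
  pose F y := c + \int[mu]_(s in `[- m, y]) f1 s.
  pose G y := d + \int[mu]_(s in `[- m, y]) g1 s.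
  have Fi : isint (- m) m F f1.
    by apply: isint_prim_cst; exact: (@L2_integrable _ _ _ mu _ _ (measurable_itv _) (lebesgue_itv_fin _ _) lf1).
  have Gi : isint (- m) m G g1.
    by apply: isint_prim_cst; exact: (@L2_integrable _ _ _ mu _ _ (measurable_itv _) (lebesgue_itv_fin _ _) lg1).
  have FG : isint (- m) m (fun y => F y * G y) k.
    apply: (isint_ae (isintM (ltW mm) Fi Gi)); first exact: measurable_funTS.
    by apply: filterS2 ef eg => y h1 h2 ym; rewrite /k h1// h2// -/(F y) -/(G y); ring.
  have Ei : isint (- m) m (eta n) (fun y => 0 - m ^- 2 * (1 * y + 1 * y)).
    apply: isintB; first exact: isint_cst.
    by apply: isintZ; apply: isintM; [exact: ltW|exact: isint_id|exact: isint_id].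
  have := isint_total (ltW mm) (isintM (ltW mm) FG Ei).
  have eta0 : eta n m = 0 /\ eta n (- m) = 0.
    by rewrite /eta -/m; split; field; rewrite gt_eqF.
  rewrite eta0.1 eta0.2 !mulr0 subrr RintegralD//; last 2 first.
  - exact: integrable_isintM (ltW mm) Ei FG.1.
  - exact: integrable_isintM (ltW mm) FG Ei.1.
  move=> /eqP; rewrite addr_eq0 => /eqP ->; rewrite normrN.
  have EFG := integrable_isintM (ltW mm) FG Ei.1.
  rewrite (le_trans (le_normr_Rintegral _ EFG))//.
  have fgm : mu.-integrable `[- m, m] (EFin \o (fun y => `|f y * g y|)).
    by apply: integrableS (integrable_norm fg).
  apply: (@le_trans _ _ (\int[mu]_(y in `[- m, m]) (2 * m^-1 * `|f y * g y|))).
    apply: ae_le_Rintegral => //; [exact: integrable_norm|exact: integrable_funZ|].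
    apply: filterS2 ef eg => y h1 h2; rewrite /= in_itv/= => ym.
    rewrite h1// h2// -/(F y) -/(G y) normrM ler_wpM2r// sub0r normrN.
    rewrite (_ : m ^- 2 * (1 * y + 1 * y) = 2 * m ^- 2 * y); last by ring.
    rewrite normrM ger0_norm; last by rewrite mulr_ge0// invr_ge0 exprn_ge0// ltW.
    rewrite -mulrA ler_pM2l// mulrC ler_pdivrMr ?exprn_gt0// expr2 mulrA mulVf ?gt_eqF//.
    by rewrite mul1r ler_norml.
  rewrite RintegralZl//.
  rewrite mulrAC ler_wpM2r ?invr_ge0 ?(ltW m0)// ler_pM2l//.
  by apply: Rintegral_le_setT => //; exact: integrable_norm.
have c0 : In n @[n --> \oo] --> (0 : R).
  apply: (@squeeze_cvgr _ _ _ _ (fun n : nat => - (2 * P * n.+1%:R^-1)) (fun n : nat => 2 * P * n.+1%:R^-1)).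
  - by apply: nearW => n; rewrite -ler_norml.
  - rewrite -oppr0 -(mulr0 (2 * P)); apply: cvgN; apply: cvgM; first exact: cvg_cst.
    exact: cvg_harmonic.
  - by rewrite -(mulr0 (2 * P)); apply: cvgM; [exact: cvg_cst|exact: cvg_harmonic].
have c1 : In n @[n --> \oo] --> \int[mu]_y k y.
  have := @Rintegral_dct _ _ _ mu setT (fun n y => ((fun y => k y * eta n y) \_ `[- n.+1%:R, n.+1%:R]) y) k (fun y => `|k y|) measurableT.
  have E n : In n = \int[mu]_y ((fun y => k y * eta n y) \_ `[- n.+1%:R, n.+1%:R]) y.
    by rewrite /In Rintegral_mkcond.
  move=> h; rewrite (_ : In = fun n => \int[mu]_y ((fun y => k y * eta n y) \_ `[- n.+1%:R, n.+1%:R]) y); last exact/funext.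
  apply: h => //.
  - move=> n; apply/(measurable_restrictT _ (measurable_itv _)); apply: measurable_funTS.
    exact: measurable_funM.
  - exact: integrable_norm.
  - move=> y _; rewrite -[X in _ --> X]mulr1.
    have e1 : eta n y @[n --> \oo] --> (1 : R).
      rewrite -[X in _ --> X]subr0 -(mul0r (y * y)); apply: cvgB; first exact: cvg_cst.
      apply: cvgM; last exact: cvg_cst.
      rewrite (_ : (fun _ => _) = (fun n : nat => n.+1%:R^-1 * n.+1%:R^-1)).
        by rewrite -(mul0r (0 : R)); apply: cvgM; exact: cvg_harmonic.
      by apply/funext => n; rewrite expr2 invfM.
    have c2 : k y * eta n y @[n --> \oo] --> k y * 1 by apply: cvgM => //; exact: cvg_cst.
    apply: (cvg_trans _ c2); apply: near_eq_cvg.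
    exists (Num.truncn `|y|) => // j /= hj.
    by rewrite restrict_itvE -ler_norml ifT// (le_trans (ltW (truncnS_gt _)))// ler_nat ltnS.
  - move=> n y _; rewrite restrict_itvE; case: ifPn => yn; last by rewrite normr0.
    by have /andP[h0 h1] := etab n y yn; rewrite normrM ler_piMr// ger0_norm.
exact: cvg_unique c1 c0.
Unshelve. all: by end_near. Qed.

End line.

Lemma ae_le_integrable d (T : measurableType d) (R : realType) (nu : {measure set T -> \bar R})
  (f g : T -> R) : measurable_fun setT f -> nu.-integrable setT (EFin \o g) ->
  {ae nu, forall x, `|f x| <= g x} -> nu.-integrable setT (EFin \o f).
Proof.
move=> mf gi fg; have mg := integrable_measurable gi.
apply: (@le_integrable_normr _ _ _ nu setT f (fun x => Num.max (g x) `|f x|)) => //.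
  by move=> x _; rewrite le_max lexx orbT.
apply: (@ae_eq_integrable _ _ _ nu setT g) => //.
  by apply: measurable_maxr => //; exact: measurableT_comp.
by apply: filterS fg => x h _; apply/esym/max_idPl.
Qed.

(** * Dissipation inequality *)

Section spatial.
Context {R : realType}.
Notation mu := (@lebesgue_measure R).
Implicit Types (L x y : R) (f g : R * R -> R).

(** Cutting the weight off outside [[0, L]] makes it bounded on the whole line; the functions it
    multiplies vanish there. *)
Definition wt L x : R := (1 + x) * \1_(`[0, L] : set R) x.

Lemma wtE L x : 0 <= x <= L -> wt L x = 1 + x.
Proof. by move=> xL; rewrite /wt indicE mem_setE in_itv/= xL mulr1. Qed.

Lemma wt_bound L x : 0 < L -> `|wt L x| <= 1 + L.
Proof.
move=> L0; rewrite /wt indicE mem_setE in_itv/=.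
have [/andP[x0 xL]|_] := boolP (0 <= x <= L); last first.
  by rewrite mulr0 normr0 addr_ge0// ltW.
by rewrite mulr1 ger0_norm ?addr_ge0// lerD2l.
Qed.

Lemma measurable_wt L : measurable_fun setT (wt L).
Proof.
apply: measurable_funM; last exact: measurable_indic.
by apply: measurable_funD => //; exact: measurable_cst.
Qed.

Lemma measurable_fst2 (h : R -> R) : measurable_fun setT h ->
  measurable_fun [set: measurableTypeR R * measurableTypeR R] (fun p => h p.1).
Proof. by move=> mh; exact: measurableT_comp mh measurable_fst. Qed.

Lemma measurable_snd2 (h : R -> R) : measurable_fun setT h ->
  measurable_fun [set: measurableTypeR R * measurableTypeR R] (fun p => h p.2).
Proof. by move=> mh; exact: measurableT_comp mh measurable_snd. Qed.

Lemma measurable_le_set d (T : measurableType d) (f g : T -> R) :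
  measurable_fun setT f -> measurable_fun setT g -> measurable [set x | f x <= g x].
Proof.
move=> mf mg; have mt : measurable [set true] by [].
by have := measurable_fun_ler mf mg measurableT mt; rewrite setTI.
Qed.

Lemma L2_wt L f : 0 < L -> L2 (leb2 R) setT f -> L2 (leb2 R) setT (fun p => f p * wt L p.1).
Proof.
move=> L0 lf; have mw := measurable_fst2 (@measurable_wt L).
apply: (@L2M _ _ _ (leb2 R) setT f (fun p => wt L p.1) (1 + L) measurableT lf mw).
by move=> p _; exact: wt_bound.
Qed.

Lemma Rintegral_supp L (h : R -> R) : (forall x, ~~ (0 <= x <= L) -> h x = 0) ->
  \int[mu]_x h x = \int[mu]_(x in `[0, L]) h x.
Proof.
move=> h0; rewrite [RHS]Rintegral_mkcond; apply: eq_Rintegral => x _.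
by rewrite restrict_itvE; case: ifPn => // /h0.
Qed.

Lemma on_strip_out L f x y : on_strip L f -> ~~ (0 <= x <= L) -> f (x, y) = 0.
Proof. by move=> fs xL; apply: fs => /=; apply: contra xL => /andP[? ?]; rewrite !ltW. Qed.

Lemma fubini_leb2 f : (leb2 R).-integrable setT (EFin \o f) ->
  \int[leb2 R]_p f p = \int[mu]_y \int[mu]_x f (x, y).
Proof. by move=> fi; exact/esym/(Rfubini2 fi). Qed.

Lemma fubini_leb2' f : (leb2 R).-integrable setT (EFin \o f) ->
  \int[leb2 R]_p f p = \int[mu]_x \int[mu]_y f (x, y).
Proof. by move=> fi; exact/esym/(Rfubini1 fi). Qed.

Lemma Rintegral0 d (T : measurableType d) (nu : {measure set T -> \bar R}) :
  \int[nu]_x (0 : R) = 0.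
Proof. by rewrite /Rintegral integral0. Qed.

(** The weight depends on [x] only, so it leaves the inner integral over [y], which is 0 by
    [real_line_ibp]. *)
Lemma ibp_y L f f1 g g1 (w : R -> R) (M : R) : 0 < L ->
  L2 (leb2 R) setT f -> L2 (leb2 R) setT f1 -> L2 (leb2 R) setT g -> L2 (leb2 R) setT g1 ->
  on_strip L f -> on_strip L f1 -> on_strip L g -> on_strip L g1 ->
  weak_tens L 0 1 f f1 -> weak_tens L 0 1 g g1 ->
  measurable_fun setT w -> (forall x, `|w x| <= M) ->
  \int[leb2 R]_p (w p.1 * (f p * g1 p + f1 p * g p)) = 0.
Proof.
move=> L0 lf lf1 lg lg1 sf sf1 sg sg1 wf wg mw wM.
have i1 := L2_prod measurableT lf lg1; have i2 := L2_prod measurableT lf1 lg.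
have i12 := integrable_funD measurableT i1 i2.
have wi : (leb2 R).-integrable setT (EFin \o (fun p => w p.1 * (f p * g1 p + f1 p * g p))).
  have := @integrable_funM _ _ _ (leb2 R) setT _ (fun p => w p.1) M measurableT i12.
  move=> /(_ (measurable_fst2 mw) (fun p _ => wM p.1)).
  by apply: eq_integrable => // p _ /=; rewrite mulrC.
rewrite (fubini_leb2' wi) -[RHS](@Rintegral0 _ _ mu); apply: ae_eq_Rintegral => //.
  exact: (measurable_Rslice1 wi).
have af := L2_slice1 lf; have af1 := L2_slice1 lf1.
have ag := L2_slice1 lg; have ag1 := L2_slice1 lg1.
have cf := ae_foralln (fun n => slice_y n L0 lf lf1 sf sf1 wf).
have cg := ae_foralln (fun n => slice_y n L0 lg lg1 sg sg1 wg).
have ai := ae_slice1 i12.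
near=> x => _.
have h1 : L2 mu setT (fun y => f (x, y)) by near: x; exact: af.
have h2 : L2 mu setT (fun y => f1 (x, y)) by near: x; exact: af1.
have h3 : L2 mu setT (fun y => g (x, y)) by near: x; exact: ag.
have h4 : L2 mu setT (fun y => g1 (x, y)) by near: x; exact: ag1.
have h0 : mu.-integrable setT (EFin \o (fun y => f (x, y) * g1 (x, y) + f1 (x, y) * g (x, y))).
  by near: x; exact: ai.
rewrite /= RintegralZl// (real_line_ibp h1 h2 h3 h4) ?mulr0//.
- by near: x; exact: cf.
- by near: x; exact: cg.
Unshelve. all: by end_near. Qed.

(* All functions are extended by zero outside the strip; the last three fields
   say that v vanishes at x = 0 and x = L, and vx at x = L. *)
Record spatial L (v vx vy vxx vxy vyy vxxx vxyy : R * R -> R) : Prop := Spatial {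
  sp_L2 : [/\ L2 (leb2 R) setT v, L2 (leb2 R) setT vx & L2 (leb2 R) setT vy] /\
    [/\ L2 (leb2 R) setT vxx, L2 (leb2 R) setT vxy, L2 (leb2 R) setT vyy,
        L2 (leb2 R) setT vxxx & L2 (leb2 R) setT vxyy];
  sp_strip : [/\ on_strip L v, on_strip L vx & on_strip L vy] /\
    [/\ on_strip L vxx, on_strip L vxy, on_strip L vyy, on_strip L vxxx & on_strip L vxyy];
  sp_x : weak_tens L 1 0 vxx vxxx /\ weak_tens L 1 0 vyy vxyy;
  sp_y : [/\ weak_tens L 0 1 v vy, weak_tens L 0 1 vy vyy,
             weak_tens L 0 1 vx vxy & weak_tens L 0 1 vxy vxyy];
  sp_trace0 : {ae mu, forall y, {ae mu, forall x, 0 <= x <= L ->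
     v (x, y) = \int[mu]_(s in `[0, x]) vx (s, y)}};
  sp_traceL : {ae mu, forall y, {ae mu, forall x, 0 <= x <= L ->
     v (x, y) = - \int[mu]_(s in `[x, L]) vx (s, y)}};
  sp_tracexL : {ae mu, forall y, {ae mu, forall x, 0 <= x <= L ->
     vx (x, y) = - \int[mu]_(s in `[x, L]) vxx (s, y)}} }.

Section inequalities.
Variables (L : R) (v vx vy vxx vxy vyy vxxx vxyy : R * R -> R).
Hypothesis L0 : 0 < L.
Hypothesis sp : spatial L v vx vy vxx vxy vyy vxxx vxyy.

Let lv : L2 (leb2 R) setT v. Proof. by case: sp => -[[]]. Qed.
Let lvx : L2 (leb2 R) setT vx. Proof. by case: sp => -[[]]. Qed.
Let lvy : L2 (leb2 R) setT vy. Proof. by case: sp => -[[]]. Qed.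
Let lvxx : L2 (leb2 R) setT vxx. Proof. by case: sp => -[_ []]. Qed.
Let lvxy : L2 (leb2 R) setT vxy. Proof. by case: sp => -[_ []]. Qed.
Let lvyy : L2 (leb2 R) setT vyy. Proof. by case: sp => -[_ []]. Qed.
Let lvxxx : L2 (leb2 R) setT vxxx. Proof. by case: sp => -[_ []]. Qed.
Let lvxyy : L2 (leb2 R) setT vxyy. Proof. by case: sp => -[_ []]. Qed.
Let sv : on_strip L v. Proof. by case: sp => _ -[[]]. Qed.
Let svx : on_strip L vx. Proof. by case: sp => _ -[[]]. Qed.
Let svy : on_strip L vy. Proof. by case: sp => _ -[[]]. Qed.
Let svxx : on_strip L vxx. Proof. by case: sp => _ -[_ []]. Qed.
Let svxy : on_strip L vxy. Proof. by case: sp => _ -[_ []]. Qed.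
Let svyy : on_strip L vyy. Proof. by case: sp => _ -[_ []]. Qed.
Let svxxx : on_strip L vxxx. Proof. by case: sp => _ -[_ []]. Qed.
Let svxyy : on_strip L vxyy. Proof. by case: sp => _ -[_ []]. Qed.

Let itvL2 (f : R -> R) : L2 mu setT f -> L2 mu `[0, L] f.
Proof.
move=> [mf fi]; split; first exact: measurable_funTS.
by apply: integrableS fi.
Qed.

Let itvI (f : R -> R) : L2 mu setT f -> mu.-integrable `[0, L] (EFin \o f).
Proof. exact: (@L2_integrable _ _ _ mu _ _ (measurable_itv _) (lebesgue_itv_fin _ _)). Qed.

Lemma poincare : \int[leb2 R]_p v p ^+ 2 <= L ^+ 2 / 8 * \int[leb2 R]_p vx p ^+ 2.
Proof.
rewrite (fubini_leb2 lv.2) (fubini_leb2 lvx.2) -RintegralZl//; last first.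
  exact: (integrable_Rslice2 lvx.2).
apply: ae_le_Rintegral => //.
- exact: (integrable_Rslice2 lv.2).
- by apply: integrable_funZ => //; exact: (integrable_Rslice2 lvx.2).
have a1 := L2_slice2 lv; have a2 := L2_slice2 lvx.
have a3 := sp_trace0 sp; have a4 := sp_traceL sp.
near=> y => _.
rewrite (@Rintegral_supp L (fun x => v (x, y) ^+ 2)); last first.
  by move=> x xL; rewrite (on_strip_out _ sv xL) expr0n.
rewrite (@Rintegral_supp L (fun x => vx (x, y) ^+ 2)); last first.
  by move=> x xL; rewrite (on_strip_out _ svx xL) expr0n.
have h1 : L2 mu setT (fun x => v (x, y)) by near: y; exact: a1.
have h2 : L2 mu setT (fun x => vx (x, y)) by near: y; exact: a2.
apply: (@line_poincare _ L (fun x => v (x, y)) (fun x => vx (x, y))) => //.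
- exact: measurable_funTS h1.1.
- exact: itvL2.
- by near: y; exact: a3.
- by near: y; exact: a4.
Unshelve. all: by end_near. Qed.

(** [v^2] is bounded by a function of [x] alone and by a function of [y] alone. Hence
    [v^4 <= qx(x) qy(y)], whose integral over the plane factors: this is the mechanism of the
    Ladyzhenskaya inequality. *)
Let qx (x : R) := 2 * \int[mu]_y `|v (x, y) * vy (x, y)|.
Let qy (y : R) := 2 * \int[mu]_x `|v (x, y) * vx (x, y)|.

Let ivvx : (leb2 R).-integrable setT (EFin \o (fun p => `|v p * vx p|)).
Proof. exact/integrable_norm/L2_prod. Qed.
Let ivvy : (leb2 R).-integrable setT (EFin \o (fun p => `|v p * vy p|)).
Proof. exact/integrable_norm/L2_prod. Qed.

Let iqx : mu.-integrable setT (EFin \o qx).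
Proof. apply: integrable_funZ => //; exact: (integrable_Rslice1 ivvy). Qed.
Let iqy : mu.-integrable setT (EFin \o qy).
Proof. apply: integrable_funZ => //; exact: (integrable_Rslice2 ivvx). Qed.

Let mv : measurable_fun setT v. Proof. exact: lv.1. Qed.

Let v_qy : {ae leb2 R, forall p, v p ^+ 2 <= qy p.2}.
Proof.
apply: (@prod_ae2 _ _ _ _ _ mu mu [set p | v p ^+ 2 <= qy p.2]).
  apply: measurable_le_set; first exact: measurable_funX.
  exact: measurable_snd2 (integrable_measurable iqy).
have a1 := L2_slice2 lv; have a2 := L2_slice2 lvx; have a3 := sp_trace0 sp.
near=> y.
have h1 : L2 mu setT (fun x => v (x, y)) by near: y; exact: a1.
have h2 : L2 mu setT (fun x => vx (x, y)) by near: y; exact: a2.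
have := @line_sup _ L (fun x => v (x, y)) (fun x => vx (x, y)) L0 (itvL2 h1) (itvL2 h2).
have h3 : {ae mu, forall x, 0 <= x <= L -> v (x, y) = \int[mu]_(s in `[0, x]) vx (s, y)}.
  by near: y; exact: a3.
move=> /(_ h3); apply: filterS => x hx /=.
rewrite /qy (@Rintegral_supp L (fun x => `|v (x, y) * vx (x, y)|)); last first.
  by move=> z zL; rewrite (on_strip_out _ sv zL) mul0r normr0.
have [xL|xL] := boolP (0 <= x <= L); first exact: hx.
by rewrite (on_strip_out _ sv xL) expr0n/= mulr_ge0// Rintegral_ge0.
Unshelve. all: by end_near. Qed.

Let v_qx : {ae leb2 R, forall p, v p ^+ 2 <= qx p.1}.
Proof.
apply: (@prod_ae1 _ _ _ _ _ mu mu [set p | v p ^+ 2 <= qx p.1]).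
  apply: measurable_le_set; first exact: measurable_funX.
  exact: measurable_fst2 (integrable_measurable iqx).
have [wv _ _ _] := sp_y sp.
have a1 := L2_slice1 lv; have a2 := L2_slice1 lvy.
have a3 := ae_foralln (fun n => slice_y n L0 lv lvy sv svy wv).
near=> x.
have h1 : L2 mu setT (fun y => v (x, y)) by near: x; exact: a1.
have h2 : L2 mu setT (fun y => vy (x, y)) by near: x; exact: a2.
have h3 : forall n : nat, exists c, {ae mu, forall y, - n.+1%:R <= y <= n.+1%:R ->
     v (x, y) = c + \int[mu]_(s in `[- n.+1%:R, y]) vy (x, s)} by near: x; exact: a3.
have := real_line_sup h1 h2 h3; apply: filterS => y h; exact: h.
Unshelve. all: by end_near. Qed.

Let U := \int[leb2 R]_p v p ^+ 2.
Let X := \int[leb2 R]_p vx p ^+ 2.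
Let Y := \int[leb2 R]_p vy p ^+ 2.

Let Ixy := integrable_tensor iqx iqy.

Let v4le : {ae leb2 R, forall p, v p ^+ 4 <= qx p.1 * qy p.2}.
Proof.
apply: filterS2 v_qx v_qy => p h1 h2.
by rewrite -[4%N]/(2 + 2)%N exprD ler_pM// sqr_ge0.
Qed.

Let v4i : (leb2 R).-integrable setT (EFin \o (fun p => v p ^+ 4)).
Proof.
apply: (ae_le_integrable _ Ixy); first exact: measurable_funX.
by apply: filterS v4le => p h; rewrite ger0_norm// (exprM _ 2 2) sqr_ge0.
Qed.

Let V4 := \int[leb2 R]_p v p ^+ 4.

Let nE (f : R * R -> R) : \int[leb2 R]_p `|f p| ^+ 2 = \int[leb2 R]_p f p ^+ 2.
Proof. by apply: eq_Rintegral => p _; rewrite real_normK// num_real. Qed.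

(** [a] and [b] stand for the integrals of [|v vx|] and [|v vy|]; bounding their squares avoids
    square roots. *)
Let V4_le : exists a b, [/\ 0 <= a, 0 <= b, a ^+ 2 <= U * X, b ^+ 2 <= U * Y & V4 <= 4 * a * b].
Proof.
exists (\int[leb2 R]_p `|v p * vx p|), (\int[leb2 R]_p `|v p * vy p|); split.
- by apply: Rintegral_ge0.
- by apply: Rintegral_ge0.
- have := cauchy_schwarz measurableT (L2_norm lv) (L2_norm lvx).
  have -> : \int[leb2 R]_p (`|v p| * `|vx p|) = \int[leb2 R]_p `|v p * vx p|.
    by apply: eq_Rintegral => p _; rewrite normrM.
  by rewrite !nE.
- have := cauchy_schwarz measurableT (L2_norm lv) (L2_norm lvy).
  have -> : \int[leb2 R]_p (`|v p| * `|vy p|) = \int[leb2 R]_p `|v p * vy p|.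
    by apply: eq_Rintegral => p _; rewrite normrM.
  by rewrite !nE.
- have h : \int[leb2 R]_p (qx p.1 * qy p.2) =
      4 * (\int[leb2 R]_p `|v p * vx p|) * (\int[leb2 R]_p `|v p * vy p|).
    rewrite (fubini_leb2 Ixy) /=.
    transitivity (\int[mu]_y ((\int[mu]_x qx x) * qy y)).
      by apply: eq_Rintegral => y _; rewrite RintegralZr.
    rewrite RintegralZl// /qx /qy RintegralZl//; last exact: (integrable_Rslice1 ivvy).
    rewrite RintegralZl//; last exact: (integrable_Rslice2 ivvx).
    by rewrite -(fubini_leb2' ivvy) -(fubini_leb2 ivvx); ring.
  by rewrite -h; apply: ae_le_Rintegral => //; apply: filterS v4le => p.
Qed.

Let v3i : (leb2 R).-integrable setT (EFin \o (fun p => `|v p| ^+ 3)).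
Proof.
apply: (@le_integrable_normr _ _ _ (leb2 R) setT _ (fun p => v p ^+ 2 + v p ^+ 4)) => //.
- by apply: measurable_funX; exact: measurableT_comp.
- move=> p _; rewrite normrX normr_id -(real_normK (num_real (v p))).
  rewrite -[v p ^+ 4](ger0_norm _) ?normrX; last by rewrite (exprM _ 2 2) sqr_ge0.
  have := sqr_ge0 (`|v p| - 1); have := normr_ge0 (v p); have := sqr_ge0 `|v p|; nra.
- exact: integrable_funD lv.2 v4i.
Qed.

Let N := \int[leb2 R]_p `|v p| ^+ 3.

(** Cauchy-Schwarz for [|v|^3 = |v| v^2] gives [N^2 <= U V4], which is squared once more to bring in
    [a^2] and [b^2]. *)
Lemma cubic_bound : N ^+ 4 <= 16 * U ^+ 4 * X * Y.
Proof.
have [a [b [a0 b0 aUX bUY V4ab]]] := V4_le.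
have l2 : L2 (leb2 R) setT (fun p => v p ^+ 2).
  split; first exact: measurable_funX.
  by apply: eq_integrable v4i => // p _ /=; rewrite -exprM.
have NU : N ^+ 2 <= U * V4.
  have := cauchy_schwarz measurableT (L2_norm lv) l2.
  have -> : \int[leb2 R]_p (`|v p| * v p ^+ 2) = N.
    by apply: eq_Rintegral => p _; rewrite -(real_normK (num_real (v p))) -exprS.
  rewrite nE (_ : \int[leb2 R]_p (v p ^+ 2) ^+ 2 = V4)//.
  by apply: eq_Rintegral => p _; rewrite -exprM.
have U0 : 0 <= U by exact: Rintegral_sqr_ge0.
have X0 : 0 <= X by exact: Rintegral_sqr_ge0.
have Y0 : 0 <= Y by exact: Rintegral_sqr_ge0.
have V0 : 0 <= V4 by apply: Rintegral_ge0 => p _; rewrite (exprM _ 2 2) sqr_ge0.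
rewrite (exprM N 2 2); apply: (@le_trans _ _ ((U * V4) ^+ 2)).
  by rewrite lerXn2r ?nnegrE ?sqr_ge0// mulr_ge0.
apply: (@le_trans _ _ ((U * (4 * a * b)) ^+ 2)).
  by rewrite lerXn2r ?nnegrE ?mulr_ge0// ler_wpM2l.
rewrite (_ : (U * (4 * a * b)) ^+ 2 = 16 * U ^+ 2 * (a ^+ 2 * b ^+ 2)); last by ring.
rewrite (_ : 16 * U ^+ 4 * X * Y = 16 * U ^+ 2 * ((U * X) * (U * Y))); last by ring.
by rewrite ler_wpM2l ?mulr_ge0 ?sqr_ge0// ler_pM ?sqr_ge0.
Qed.

Let w := wt L.
Let mw : measurable_fun setT w. Proof. exact: measurable_wt. Qed.
Let wb x : `|w x| <= 1 + L. Proof. exact: wt_bound. Qed.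
Let wi f g : L2 (leb2 R) setT f -> L2 (leb2 R) setT g ->
  (leb2 R).-integrable setT (EFin \o (fun p => w p.1 * (f p * g p))).
Proof.
move=> lf lg; have := L2_prod measurableT (L2_wt L0 lf) lg.
by apply: eq_integrable => // p _ /=; congr EFin; rewrite -/w; ring.
Qed.

(** On a line in [x] the integrand is the derivative of [(1 + x) v vyy], which vanishes at both ends
    because [v] does; no boundary value of [vyy] is involved. *)
Let ibp_x : \int[leb2 R]_p (v p * vyy p + w p.1 * (vx p * vyy p) + w p.1 * (v p * vxyy p)) = 0.
Proof.
have i1 := L2_prod measurableT lv lvyy.
have i123 := integrable_funD measurableT (integrable_funD measurableT i1 (wi lvx lvyy)) (wi lv lvxyy).
rewrite (fubini_leb2 i123) -[RHS](@Rintegral0 _ _ mu); apply: ae_eq_Rintegral => //.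
  exact: (measurable_Rslice2 i123).
have a1 := L2_slice2 lv; have a2 := L2_slice2 lvx.
have a3 := sp_trace0 sp; have a4 := sp_traceL sp.
have a5 := L2_slice2 lvyy; have a6 := L2_slice2 lvxyy.
have [_ wy] := sp_x sp.
have a7 := slice_x L0 lvyy lvxyy svyy svxyy wy.
near=> y => _.
rewrite (@Rintegral_supp L (fun x => v (x, y) * vyy (x, y) + w x * (vx (x, y) * vyy (x, y)) +
    w x * (v (x, y) * vxyy (x, y)))); last first.
  move=> x xL; rewrite (on_strip_out _ sv xL) (on_strip_out _ svx xL) !mul0r !mulr0.
  by rewrite !addr0.
have h1 : L2 mu setT (fun x => v (x, y)) by near: y; exact: a1.
have h2 : L2 mu setT (fun x => vx (x, y)) by near: y; exact: a2.
have h5 : L2 mu setT (fun x => vyy (x, y)) by near: y; exact: a5.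
have h6 : L2 mu setT (fun x => vxyy (x, y)) by near: y; exact: a6.
have h3 : {ae mu, forall x, 0 <= x <= L -> v (x, y) = \int[mu]_(s in `[0, x]) vx (s, y)}.
  by near: y; exact: a3.
have h4 : {ae mu, forall x, 0 <= x <= L -> v (x, y) = - \int[mu]_(s in `[x, L]) vx (s, y)}.
  by near: y; exact: a4.
have [c h7] : exists c, {ae mu, forall x, 0 <= x <= L ->
     vyy (x, y) = c + \int[mu]_(s in `[0, x]) vxyy (s, y)} by near: y; exact: a7.
pose W x := \int[mu]_(s in `[0, x]) vx (s, y).
pose Z x := c + \int[mu]_(s in `[0, x]) vxyy (s, y).
have Wi : isint 0 L W (fun x => vx (x, y)) by apply: isint_prim; exact: itvI.
have Zi : isint 0 L Z (fun x => vxyy (x, y)) by apply: isint_prim_cst; exact: itvI.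
have Xi : isint 0 L (fun x => 1 + x) (fun x => 0 + 1).
  exact: isintD (isint_cst 0 L 1) (isint_id 0 L).
have W0 : W 0 = 0 by rewrite /W Rintegral_itv0.
have WL : W L = 0.
  have [x xL [e1 e2]] : exists2 x, 0 <= x <= L &
      (v (x, y) = \int[mu]_(s in `[0, x]) vx (s, y)) /\
      (v (x, y) = - \int[mu]_(s in `[x, L]) vx (s, y)).
    by apply: ae_itv_ex => //; apply: filterS2 h3 h4 => x e1 e2 xL; rewrite -e1// -e2.
  rewrite /W (Rintegral_itv_cat xL (itvI h2)) -e1 e2; ring.
have Hi := isintM (ltW L0) (isintM (ltW L0) Xi Wi) Zi.
have := isint_total (ltW L0) Hi; rewrite W0 WL !(mulr0, mul0r) subrr => tot.
rewrite -[RHS]tot; apply: ae_eq_Rintegral => //.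
- have mm (f : R -> R) : L2 mu setT f -> measurable_fun `[0, L] f.
    by move=> [mf _]; exact: measurable_funTS.
  have mw' : measurable_fun `[0, L] w by exact: measurable_funTS.
  have ? := mm _ h1; have ? := mm _ h2; have ? := mm _ h5; have ? := mm _ h6.
  by repeat first [assumption | apply: measurable_funM | apply: measurable_funD].
- exact: integrable_measurable Hi.1.
- apply: filterS2 h3 h7 => x e1 e2; rewrite /= in_itv/= => xL.
  by rewrite e1// e2// -/(W x) -/(Z x) /w wtE//; ring.
Unshelve. all: by end_near. Qed.

(* Integrating by parts once in x and once in y, in the two possible orders,
   and adding up avoids any trace of vy on the boundary. *)
Lemma dissipation_y : \int[leb2 R]_p (2 * (w p.1 * (v p * vxyy p))) = Y.
Proof.
have [wy1 wy2 wy3 wy4] := sp_y sp.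
have e1 := @ibp_y L v vy vy vyy (fun=> 1) 1 L0 lv lvy lvy lvyy sv svy svy svyy wy1 wy2
  (measurable_cst _) (fun _ => eq_ind_r (fun z => z <= 1) (lexx 1) (normr1 R)).
have e2 := @ibp_y L vx vxy vy vyy w (1 + L) L0 lvx lvxy lvy lvyy svx svxy svy svyy wy3 wy2 mw wb.
have e3 := @ibp_y L v vy vxy vxyy w (1 + L) L0 lv lvy lvxy lvxyy sv svy svxy svxyy wy1 wy4 mw wb.
have i1 := wi lv lvxyy; have i2 := wi lvx lvyy; have i3 := wi lvxy lvy; have i4 := wi lvy lvxy.
have j1 := L2_prod measurableT lv lvyy; have j2 := L2_prod measurableT lvy lvy.
have j2E : \int[leb2 R]_p (vy p * vy p) = Y by apply: eq_Rintegral => p _; rewrite expr2.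
have E1 : \int[leb2 R]_p (v p * vyy p) + Y = 0.
  rewrite -j2E -RintegralD// -[RHS]e1; apply: eq_Rintegral => p _; ring.
have E2 : \int[leb2 R]_p (w p.1 * (vx p * vyy p)) + \int[leb2 R]_p (w p.1 * (vxy p * vy p)) = 0.
  rewrite -RintegralD// -[RHS]e2; apply: eq_Rintegral => p _; ring.
have E3 : \int[leb2 R]_p (w p.1 * (v p * vxyy p)) + \int[leb2 R]_p (w p.1 * (vxy p * vy p)) = 0.
  rewrite -RintegralD// -[RHS]e3; apply: eq_Rintegral => p _; ring.
have E4 : \int[leb2 R]_p (v p * vyy p) + \int[leb2 R]_p (w p.1 * (vx p * vyy p)) +
    \int[leb2 R]_p (w p.1 * (v p * vxyy p)) = 0.
  have := ibp_x; rewrite RintegralD//; last exact: (integrable_funD measurableT j1 i2).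
  by rewrite RintegralD.
(* [E2] and [E3] make the last two terms of [E4] equal, and by [E1] the first one is [- Y]. *)
rewrite RintegralZl//; lra.
Qed.

Let lin (t x u z n y : R) : 0 <= - t - y - 3 * x + u + 2 / 3 * z -> z <= n ->
  t <= - (3 * x) + u + 2 / 3 * n - y.
Proof. lra. Qed.

Lemma energy_dissipation vt : L2 (leb2 R) setT vt ->
  {ae leb2 R, forall p, vt p + (1 + v p) * vx p + vxxx p + vxyy p = 0} ->
  \int[leb2 R]_p (2 * (w p.1 * (v p * vt p))) <= - (3 * X) + U + 2 / 3 * N - Y.
Proof.
move=> lvt pde.
have i1 := integrable_funZ 2 measurableT (wi lv lvt).
have i2 := integrable_funZ 2 measurableT (wi lv lvxyy).
have i3 := integrable_funZ 3 measurableT lvx.2.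
have v3i' : (leb2 R).-integrable setT (EFin \o (fun p => v p ^+ 3)).
  apply: le_integrable_normr v3i => //; first exact: measurable_funX.
  by move=> p _; rewrite normrX.
have i4 := integrable_funZ (2 / 3) measurableT v3i'.
(* By the equation [- vt - vxyy] is [vx + v vx + vxxx], so on each line in [x] the function [K] is
   the integrand of [line_ineq]; over the plane, its term in [vxyy] is evaluated by
   [dissipation_y]. *)
pose K p := - (2 * (w p.1 * (v p * vt p))) - 2 * (w p.1 * (v p * vxyy p)) - 3 * vx p ^+ 2 +
  v p ^+ 2 + 2 / 3 * v p ^+ 3.
have i1' : (leb2 R).-integrable setT (EFin \o (fun p => - (2 * (w p.1 * (v p * vt p))))).
  by apply: eq_integrable (integrable_funZ (-1) measurableT i1) => // p _ /=; rewrite mulN1r.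
have k1 := integrable_funB measurableT i1' i2.
have k2 := integrable_funB measurableT k1 i3.
have k3 := integrable_funD measurableT k2 lv.2.
have Ki : (leb2 R).-integrable setT (EFin \o K) := integrable_funD measurableT k3 i4.
have KE : \int[leb2 R]_p K p = - (\int[leb2 R]_p (2 * (w p.1 * (v p * vt p)))) - Y - 3 * X + U +
    2 / 3 * \int[leb2 R]_p v p ^+ 3.
  rewrite /K (RintegralD measurableT k3 i4) (RintegralD measurableT k2 lv.2).
  rewrite (RintegralB measurableT k1 i3) (RintegralB measurableT i1' i2) dissipation_y.
  have -> : \int[leb2 R]_p (- (2 * (w p.1 * (v p * vt p)))) =
      - \int[leb2 R]_p (2 * (w p.1 * (v p * vt p))).
    by rewrite -mulN1r -RintegralZl//; apply: eq_Rintegral => p _; rewrite mulN1r.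
  by rewrite (RintegralZl _ measurableT v3i') (RintegralZl _ measurableT lvx.2).
have K0 : 0 <= \int[leb2 R]_p K p.
  rewrite (fubini_leb2 Ki) -(@Rintegral0 _ _ mu); apply: ae_le_Rintegral => //.
  - by apply: eq_integrable (integrable0 _ _).
  - exact: (integrable_Rslice2 Ki).
  have a1 := L2_slice2 lv; have a2 := L2_slice2 lvx; have a5 := L2_slice2 lvxx.
  have a6 := L2_slice2 lvxxx; have a9 := ae_slice2 Ki.
  have a3 := sp_trace0 sp; have a4 := sp_traceL sp; have a8 := sp_tracexL sp.
  have [wx _] := sp_x sp.
  have a7 := slice_x L0 lvxx lvxxx svxx svxxx wx.
  have a10 := ae_prod2 (m1 := mu) (m2 := mu) pde.
  near=> y => _.
  have h1 : L2 mu setT (fun x => v (x, y)) by near: y; exact: a1.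
  have h2 : L2 mu setT (fun x => vx (x, y)) by near: y; exact: a2.
  have h5 : L2 mu setT (fun x => vxx (x, y)) by near: y; exact: a5.
  have h6 : L2 mu setT (fun x => vxxx (x, y)) by near: y; exact: a6.
  have h9 : mu.-integrable setT (EFin \o (fun x => K (x, y))) by near: y; exact: a9.
  have h10 : {ae mu, forall x, vt (x, y) + (1 + v (x, y)) * vx (x, y) + vxxx (x, y) + vxyy (x, y) = 0}.
    by near: y; exact: a10.
  have [c h7] : exists c, {ae mu, forall x, 0 <= x <= L ->
     vxx (x, y) = c + \int[mu]_(s in `[0, x]) vxxx (s, y)} by near: y; exact: a7.
  have := @line_ineq _ L c (fun x => v (x, y)) (fun x => vx (x, y)) (fun x => vxx (x, y))
    (fun x => vxxx (x, y)) L0 (measurable_funTS h1.1) (itvI h2) (itvI h5) (itvI h6).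
  have h3 : {ae mu, forall x, 0 <= x <= L -> v (x, y) = \int[mu]_(s in `[0, x]) vx (s, y)}.
    by near: y; exact: a3.
  have h4 : {ae mu, forall x, 0 <= x <= L -> v (x, y) = - \int[mu]_(s in `[x, L]) vx (s, y)}.
    by near: y; exact: a4.
  have h8 : {ae mu, forall x, 0 <= x <= L -> vx (x, y) = - \int[mu]_(s in `[x, L]) vxx (s, y)}.
    by near: y; exact: a8.
  move=> /(_ h3 h4 h8 h7); rewrite (@Rintegral_supp L (fun x => K (x, y))); last first.
    move=> x xL; rewrite /K (on_strip_out _ sv xL) (on_strip_out _ svx xL).
    by rewrite !(mul0r, mulr0, expr0n)/= !(mulr0, oppr0, subr0, addr0).
  rewrite (@ae_eq_Rintegral _ _ _ mu `[0, L] _ (fun x => K (x, y)))//.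
  - have mm (f : R -> R) : L2 mu setT f -> measurable_fun `[0, L] f.
      by move=> [mf _]; exact: measurable_funTS.
    have ? := mm _ h1; have ? := mm _ h2; have ? := mm _ h5; have ? := mm _ h6.
    have mi : measurable_fun `[0, L] (fun x : R => x) by exact: measurable_id.
    by repeat first [assumption | exact: measurable_cst | apply: measurable_funX |
      apply: measurable_funM | apply: measurable_funN | apply: measurable_funD].
  - exact: measurable_funTS (integrable_measurable h9).
  - apply: filterS h10 => x e; rewrite /= in_itv/= => xL.
    have vtE : vt (x, y) = - ((1 + v (x, y)) * vx (x, y) + vxxx (x, y) + vxyy (x, y)).
      by apply/eqP; rewrite -addr_eq0 addrA addrA e.
    by rewrite /K /= vtE /w wtE//; ring.
have V3N : \int[leb2 R]_p v p ^+ 3 <= N.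
  by apply: le_Rintegral => // p _; rewrite -normrX ler_norm.
by rewrite KE in K0; exact: lin K0 V3N.
Unshelve. all: by end_near. Qed.

End inequalities.

(* With a = A^2 L^2 / 8, the smallness of U gives
   ((2 / 3) N)^4 <= a^4 X^3 Y <= (a X + Y)^4. *)
Lemma decay_algebra (A L U X Y N : R) : 0 < L -> 24 / L ^+ 2 - 1 = 2 * A ^+ 2 ->
  0 <= U -> 0 <= X -> 0 <= Y -> 0 <= N -> U <= L ^+ 2 / 8 * X ->
  N ^+ 4 <= 16 * U ^+ 4 * X * Y ->
  U <= 9 * ((24 - L ^+ 2) ^+ 2 / (2 ^+ 9 * L ^+ 2)) ->
  - (3 * X) + U + 2 / 3 * N - Y <= - (A ^+ 2 * U).
Proof.
move=> L0 hA U0 X0 Y0 N0 UX N4 Us.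
have L2 : 0 < L ^+ 2 by rewrite exprn_gt0.
have Ln : L != 0 by rewrite gt_eqF.
(* [a X] is the share of [3 X] set aside for the cubic term; by the Poincare inequality the rest,
   [(3 - a) X], still dominates [(1 + A ^+ 2) U]. *)
have [a aE] : exists a, a = A ^+ 2 * L ^+ 2 / 8 by eexists.
have a0 : 0 <= a by rewrite aE divr_ge0// mulr_ge0 ?sqr_ge0.
have LA : 24 - L ^+ 2 = 16 * a.
  have -> : 16 * a = 2 * A ^+ 2 * L ^+ 2 by rewrite aE; field.
  by rewrite -hA; field.
have a32 : a <= 3 / 2 by have := ltW L2; lra.
have Us' : U * (2 * L ^+ 2) <= 9 * a ^+ 2.
  have : U * (2 * L ^+ 2) <= 9 * ((24 - L ^+ 2) ^+ 2 / (2 ^+ 9 * L ^+ 2)) * (2 * L ^+ 2).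
    by rewrite ler_wpM2r// mulr_ge0// ltW.
  rewrite LA (_ : 9 * _ * (2 * L ^+ 2) = 9 * a ^+ 2) //; last by field.
(* One factor [U] is bounded by the threshold, the other by the Poincare inequality. The value of
   the threshold is such that [(3 / 4) ^+ 4] then cancels [16 * (2 / 3) ^+ 4]. *)
have UU : U ^+ 2 <= (3 / 4 * a) ^+ 2 * X.
  apply: (@le_trans _ _ (U * (L ^+ 2 / 8 * X))); first by rewrite expr2 ler_wpM2l.
  rewrite (_ : U * _ = U * (2 * L ^+ 2) * (X / 16)); last by field.
  rewrite (_ : (3 / 4 * a) ^+ 2 * X = 9 * a ^+ 2 * (X / 16)); last by field.
  by rewrite ler_wpM2r// divr_ge0.
have N4' : (2 / 3 * N) ^+ 4 <= (a * X + Y) ^+ 4.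
  have U4 : U ^+ 4 <= ((3 / 4 * a) ^+ 2 * X) ^+ 2.
    rewrite (exprM U 2 2) lerXn2r ?nnegrE ?sqr_ge0// mulr_ge0 ?sqr_ge0//.
  have XY : 0 <= X * Y by rewrite mulr_ge0.
  have h1 : (2 / 3 * N) ^+ 4 <= a ^+ 4 * X ^+ 3 * Y.
    rewrite exprMn; apply: (@le_trans _ _ ((2 / 3) ^+ 4 * (16 * ((3 / 4 * a) ^+ 2 * X) ^+ 2 * (X * Y)))).
      rewrite ler_wpM2l ?exprn_ge0 ?divr_ge0//; apply: le_trans N4 _.
      by rewrite -mulrA ler_wpM2r// ler_wpM2l.
    by rewrite le_eqVlt; apply/orP; left; apply/eqP; field.
  apply: le_trans h1 _.
  have aX : 0 <= a * X by rewrite mulr_ge0.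
  have -> : (a * X + Y) ^+ 4 = (a * X) ^+ 4 + 4 * (a * X) ^+ 3 * Y + 6 * (a * X) ^+ 2 * Y ^+ 2 +
     4 * (a * X) * Y ^+ 3 + Y ^+ 4 by ring.
  (* A single term of the expansion of [(a X + Y)^4] suffices, because [a <= 4]. *)
  have t1 : a ^+ 4 * X ^+ 3 * Y <= 4 * (a * X) ^+ 3 * Y.
    rewrite (_ : a ^+ 4 * X ^+ 3 * Y = a * ((a * X) ^+ 3 * Y)); last by ring.
    rewrite -mulrA; apply: ler_wpM2r; first by rewrite mulr_ge0 ?exprn_ge0.
    by lra.
  have t2 : 0 <= (a * X) ^+ 4 by rewrite exprn_ge0.
  have t3 : 0 <= 6 * (a * X) ^+ 2 * Y ^+ 2 by rewrite !mulr_ge0 ?exprn_ge0.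
  have t4 : 0 <= 4 * (a * X) * Y ^+ 3 by rewrite !mulr_ge0 ?exprn_ge0.
  have t5 : 0 <= Y ^+ 4 by rewrite exprn_ge0.
  lra.
have NX : 2 / 3 * N <= a * X + Y.
  rewrite -(@ler_pXn2r _ 4)// nnegrE; first by rewrite mulr_ge0.
  by rewrite addr_ge0// mulr_ge0.
have AU : (1 + A ^+ 2) * U <= (3 - a) * X.
  have h : (3 - a) * (8 / L ^+ 2) = 1 + A ^+ 2.
    have -> : A ^+ 2 = 8 * a / L ^+ 2 by rewrite aE; field.
    have -> : (3 - a) * (8 / L ^+ 2) = 24 / L ^+ 2 - 8 * a / L ^+ 2 by field.
    have -> : 24 = 16 * a + L ^+ 2 by lra.
    by field.
  rewrite -h -mulrA ler_wpM2l//; first by lra.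
  have p : 0 <= 8 / L ^+ 2 by rewrite divr_ge0// ltW.
  rewrite (_ : X = 8 / L ^+ 2 * (L ^+ 2 / 8 * X)); last by field.
  exact: ler_wpM2l.
lra.
Qed.

End spatial.

(** * The norms of the definitions as integrals of squares *)

Section norms.
Context {R : realType}.
Notation mu := (@lebesgue_measure R).
Implicit Types (L : R) (f : R * R -> R).

Lemma Lnorm2_sqr d (T : measurableType d) (nu : {measure set T -> \bar R}) (f : T -> R) :
  ('N[nu]_2%:E [EFin \o f] ^+ 2 = \int[nu]_x ((f x) ^+ 2)%:E)%E.
Proof.
rewrite unlock /= -expe2.
rewrite poweR12_sqrt ?integral_ge0// sqr_sqrte ?integral_ge0//.
by apply: eq_integral => x _ /=; rewrite powR_mulrn// real_normK// num_real.
Qed.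

Lemma L2norm_sqr L f :
  (L2norm L f ^+ 2 = \int[leb2 R]_p (((f \_ (strip L)) p) ^+ 2)%:E)%E.
Proof. exact: Lnorm2_sqr. Qed.

Lemma Hnorm_sqr L k (D : nat -> nat -> R * R -> R) :
  (Hnorm L k D ^+ 2 = \sum_(i < k.+1) \sum_(j < k.+1 | (i + j <= k)%N) L2norm L (D i j) ^+ 2)%E.
Proof.
rewrite /Hnorm poweR12_sqrt ?sqr_sqrte//;
  by apply: sume_ge0 => i _; apply: sume_ge0 => j _; rewrite expe_ge0// Lnorm_ge0.
Qed.

Lemma L2norm_le_Hnorm L k (D : nat -> nat -> R * R -> R) i j : (i + j <= k)%N ->
  (L2norm L (D i j) ^+ 2 <= Hnorm L k D ^+ 2)%E.
Proof.
move=> ijk; rewrite Hnorm_sqr.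
have ik : (i < k.+1)%N by rewrite ltnS (leq_trans _ ijk)// leq_addr.
have jk : (j < k.+1)%N by rewrite ltnS (leq_trans _ ijk)// leq_addl.
have sq0 a b : (0 <= L2norm L (D a b) ^+ 2)%E by rewrite expe_ge0// Lnorm_ge0.
rewrite (bigD1 (Ordinal ik))//= (bigD1 (Ordinal jk))//= -addeA leeDl//.
apply: adde_ge0; [|apply: sume_ge0 => a _]; apply: sume_ge0 => b _; exact: sq0.
Qed.

Lemma cvg0_lt (I : Type) (F : set_system I) {FF : Filter F} (u : I -> \bar R) (e : R) :
  0 < e -> (forall n, 0 <= u n)%E ->
  u @ F --> 0%E -> \forall n \near F, (u n ^+ 2 < e%:E)%E.
Proof.
move=> e0 u0 /fine_cvgP[ufin /cvgrPdist_lt].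
(* A number in [[0, 1]] that is less than [e] has its square less than [e]. *)
have s0 : 0 < Num.min 1 e by rewrite lt_min ltr01.
move=> /(_ _ s0) h; near=> n.
have fn : u n \is a fin_num by near: n.
have hn : `|0 - fine (u n)| < Num.min 1 e by near: n; exact: h.
rewrite -(fineK fn) -EFin_expe lte_fin.
move: hn; rewrite sub0r normrN ger0_norm ?fine_ge0// lt_min => /andP[h1 h2].
have f0 : 0 <= fine (u n) by rewrite fine_ge0.
apply: le_lt_trans h2; rewrite expr2; apply: ler_piMl => //; exact: ltW.
Unshelve. all: by end_near. Qed.

Lemma integrable_Rintegral_lt d (T : measurableType d) (nu : {measure set T -> \bar R})
    (f : T -> R) (e : R) : measurable_fun setT f -> (\int[nu]_x ((f x) ^+ 2)%:E < e%:E)%E ->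
  L2 nu setT f /\ \int[nu]_x f x ^+ 2 < e.
Proof.
move=> mf h; have fi : nu.-integrable setT (EFin \o (fun x => f x ^+ 2)).
  apply/ge0_integrableP.
  - exact: measurable_funX.
  - by move=> x _; exact: sqr_ge0.
  - by apply: lt_trans h _; rewrite ltry.
by split => //; rewrite -lte_fin EFin_Rintegral.
Qed.

(** Measurability refers to the product sigma-algebra, so an open set is written as the union of the
    countably many rational boxes it contains. *)
Lemma open_measurable2 (O : set (R * R)) : open O ->
  measurable (O : set (measurableTypeR R * measurableTypeR R)).
Proof.
move=> oO.
pose box (n : nat) : set (R * R) :=
  if unpickle n is Some (q1, r1, q2, r2) then
    if pselect (`]ratr q1, ratr r1[ `*` `]ratr q2, ratr r2[ `<=` O) is left _
    then `](ratr q1 : R), ratr r1[ `*` `]ratr q2, ratr r2[ else set0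
  else set0.
have -> : O = \bigcup_n box n.
  apply/seteqP; split => [[x y] Oxy|p [n _]]; last first.
    by rewrite /box; case: unpickle => // -[[[q1 r1] q2] r2]; case: pselect => // h; exact: h.
  have /nbhs_ballP[e /= e0 he] : nbhs (x, y) O by apply: open_nbhs_nbhs.
  have rq (a b : R) : a < b -> exists q : rat, a < ratr q < b.
    by move=> ab; have [q] := rat_in_itvoo ab; rewrite in_itv/=; exists q.
  have [q1 /andP[h1 h1']] := rq (x - e) x (ltac:(by rewrite ltrBlDr ltrDl)).
  have [r1 /andP[h2 h2']] := rq x (x + e) (ltac:(by rewrite ltrDl)).
  have [q2 /andP[h3 h3']] := rq (y - e) y (ltac:(by rewrite ltrBlDr ltrDl)).
  have [r2 /andP[h4 h4']] := rq y (y + e) (ltac:(by rewrite ltrDl)).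
  have [n nE] : exists n, unpickle n = Some (q1, r1, q2, r2) by exists (pickle (q1, r1, q2, r2)); exact: pickleK.
  exists n => //; rewrite /box nE.
  case: pselect => [_|]; first by split; rewrite /= in_itv/= ?h1' ?h2 ?h3' ?h4.
  case; move=> [s t] [/=]; rewrite !in_itv/= => /andP[a1 a2] /andP[a3 a4].
  apply: he; split; rewrite /ball/= ltr_norml; apply/andP; split; rewrite ?ltrBrDr ?ltrBlDr; lra.
apply: bigcupT_measurable => n; rewrite /box; case: unpickle => [[[[q1 r1] q2] r2]|//].
by case: pselect => // h; exact: measurableX.
Qed.

Lemma continuous_measurable2 (f : R * R -> R) : continuous f ->
  measurable_fun [set: measurableTypeR R * measurableTypeR R] f.
Proof.
move=> cf; apply: (measurability _ (RGenOInfty.measurableE R)) => //.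
move=> /= _ [_ [a ->] <-]; rewrite setTI; apply: open_measurable2.
by move/continuousP : cf; apply; exact: interval_open.
Qed.

End norms.

(** * Traces *)

Section trace.
Context {R : realType}.
Notation mu := (@lebesgue_measure R).
Implicit Types (L x y : R) (f : R * R -> R).

(** The boolean selects the end from which one integrates, [L] if true and [0] if false, so that one
    argument serves all the boundary conditions. *)
Definition trint L (b : bool) (h : R -> R) (x : R) : R :=
  if b then - \int[mu]_(s in `[x, L]) h s else \int[mu]_(s in `[0, x]) h s.

Definition endpt L (b : bool) : R := if b then L else 0.

Lemma trint_isint L b F h x : 0 <= x <= L -> isint 0 L F h ->
  F x = F (endpt L b) + trint L b h x.
Proof.
move=> xL Fh; have /andP[x0 xL'] := xL; rewrite /trint /endpt; case: b.
  by rewrite (isint_itv Fh x0 xL' (lexx L)); ring.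
by rewrite (Fh.2 x xL).
Qed.

Lemma trint_sqr L b h x : 0 <= x <= L -> L2 mu `[0, L] h ->
  trint L b h x ^+ 2 <= L * \int[mu]_(s in `[0, L]) h s ^+ 2.
Proof.
move=> /andP[x0 xL] lh; have L0 := le_trans x0 xL.
have I0 : 0 <= \int[mu]_(s in `[0, x]) h s ^+ 2 by exact: Rintegral_sqr_ge0.
have I1 : 0 <= \int[mu]_(s in `[x, L]) h s ^+ 2 by exact: Rintegral_sqr_ge0.
rewrite (@Rintegral_itv_cat _ 0 x L) ?x0//; last exact: lh.2.
rewrite /trint; case: b; rewrite ?sqrrN.
  apply: le_trans (itv_cauchy_schwarz xL (L2_sub_itv x0 (lexx L) lh)) _.
  by rewrite ler_pM// ?subr_ge0// ?lerDr// gerBl.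
apply: le_trans (itv_cauchy_schwarz x0 (L2_sub_itv (lexx 0) xL lh)) _.
by rewrite subr0 ler_pM// lerDl.
Qed.

Lemma trintD L b h k x : 0 <= x <= L -> mu.-integrable `[0, L] (EFin \o h) ->
  mu.-integrable `[0, L] (EFin \o k) ->
  trint L b (fun s => h s + k s) x = trint L b h x + trint L b k x.
Proof.
move=> /andP[x0 xL] hi ki; rewrite /trint; case: b; rewrite RintegralD//.
- by rewrite opprD.
- exact: integrable_sub_itv hi.
- exact: integrable_sub_itv ki.
- exact: integrable_sub_itv hi.
- exact: integrable_sub_itv ki.
Qed.

Lemma measurable_trint L b f : L2 (leb2 R) setT f ->
  measurable_fun [set: measurableTypeR R * measurableTypeR R]
    (fun p => trint L b (fun s => f (s, p.2)) p.1).
Proof.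
move=> [mf _].
pose c (b : bool) (z : R * (R * R)) : bool :=
  if b then (z.2.1 <= z.1) && (z.1 <= L) else (0 <= z.1) && (z.1 <= z.2.1).
pose H b (z : R * (R * R)) := f (z.1, z.2.2) * (c b z : nat)%:R.
have mc b' : measurable_fun
   [set: measurableTypeR R * (measurableTypeR R * measurableTypeR R)] (c b').
  have m1 : measurable_fun [set: measurableTypeR R * (measurableTypeR R * measurableTypeR R)]
     (fun z => z.1 : R) by exact: measurable_fst.
  have m2 : measurable_fun [set: measurableTypeR R * (measurableTypeR R * measurableTypeR R)]
     (fun z => z.2.1 : R) by exact: measurableT_comp measurable_fst measurable_snd.
  by case: b'; apply: measurable_and; apply: measurable_fun_ler => //; exact: measurable_cst.
have mH b' : measurable_fun
   [set: measurableTypeR R * (measurableTypeR R * measurableTypeR R)] (H b').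
  apply: measurable_funM.
    apply: measurableT_comp mf _; apply/measurable_fun_pairP; split.
    - exact: measurable_fst.
    - exact: measurableT_comp measurable_snd measurable_snd.
  by apply: (@measurableT_comp _ _ _ _ _ _ (fun b : bool => (b : nat)%:R : R)).
have E b' p : (if b' then \int[mu]_(s in `[p.1, L]) f (s, p.2)
     else \int[mu]_(s in `[0, p.1]) f (s, p.2)) = \int[mu]_s H b' (s, p).
  case: b'; rewrite Rintegral_mkcond; apply: eq_Rintegral => s _;
    rewrite restrict_itvE /H /c /=; case: ifPn => _; by rewrite ?mulr1 ?mulr0.
have := measurable_Rintegral2 mu (mH b).
case: b => mi; rewrite /trint.
- apply: eq_measurable_fun (measurable_funN mi) => p _.
  by have := E true p => /= ->.
- by apply: eq_measurable_fun mi => p _; have := E false p => /= ->.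
Qed.

(* For the gap between the two sides, the smooth approximations phi_n bound its
   L^2 norm by the trace and H^1 errors of phi_n, so it vanishes. *)
Lemma has_trace0_repr L b f fx : 0 < L -> has_trace L (endpt L b) f (cst 0) ->
  L2fun L f -> L2fun L fx -> weak_tens L 1 0 (f \_ (strip L)) (fx \_ (strip L)) ->
  {ae mu, forall y, {ae mu, forall x, 0 <= x <= L ->
    (f \_ (strip L)) (x, y) = trint L b (fun s => (fx \_ (strip L)) (s, y)) x}}.
Proof.
move=> L0 [D [phi [HD tphi cD cg]]] lf lfx wfx.
pose f0 := f \_ (strip L); pose f1 := fx \_ (strip L).
have lf0 : L2 (leb2 R) setT f0 := L2fun_L2 lf.
have lf1 : L2 (leb2 R) setT f1 := L2fun_L2 lfx.
(* The derivatives [D] that come with the trace have to be identified with [f] and [fx]. *)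
have [_ lD00 _] := HD 0%N 0%N isT; have [_ lD10 _] := HD 1%N 0%N isT.
have eD10 : {ae leb2 R, forall p, f1 p = (D 1%N 0%N \_ (strip L)) p}.
  apply: (weak_tens_unique L0 lf1 (L2fun_L2 lD10) (@restrict_on_strip _ _ _)
     (@restrict_on_strip _ _ _) wfx (weakD_tens (HD 1%N 0%N isT))).
have w00 : weak_tens L 0 0 f0 f0 by move=> m al be _ _ _; rewrite expr0 mul1r.
have eD00 : {ae leb2 R, forall p, f0 p = (D 0%N 0%N \_ (strip L)) p}.
  apply: (weak_tens_unique L0 lf0 (L2fun_L2 lD00) (@restrict_on_strip _ _ _)
     (@restrict_on_strip _ _ _) w00 (weakD_tens (HD 0%N 0%N isT))).
pose ind (x : R) : R := \1_(`[0, L] : set R) x.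
pose gap (p : R * R) := (f0 p - trint L b (fun s => f1 (s, p.2)) p.1) * ind p.1.
have mind : measurable_fun setT ind by exact: measurable_indic.
have mgap : measurable_fun [set: measurableTypeR R * measurableTypeR R] gap.
  apply: measurable_funM; last exact: measurable_fst2.
  by apply: measurable_funB; [exact: lf0.1|exact: measurable_trint].
have gap_small (e : R) : 0 < e -> (leb2 R).-integrable setT (EFin \o (fun p => gap p ^+ 2)) /\
    \int[leb2 R]_p gap p ^+ 2 <= 3 * (e + L * e + L * (L * e)).
  move=> e0.
  have H0 n : (0 <= Hnorm L 1 (fun i j p => (pderiv i j (phi n) p - D i j p)%R))%E.
    exact: poweR_ge0.
  have N0 n : (0 <= 'N[mu]_2%:E [(fun y => (phi n (endpt L b, y) - cst 0 y)%:E)])%E.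
    exact: Lnorm_ge0.
  have [n /= [hn hn']] : exists n,
      (Hnorm L 1 (fun i j p => (pderiv i j (phi n) p - D i j p)%R) ^+ 2 < e%:E)%E /\
      ('N[mu]_2%:E [(fun y => (phi n (endpt L b, y) - cst 0 y)%:E)] ^+ 2 < e%:E)%E.
    have h1 := cvg0_lt (FF := @filter_filter _ _ eventually_filter) e0 H0 cD; have h2 := cvg0_lt (FF := @filter_filter _ _ eventually_filter) e0 N0 cg.
    by have [n [? ?]] := filter_ex (filterI h1 h2); exists n.
  have [sphi _] := tphi n.
  have cphi w : continuous (Defs.iterD w (phi n)) by case: (sphi w).
  have cx : continuous (pderiv 1 0 (phi n)) by exact: cphi.
  have c0 : continuous (phi n) by exact: (cphi [::]).
  pose d := (fun p => pderiv 0 0 (phi n) p - D 0%N 0%N p) \_ (strip L).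
  pose e1 := (fun p => pderiv 1 0 (phi n) p - D 1%N 0%N p) \_ (strip L).
  pose r (y : R) := phi n (endpt L b, y).
  have md : measurable_fun setT d.
    apply/(measurable_restrictT _ (measurable_strip L)); apply: measurable_funB.
      apply: measurable_funTS; exact: (continuous_measurable2 c0).
    by case: lD00.
  have me1 : measurable_fun setT e1.
    apply/(measurable_restrictT _ (measurable_strip L)); apply: measurable_funB.
      apply: measurable_funTS; exact: (continuous_measurable2 cx).
    by case: lD10.
  have mr : measurable_fun setT r.
    exact: (measurable_fun_pair2 (T1 := measurableTypeR R) (endpt L b) (continuous_measurable2 c0)).
  have [ld dle] : L2 (leb2 R) setT d /\ \int[leb2 R]_p d p ^+ 2 < e.
    apply: integrable_Rintegral_lt => //; rewrite -L2norm_sqr.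
    by apply: le_lt_trans hn; exact: (@L2norm_le_Hnorm _ _ _ _ 0%N 0%N).
  have [le1 e1le] : L2 (leb2 R) setT e1 /\ \int[leb2 R]_p e1 p ^+ 2 < e.
    apply: integrable_Rintegral_lt => //; rewrite -L2norm_sqr.
    by apply: le_lt_trans hn; exact: (@L2norm_le_Hnorm _ _ _ _ 1%N 0%N).
  have [lr rle] : L2 mu setT r /\ \int[mu]_y r y ^+ 2 < e.
    apply: integrable_Rintegral_lt => //; rewrite -Lnorm2_sqr.
    rewrite (_ : EFin \o r = (fun y => (phi n (endpt L b, y) - cst 0 y)%:E))//.
    by apply/funext => y; rewrite /= subr0.
  pose Q (y : R) := \int[mu]_x e1 (x, y) ^+ 2.
  have Qi : mu.-integrable setT (EFin \o Q) by exact: (integrable_Rslice2 le1.2).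
  have li : L2 mu setT (fun x : R => 1 * ind x).
    apply: (@L2_bounded_support _ _ _ mu `[0, L] (fun=> 1) 1 (measurable_itv _) (lebesgue_itv_fin _ _)) => //.
    by move=> x; rewrite normr1.
  have ind2 x : (1 * ind x) ^+ 2 = ind x.
    by rewrite mul1r /ind indicE; case: (x \in _); rewrite ?expr1n// expr0n.
  have indi : mu.-integrable setT (EFin \o ind).
    by apply: eq_integrable li.2 => // x _ /=; rewrite ind2.
  have indI : \int[mu]_x ind x = L.
    rewrite (@Rintegral_supp _ L).
      rewrite -[RHS]subr0 -(isint_total (ltW L0) (isint_id 0 L)); apply: eq_Rintegral => x.
      by rewrite /ind indicE => ->.
    by move=> x xL; rewrite /ind indicE mem_setE in_itv/= (negbTE xL).
  have T1 := integrable_tensor indi lr.2.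
  have T2 := integrable_tensor indi Qi.
  have tensI (h : R -> R) : mu.-integrable setT (EFin \o h) ->
      \int[leb2 R]_p (ind p.1 * h p.2) = L * \int[mu]_y h y.
    move=> hi; rewrite (fubini_leb2 (integrable_tensor indi hi)) /= -RintegralZl//.
    by apply: eq_Rintegral => y _; rewrite RintegralZr// indI.
  have T1' := integrable_funD measurableT ld.2 T1.
  have T12 := integrable_funD measurableT T1' (integrable_funZ L measurableT T2).
  have B := integrable_funZ 3 measurableT T12.
  (* On a slice the gap is [r + t1 - d]: the trace error of [phi n], the primitive of the error on
     the derivative and the error on the function. The factor 3 is that of the square of a sum of
     three terms. *)
  have gapB : {ae leb2 R, forall p, gap p ^+ 2 <= 3 * (d p ^+ 2 + ind p.1 * r p.2 ^+ 2 + L * (ind p.1 * Q p.2))}.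
    apply: (@prod_ae2 _ _ _ _ _ mu mu [set p | gap p ^+ 2 <=
        3 * (d p ^+ 2 + ind p.1 * r p.2 ^+ 2 + L * (ind p.1 * Q p.2))]).
      apply: measurable_le_set; first exact: measurable_funX.
      exact: integrable_measurable B.
    have a1 := ae_prod2 (m1 := mu) (m2 := mu) eD00; have a2 := ae_prod2 (m1 := mu) (m2 := mu) eD10.
    have a3 := L2_slice2 lf1; have a4 := L2_slice2 le1.
    near=> y.
    have h1 : {ae mu, forall x, f0 (x, y) = (D 0%N 0%N \_ (strip L)) (x, y)} by near: y; exact: a1.
    have h2 : {ae mu, forall x, f1 (x, y) = (D 1%N 0%N \_ (strip L)) (x, y)} by near: y; exact: a2.
    have h3 : L2 mu setT (fun x => f1 (x, y)) by near: y; exact: a3.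
    have h4 : L2 mu setT (fun x => e1 (x, y)) by near: y; exact: a4.
    have itvL (h : R -> R) : L2 mu setT h -> L2 mu `[0, L] h.
      by move=> [mh hi]; split; [exact: measurable_funTS|apply: integrableS hi].
    have itvI (h : R -> R) : L2 mu setT h -> mu.-integrable `[0, L] (EFin \o h).
      exact: (@L2_integrable _ _ _ mu _ _ (measurable_itv _) (lebesgue_itv_fin _ _)).
    have hs : {ae mu, forall x, x != 0 /\ x != L}.
      have n1 : mu.-negligible [set (0 : R)] by exists [set 0]; split => //; exact: lebesgue_measure_set1.
      have n2 : mu.-negligible [set L] by exists [set L]; split => //; exact: lebesgue_measure_set1.
      apply: negligibleS (negligibleU n1 n2) => x /= /not_andP[/negP/negPn/eqP ->|/negP/negPn/eqP ->]; by [left|right].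
    have Fi : isint 0 L (fun x => phi n (x, y)) (fun x => f1 (x, y) + e1 (x, y)).
      have Fi0 : isint 0 L (fun x => phi n (x, y)) (fun x => pderiv 1 0 (phi n) (x, y)).
        apply: isint_deriv; first exact: ltW.
          move=> x; have cxy : {for x, continuous (fun s : R => (s, y))}.
            exact: (@cvg_pair R R R (nbhs x) (nbhs x) (nbhs y) _ _ _ (fun s : R => s) (fun=> y) cvg_id (cvg_cst _)).
          exact: (@continuous_comp _ _ _ (fun s : R => (s, y)) (pderiv 1 0 (phi n)) x cxy (cx _)).
        move=> x; have dphi : derivable (phi n) (x, y) (1, 0) by case: (sphi [::]).
        have [A1 A2] := @derive_affine _ _ _ (fun x : R => (x, y) : R * R)
          (fun v => (v, 0)) (phi n) x 1 (fun h u q =>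
             congr2 pair erefl (esym (etrans (congr1 (fun z => z + y) (mulr0 h)) (add0r y)))).
        by apply: DeriveDef; [exact: A1|exact: A2].
      apply: (isint_ae Fi0).
        by apply: measurable_funTS; apply: measurable_funD; [exact: h3.1|exact: h4.1].
      apply: filterS2 h2 hs => x hx [x0 xL'] /andP[x0' xL].
      have xs : 0 < x < L by rewrite !lt_neqAle eq_sym x0 x0' xL' xL.
      rewrite hx /e1 !restrictE0 mem_set//=; ring.
    apply: filterS2 h1 hs => x hx [x0 xL'] /=.
    have [xL|xL] := boolP (0 <= x <= L); last first.
      have -> : gap (x, y) = 0 by rewrite /gap /ind indicE mem_setE in_itv/= (negbTE xL) mulr0.
      have -> : ind x = 0 by rewrite /ind indicE mem_setE in_itv/= (negbTE xL).
      by rewrite expr0n/= !mul0r mulr0 !addr0 mulr_ge0// sqr_ge0.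
    have i1 : ind x = 1 by rewrite /ind indicE mem_setE in_itv/= xL.
    have := trint_isint b xL Fi; rewrite trintD//; [|exact: itvI|exact: itvI].
    rewrite -/(r y) => phiE.
    have tb := trint_sqr b xL (itvL _ h4).
    have QE : Q y = \int[mu]_(s in `[0, L]) e1 (s, y) ^+ 2.
      rewrite /Q (@Rintegral_supp _ L)// => z zL.
      have -> : e1 (z, y) = 0 by exact: (on_strip_out y (@restrict_on_strip _ _ _) zL).
      by rewrite expr0n.
    rewrite /gap /= i1 mulr1 !mul1r QE.
    have xs : 0 < x < L by move: xL => /andP[? ?]; rewrite !lt_neqAle eq_sym x0 xL'; apply/andP; split.
    have -> : f0 (x, y) = phi n (x, y) - d (x, y).
      by rewrite hx /d !restrictE0 mem_set//= /pderiv/=; ring.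
    rewrite phiE; move: tb; set t1 := trint L b (fun s => e1 (s, y)) x.
    set t2 := trint L b (fun s => f1 (s, y)) x; set q := L * _; move: (d (x, y)) (r y) => dd rr tq.
    have := sqr_ge0 (dd + rr); have := sqr_ge0 (dd + t1); have := sqr_ge0 (rr - t1).
    move=> s1 s2 s3; rewrite [leLHS](_ : _ = 3 * (dd ^+ 2 + rr ^+ 2 + t1 ^+ 2) -
      (dd + rr) ^+ 2 - (dd + t1) ^+ 2 - (rr - t1) ^+ 2); first by lra.
    by ring.
  have gi : (leb2 R).-integrable setT (EFin \o (fun p => gap p ^+ 2)).
    apply: (ae_le_integrable _ B); first exact: measurable_funX.
    by apply: filterS gapB => p; rewrite ger0_norm// sqr_ge0.
  split => //; apply: (@le_trans _ _ (\int[leb2 R]_p (3 * (d p ^+ 2 + ind p.1 * r p.2 ^+ 2 + L * (ind p.1 * Q p.2))))).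
    by apply: ae_le_Rintegral => //; apply: filterS gapB => p.
  rewrite (RintegralZl _ measurableT T12) (RintegralD measurableT T1' (integrable_funZ L measurableT T2)).
  rewrite (RintegralD measurableT ld.2 T1) (RintegralZl _ measurableT T2) (tensI _ lr.2) (tensI _ Qi).
  have -> : \int[mu]_y Q y = \int[leb2 R]_p e1 p ^+ 2 by rewrite (fubini_leb2 le1.2).
  by rewrite ler_wpM2l// !lerD// ?ler_wpM2l ?(ltW L0)// ltW.
have [gi _] := gap_small 1 ltr01.
have g0 : \int[leb2 R]_p gap p ^+ 2 = 0.
  apply/eqP; rewrite eq_le Rintegral_sqr_ge0 andbT.
  apply/ler_addgt0Pl => e e0; rewrite addr0.
  have c0 : 0 < 3 * (1 + L + L * L) by rewrite mulr_gt0// !addr_gt0// mulr_gt0.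
  have [_] := gap_small (e / (3 * (1 + L + L * L))) (divr_gt0 e0 c0).
  move=> /le_trans; apply; rewrite le_eqVlt; apply/orP; left; apply/eqP; field.
  by rewrite gt_eqF// !addr_gt0// mulr_gt0.
have := Rintegral_ge0_eq0 measurableT gi (fun p _ => sqr_ge0 (gap p)) g0.
move=> h; have := ae_prod2 (m1 := mu) (m2 := mu) h.
apply: filterS => y; apply: filterS => x /(_ I) /eqP; rewrite sqrf_eq0 /gap/=.
move=> + xL; rewrite /ind indicE mem_setE in_itv/= xL mulr1 subr_eq0 => /eqP.
exact.
Unshelve. all: by end_near. Qed.

End trace.

(** * Differential inequality for the energy *)

Section decay.
Context {R : realType}.
Notation mu := (@lebesgue_measure R).

(** A point of disagreement would have a whole neighbourhood of such points, and a null set contains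
    no interval. *)
Lemma ae_continuous_eq (a b : R) (f g : R -> R) :
  {in `]a, b[, continuous f} -> {in `]a, b[, continuous g} ->
  {ae mu, forall x, a <= x <= b -> f x = g x} ->
  forall x, a < x < b -> f x = g x.
Proof.
move=> cf cg fg x xab; apply: contrapT => /eqP nfg.
have xi : x \in `]a, b[ by rewrite in_itv.
have ch : (fun y => f y - g y) @ x --> f x - g x by apply: cvgB; [exact: cf|exact: cg].
have h0 : 0 < `|f x - g x| by rewrite normr_gt0 subr_eq0.
move/cvgrPdist_lt : ch => /(_ _ h0) /nbhs_ballP[d /= d0 hd].
have /andP[xa xb] := xab.
have xlt : x < Num.min b (x + d / 2).
  by rewrite lt_min xb/= ltrDl divr_gt0.
have [y /andP[xy yb] yfg] : exists2 y : R, x <= y <= Num.min b (x + d / 2) & a <= y <= b -> f y = g y.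
  by apply: ae_itv_ex => //; apply: filterS fg => z + _.
move: yb; rewrite le_min => /andP[yb yd].
have := hd y; rewrite /ball/= yfg ?subrr ?subr0 ?ltxx; last by rewrite yb (le_trans (ltW xa)).
by move=> /(_ _)/wrap[] //; rewrite ler0_norm ?subr_le0// opprB; lra.
Qed.

Lemma isint_expR (a b k : R) : a <= b ->
  isint a b (fun x => expR (k * x)) (fun x => k * expR (k * x)).
Proof.
move=> ab; apply: isint_deriv => //.
  move=> x; apply: cvgM; first exact: cvg_cst.
  by apply: continuous_comp; [exact: mulrl_continuous|exact: continuous_expR].
move=> x; apply: is_derive_eq.
by rewrite -[_ *: 1]/(_ * 1) -[LHS]/(_ * _); ring.
Qed.

Section energy.
Variables (E e : R -> R) (E0 k thr : R).
Hypothesis k0 : 0 <= k.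
Hypothesis E_ge0 : forall t : R, 0 < t -> 0 <= E t.
Hypothesis cE : forall t : R, 0 < t -> E s @[s --> t] --> E t.
Hypothesis cE0 : E s @[s --> 0^'+] --> E0.
Hypothesis E0_lt : E0 < thr.
Hypothesis Ee : forall T : R, 0 < T -> mu.-integrable `[0, T] (EFin \o e) /\
  exists c, {ae mu, forall x, 0 <= x <= T -> E x = c + \int[mu]_(s in `[0, x]) e s}.
Hypothesis e_le : {ae mu, forall s, 0 < s -> E s < thr -> e s <= - (k * E s)}.

(** [Ee] gives the representation almost everywhere; both sides being continuous, it holds at every
    point. The interval is prolonged to [t + 1] so that [t] is interior. *)
Lemma energy_isint (s t : R) : 0 < s -> s <= t -> isint s t E e.
Proof.
move=> s0 st; have T0 : 0 < t + 1 by rewrite addr_gt0// (lt_le_trans s0).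
have [ei [c Ec]] := Ee T0; have Fi := isint_prim_cst c ei.
apply: (@isint_sub _ s t s t) => //.
apply: isint_eq (isint_sub (ltW s0) st _ Fi) _ _ => //; first by rewrite lerDl.
move=> x /andP[sx xt]; apply/esym; apply: (ae_continuous_eq _ _ Ec); last first.
- by rewrite (lt_le_trans s0)//= (le_lt_trans xt)// ltrDl.
- have := isint_continuous (ltW T0) Fi; move/(continuous_within_itvP _ T0) => [h _ _].
  exact: h.
- by move=> y; rewrite in_itv/= => /andP[y0 _]; exact: cE.
Qed.

(** The derivative of [expR (k x) E(x)] is [expR (k x) (k E + e) <= 0]. The bound on [E] is asked on
    [[s, t[] only, so [t] may be the first time at which the threshold is reached. *)
Lemma energy_weighted (s t : R) : 0 < s -> s <= t -> (forall x, s <= x < t -> E x < thr) ->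
  expR (k * t) * E t <= expR (k * s) * E s.
Proof.
move=> s0 st lthr; have Ei := isintM st (isint_expR k st) (energy_isint s0 st).
have := isint_total st Ei; move/eqP; rewrite eq_sym subr_eq => /eqP ->.
rewrite gerDr.
have nt : {ae mu, forall x : R, x != t}.
  exists [set t]; split => //; first exact: lebesgue_measure_set1.
  by move=> x /= /negP/negPn/eqP.
apply: (@le_trans _ _ (\int[mu]_(x in `[s, t]) 0)); last by rewrite /Rintegral integral0.
apply: ae_le_Rintegral => //; [exact: Ei.1|exact: integrable0|].
apply: filterS2 e_le nt => x h xt; rewrite /= in_itv/= => /andP[sx xt'].
have x0 := lt_le_trans s0 sx.
have Ex : E x < thr by apply: lthr; rewrite sx lt_neqAle xt.
have := h x0 Ex => ex.
rewrite (_ : _ + _ = expR (k * x) * (k * E x + e x)); last by ring.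
by rewrite mulr_ge0_le0 ?expR_ge0//; lra.
Qed.

(** At the first time [m] after [d / 2] with [thr <= E m], the monotonicity of the weighted energy
    gives [E m <= E (d / 2) < thr], a contradiction. One starts from [d / 2], where [E] is still
    below the threshold, because the value of [E] at 0 is not constrained. *)
Lemma energy_lt_thr (t : R) : 0 < t -> E t < thr.
Proof.
move=> t0; rewrite ltNge; apply/negP => Et.
have [d d0 hd] : exists2 d : R, 0 < d & forall x, 0 < x < d -> E x < thr.
  have h : nbhs (0 : R) (fun x => 0 < x -> E x < thr) by exact: (cvgr_lt _ cE0 _ E0_lt).
  have [d /= d0 hd] := (nbhs_ballP _ _).1 h.
  exists d => // x /andP[x0 xd]; apply: hd => //.
  by rewrite /ball/= sub0r normrN gtr0_norm.
pose S := [set x | d / 2 <= x /\ thr <= E x].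
have dt : d / 2 <= t.
  rewrite leNgt; apply/negP => td; have td' : t < d by lra.
  by have := hd t; rewrite t0 td' => /(_ isT); rewrite ltNge Et.
have d20 : 0 < d / 2 by rewrite divr_gt0.
have hS : has_inf S by split; [exists t|exists (d / 2) => x []].
pose m := inf S.
have dm : d / 2 <= m by apply: lb_le_inf; [exact: hS.1|move=> x []].
have m0 : 0 < m := lt_le_trans d20 dm.
have Em : thr <= E m.
  rewrite leNgt; apply/negP => Em.
  have h : nbhs m (fun x => E x < thr) by exact: (cvgr_lt _ (cE m0) _ Em).
  have [r /= r0 hr] := (nbhs_ballP _ _).1 h.
  have [x Sx xm] := inf_adherent r0 hS.
  have mx : m <= x by apply: ge_inf; [exact: hS.2|].
  have : E x < thr.
    by apply: hr; rewrite /ball/= distrC ger0_norm ?subr_ge0// ltrBlDl.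
  by case: Sx => _; rewrite leNgt => /negP.
have lt x : d / 2 <= x < m -> E x < thr.
  move=> /andP[dx xm]; rewrite ltNge; apply/negP => Ex.
  by move: xm; rewrite ltNge => /negP; apply; apply: ge_inf; [exact: hS.2|].
have := energy_weighted d20 dm lt.
rewrite leNgt => /negP; apply.
have E1 : E (d / 2) < thr by apply: hd; rewrite d20 ltr_pdivrMr// ltr_pMr// ltrDl ltr01.
apply: (@le_lt_trans _ _ (expR (k * m) * E (d / 2))).
  by rewrite ler_wpM2r ?E_ge0// ler_expR ler_wpM2l.
by rewrite ltr_pM2l ?expR_gt0// (lt_le_trans E1).
Qed.

(** The weighted energy is non-increasing on [[s, t]] for every [s > 0]; then [s] tends to 0, where
    [E] has the limit [E0]. *)
Lemma energy_decay (t : R) : 0 < t -> E t <= expR (- k * t) * E0.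
Proof.
move=> t0; rewrite mulNr expRN mulrC ler_pdivlMr ?expR_gt0// mulrC.
have ce : expR (k * s) * E s @[s --> 0^'+] --> 1 * E0.
  apply: cvgM => //; rewrite -expR0 -[X in expR X](mulr0 k).
  apply: cvg_at_right_filter.
  by apply: continuous_comp; [exact: mulrl_continuous|exact: continuous_expR].
rewrite -[leRHS]mul1r; apply: (cvgr_to_ge ce); near=> s.
have s0 : 0 < s by near: s; exact: nbhs_right_gt.
have st : s <= t by near: s; exact: nbhs_right_le.
by apply: energy_weighted => // x /andP[sx _]; apply: energy_lt_thr; apply: lt_le_trans sx.
Unshelve. all: by end_near. Qed.

End energy.
End decay.

(** * Evolution of the energy *)

Section bochner.
Context {R : realType}.
Notation mu := (@lebesgue_measure R).
Implicit Types (L T : R).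

Lemma weakD00 L (f g : R * R -> R) : 0 < L -> weakD L 0 0 f g ->
  {ae leb2 R, forall p, (f \_ (strip L)) p = (g \_ (strip L)) p}.
Proof.
move=> L0 fg; have [lf lg _] := fg.
apply: (@weak_tens_unique _ L 0 0 (f \_ (strip L)) (f \_ (strip L)) (g \_ (strip L)) L0
   (L2fun_L2 lf) (L2fun_L2 lg) (@restrict_on_strip _ _ _) (@restrict_on_strip _ _ _) _ (weakD_tens fg)).
by move=> m al be _ _ _; rewrite expr0 mul1r.
Qed.

Lemma Lnorm_oo_bound (T : R) (g : R -> \bar R) : (forall t, 0 <= g t)%E ->
  ('N[mu]_+oo [g \_ (`]0%R, T[ : set R)] < +oo)%E ->
  exists2 M : R, 0 <= M & {ae mu, forall t, 0 < t < T -> (g t <= M%:E)%E}.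
Proof.
move=> g0; rewrite unlock.
(* The norm of exponent [+oo] is an essential supremum once the whole space is known to have
   positive measure. *)
have -> : (0 < mu setT)%E.
  apply: (@lt_le_trans _ _ (mu `[0, 1])).
    by rewrite lebesgue_measure_itv/= lte_fin ltr01 -EFinB lte_fin subr0.
  by apply: le_measure; rewrite ?inE.
set S := ess_sup _ _ => Soo.
exists (Num.max 0 (fine S)); first by rewrite le_max lexx.
have := ess_sup_ge mu (abse \o (g \_ (`]0%R, T[ : set R))); rewrite -/S.
apply: filterS => t + t0T; rewrite /= patchE mem_set ?in_itv//= gee0_abs// => gS.
apply: (le_trans gS); have := le_trans (g0 t) gS.
by move: Soo; case: S {gS} => // r _ r0; rewrite lee_fin le_max lexx orbT.
Qed.

Lemma Linf_bound L k T (f : R -> R * R -> R) : 0 < L -> LpH L +oo%E k T f ->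
  exists2 M : R, 0 <= M & {ae mu, forall t, 0 < t < T ->
    L2fun L (f t) /\ \int[leb2 R]_p (f t \_ (strip L)) p ^+ 2 <= M}.
Proof.
move=> L0 [D [_ HD hN]].
have H0 t : (0 <= Hnorm L k (D t))%E by exact: poweR_ge0.
have [M M0 hM] := Lnorm_oo_bound H0 hN.
exists (M ^+ 2); first exact: sqr_ge0.
apply: filterS2 HD hM => t HD hM tT; have h00 := HD tT 0%N 0%N (leq0n k).
have [lf lD _] := h00; split => //.
have l1 := L2fun_L2 lf; have l2 := L2fun_L2 lD.
rewrite (@ae_eq_Rintegral _ _ _ (leb2 R) setT _ (fun p => (D t 0%N 0%N \_ (strip L)) p ^+ 2)) //; last first.
- by apply: filterS (weakD00 L0 h00) => p ->.
- by apply: measurable_funX; exact: l2.1.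
- by apply: measurable_funX; exact: l1.1.
rewrite -lee_fin (EFin_Rintegral measurableT l2.2) -L2norm_sqr.
apply: (le_trans (@L2norm_le_Hnorm _ _ k _ 0%N 0%N isT)).
have := hM tT; have := H0 t; case: (Hnorm L k (D t)) => // r.
by rewrite !lee_fin => r0 rM; rewrite -expr2 lerXn2r.
Qed.

End bochner.

Section joint.
Context d (S : measurableType d) (R : realType).
Notation mu := (@lebesgue_measure R).
Variable nu : {sigma_finite_measure set S -> \bar R}.

(** By Tonelli, a uniform bound on the slices over a bounded time interval bounds the integral over
    space-time. *)
Lemma joint_L2 (F : R * S -> R) (T M : R) : 0 <= M -> measurable_fun setT F ->
  {ae mu, forall t, ~~ (0 < t < T) -> forall y, F (t, y) = 0} ->
  {ae mu, forall t, 0 < t < T -> L2 nu setT (fun y => F (t, y)) /\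
    \int[nu]_y F (t, y) ^+ 2 <= M} ->
  L2 (mu \x nu)%E setT F.
Proof.
move=> M0 mF F0 FM; split => //.
have mF2 : measurable_fun setT (EFin \o (fun z => F z ^+ 2)).
  by apply/measurable_EFinP; exact: measurable_funX.
have F2_ge0 (z : R * S) : (0 <= (EFin \o (fun z => (F z ^+ 2)%R)) z)%E by rewrite lee_fin sqr_ge0.
apply/ge0_integrableP; [exact: measurable_funX|by move=> x _; exact: sqr_ge0|].
have Tn := fubini_tonelli1 (m1 := mu) (m2 := nu) _ mF2 F2_ge0.
apply: (@le_lt_trans _ _ (\int[mu]_t (M * \1_(`[0, T] : set R) t)%:E)%E).
  apply: (le_trans (y := (\int[mu]_t fubini_F nu (EFin \o (fun z => (F z ^+ 2)%R)) t)%E)).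
    by rewrite -Tn.
  apply: ae_ge0_le_integral => //.
  - by move=> t _; apply: integral_ge0.
  - exact: measurable_fun_fubini_tonelli_F.
  - by move=> t _; rewrite lee_fin mulr_ge0// indicE.
  - apply/measurable_EFinP; apply: measurable_funM => //; exact: measurable_indic.
  apply: filterS2 F0 FM => t h1 h2 _; rewrite /fubini_F /=.
  have [t0T|t0T] := boolP (0 < t < T); last first.
    rewrite (eq_integral (cst 0%E)) ?integral0 ?lee_fin ?mulr_ge0 ?indicE//.
    by move=> y _; rewrite h1// expr0n.
  have [l2 le] := h2 t0T; rewrite -(EFin_Rintegral measurableT l2.2) lee_fin.
  move/andP : t0T => [t0 tT].
  by rewrite indicE mem_setE in_itv/= (ltW t0) (ltW tT) mulr1.
have : mu.-integrable setT (EFin \o (fun t => M * \1_(`[0, T] : set R) t)).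
  apply: integrable_funZ => //; apply/ge0_integrableP.
  - exact: measurable_indic.
  - by move=> t _; rewrite indicE.
  by rewrite integral_indic// setIT; exact: lebesgue_itv_fin.
move/ge0_integrableP; apply.
- apply: measurable_funM => //; exact: measurable_indic.
- by move=> t _; rewrite mulr_ge0// indicE.
Qed.

(* The identity holds on slices; it is transferred to the integrals over S by
   testing against functions of t, so that the constant c(p) is never integrated. *)
Lemma energy_identity (F Ft : R * S -> R) (w : S -> R) (T M : R) : 0 < T ->
  L2 (mu \x nu)%E setT F -> L2 (mu \x nu)%E setT Ft ->
  measurable_fun setT w -> (forall p, `|w p| <= M) ->
  {ae nu, forall p, exists c, {ae mu, forall t, 0 <= t <= T ->
     F (t, p) = c + \int[mu]_(s in `[0, t]) Ft (s, p)}} ->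
  mu.-integrable `[0, T] (EFin \o (fun s => \int[nu]_p (2 * (w p * (F (s, p) * Ft (s, p)))))) /\
  exists c, {ae mu, forall t, 0 <= t <= T ->
    \int[nu]_p (w p * F (t, p) ^+ 2) =
    c + \int[mu]_(s in `[0, t]) \int[nu]_p (2 * (w p * (F (s, p) * Ft (s, p))))}.
Proof.
move=> T0 lF lFt mw wM rep.
have mw2 : measurable_fun [set: measurableTypeR R * S] (fun z => w z.2) by exact: measurableT_comp mw measurable_snd.
pose G1 z := F z ^+ 2 * w z.2.
pose G2 z := 2 * (F z * Ft z * w z.2).
have iG1 : (mu \x nu)%E.-integrable setT (EFin \o G1).
  exact: (@integrable_funM _ _ _ (mu \x nu)%E setT (fun z => F z ^+ 2) (fun z => w z.2) M measurableT lF.2 mw2).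
have iG2 : (mu \x nu)%E.-integrable setT (EFin \o G2).
  apply: (@integrable_funZ _ _ _ (mu \x nu)%E) => //.
  exact: (@integrable_funM _ _ _ (mu \x nu)%E setT (fun z => F z * Ft z) (fun z => w z.2) M measurableT (L2_prod measurableT lF lFt) mw2).
have E1 : (fun s => \int[nu]_p (2 * (w p * (F (s, p) * Ft (s, p))))) = (fun s => \int[nu]_p G2 (s, p)).
  by apply/funext => s; apply: eq_Rintegral => p _; rewrite /G2/= [w p * _]mulrC.
have E2 t : \int[nu]_p (w p * F (t, p) ^+ 2) = \int[nu]_p G1 (t, p).
  by apply: eq_Rintegral => p _; rewrite /G1/= mulrC.
rewrite E1.
have i1 : mu.-integrable `[0, T] (EFin \o (fun s => \int[nu]_p G1 (s, p))).
  by apply: integrableS (integrable_Rslice1 iG1).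
have i2 : mu.-integrable `[0, T] (EFin \o (fun s => \int[nu]_p G2 (s, p))).
  by apply: integrableS (integrable_Rslice1 iG2).
split => //.
have [i|c hc] := @du_bois_reymond _ 0 T _ _ T0 i1 i2; last first.
  by exists c; apply: filterS hc => t; rewrite E2.
set th := test_family 0 T i; have tth : test1 0 T th := test_familyP 0 T i.
have tth' := test1_derive tth.
have [M1 M10 hM1] := test1_bounded tth; have [M2 M20 hM2] := test1_bounded tth'.
pose H z := G1 z * 'D_1 th z.1 + G2 z * th z.1.
have mth : measurable_fun [set: measurableTypeR R * S] (fun z => th z.1).
  exact: measurableT_comp (test1_measurable tth) measurable_fst.
have mth' : measurable_fun [set: measurableTypeR R * S] (fun z => 'D_1 th z.1).
  exact: measurableT_comp (test1_measurable tth') measurable_fst.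
have H1 : (mu \x nu)%E.-integrable setT (EFin \o (fun z => G1 z * 'D_1 th z.1)).
  by apply: (@integrable_funM _ _ _ (mu \x nu)%E setT G1 (fun z => 'D_1 th z.1) M2).
have H2 : (mu \x nu)%E.-integrable setT (EFin \o (fun z => G2 z * th z.1)).
  by apply: (@integrable_funM _ _ _ (mu \x nu)%E setT G2 (fun z => th z.1) M1).
have iH := integrable_funD measurableT H1 H2.
have out (x : R) : ~~ (0 <= x <= T) -> th x = 0 /\ 'D_1 th x = 0.
  move=> xT; have xT' : ~~ (0 < x < T) by apply: contra xT => /andP[? ?]; rewrite !ltW.
  by rewrite (test1_out tth xT') (test1_out tth' xT').
rewrite -(@Rintegral_supp _ T (fun x => \int[nu]_p G1 (x, p) * 'D_1 th x + \int[nu]_p G2 (x, p) * th x)); last first.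
  by move=> x /out[-> ->]; rewrite !mulr0 addr0.
transitivity (\int[mu]_x \int[nu]_p H (x, p)).
  apply: ae_eq_Rintegral => //.
  - apply: measurable_funD; apply: measurable_funM.
    + exact: measurable_Rslice1 iG1.
    + exact: test1_measurable tth'.
    + exact: measurable_Rslice1 iG2.
    + exact: test1_measurable tth.
  - exact: measurable_Rslice1 iH.
  have s1 := ae_slice1 iG1; have s2 := ae_slice1 iG2; have s3 := ae_slice1 H1; have s4 := ae_slice1 H2.
  apply: filterS2 (filterI s1 s2) (filterI s3 s4) => x [h1 h2] [h3 h4] _.
  by rewrite /H/= RintegralD// !RintegralZr.
rewrite (Rfubini iH) -[RHS](@Rintegral0 _ _ _ nu); apply: ae_eq_Rintegral => //.
  exact: measurable_Rslice2 iH.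
have sF := L2_slice2 lF; have sFt := L2_slice2 lFt.
apply: filterS2 rep (filterI sF sFt) => p [c hc] [l1 l2] _.
rewrite (@Rintegral_supp _ T (fun x => H (x, p))); last first.
  by move=> x /out[h1 h2]; rewrite /H/= h1 h2 !mulr0 addr0.
have fti : mu.-integrable `[0, T] (EFin \o (fun t => Ft (t, p))).
  exact: (@L2_integrable _ _ _ mu _ _ (measurable_itv _) (lebesgue_itv_fin _ _) l2).
have Ai := isint_prim_cst c fti.
(* On a slice [H] is [w p] times the derivative of the square of the representative times [th]; as
   [th] vanishes at 0 and at [T], the integral is 0 whatever [c]. *)
have Bi := isintM (ltW T0) (isintM (ltW T0) Ai Ai) (isint_test1 (ltW T0) tth).
have := isint_total (ltW T0) Bi.
rewrite (test1_out tth (x := T)) ?ltxx ?andbF// (test1_out tth (x := 0)) ?ltxx// !mulr0 subrr => B0.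
transitivity (w p * 0); last by rewrite mulr0.
rewrite -[X in _ = w p * X]B0 -RintegralZl//; last exact: Bi.1.
apply: ae_eq_Rintegral => //.
- apply: measurable_funTS.
  exact: (measurable_fun_pair1 p (integrable_measurable iH)).
- apply: measurable_funM => //; exact: integrable_measurable Bi.1.
apply: filterS hc => t ht /=; rewrite in_itv/= => /ht; rewrite /H /G1 /G2 /= => ->; ring.
Qed.

End joint.

Section evolution.
Context {R : realType}.
Notation mu := (@lebesgue_measure R).
Implicit Types (L T : R).

Lemma test1_out_itv (a b : R) f x : test1 a b f -> ~~ (a <= x <= b) -> f x = 0.
Proof. by move=> tf xab; apply: (test1_out tf); apply: contra xab => /andP[? ?]; rewrite !ltW. Qed.

Lemma measurable_cylinder L :
  measurable (cylinder L : set (measurableTypeR R * (measurableTypeR R * measurableTypeR R))).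
Proof.
have -> : cylinder L = `]0, +oo[ `*` strip L.
  by apply/seteqP; split => z [/= z1 z2]; split => //; move: z1; rewrite /= in_itv/= andbT.
by apply: measurableX => //; exact: measurable_strip.
Qed.

Definition zext L (u : R -> R * R -> R) : R * (R * R) -> R :=
  (fun z => u z.1 z.2) \_ (cylinder L).

Lemma zextE L u t p : 0 < t -> zext L u (t, p) = (u t \_ (strip L)) p.
Proof.
move=> t0; rewrite /zext !restrictE0 /cylinder.
by have [ps|ps] := pselect (strip L p); [rewrite !mem_set|rewrite !memNset// => -[]].
Qed.

Lemma measurable_zext L u : jointly_measurable L u ->
  measurable_fun [set: measurableTypeR R * (measurableTypeR R * measurableTypeR R)] (zext L u).
Proof. by move=> mu'; apply/(measurable_restrictT _ (measurable_cylinder L)). Qed.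

(** The bounds on [u] and [ut] are given on finite time intervals only, whereas slicing works with
    functions in L^2 of the whole space-time. *)
Definition tcut L T u z := zext L u z * \1_(`[0, T] : set R) z.1.

Lemma tcutE L T u t p : 0 <= t <= T -> tcut L T u (t, p) = zext L u (t, p).
Proof. by move=> tT; rewrite /tcut indicE mem_setE in_itv/= tT mulr1. Qed.

Lemma L2_tcut L k T u : 0 < L -> 0 < T -> jointly_measurable L u -> LpH L +oo%E k T u ->
  L2 (leb3 R) setT (tcut L T u).
Proof.
move=> L0 T0 ju hu; have [M M0 hM] := Linf_bound L0 hu.
apply: (@joint_L2 _ _ R (leb2 R) _ T M M0).
- apply: measurable_funM; first exact: measurable_zext.
  by apply: measurableT_comp => //; exact: measurable_indic.
- have nT : {ae mu, forall x : R, x != T}.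
    exists [set T]; split => //; first exact: lebesgue_measure_set1.
    by move=> x /= /negP/negPn/eqP.
  apply: filterS nT => t tT t0T p; rewrite /tcut indicE mem_setE in_itv/=.
  have [/andP[t0 t1]|] := boolP (0 <= t <= T); last by rewrite mulr0.
  rewrite /zext restrictE0 memNset ?mul0r// => -[/= t0' _].
  by move: t0T; rewrite t0' lt_neqAle tT t1.
- apply: filterS hM => t + tT => /(_ tT)[lt le].
  have E p : tcut L T u (t, p) = (u t \_ (strip L)) p.
    by move/andP : (tT) => [t0 t1]; rewrite tcutE ?zextE ?(ltW t0) ?(ltW t1).
  split; first by under eq_fun do rewrite E; exact: L2fun_L2.
  by under eq_Rintegral do rewrite E.
Qed.

(** Here the transverse variable of [slicing] is the point [p] of the plane, and the weak derivative
    in time is tested with products of three functions. Off the strip everything is 0. *)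
Lemma time_slices L T u ut : 0 < L -> 0 < T -> weak_dt L u ut ->
  L2 (leb3 R) setT (tcut L T u) -> L2 (leb3 R) setT (tcut L T ut) ->
  {ae leb2 R, forall p, exists c, {ae mu, forall t, 0 <= t <= T ->
     tcut L T u (t, p) = c + \int[mu]_(s in `[0, t]) tcut L T ut (s, p)}}.
Proof.
move=> L0 T0 wt lu lut.
have H (n : nat) : {ae leb2 R, forall p, (`[0, L] `*` `[- n.+1%:R, n.+1%:R]) p ->
    exists c, {ae mu, forall t, 0 <= t <= T ->
     tcut L T u (t, p) = c + \int[mu]_(s in `[0, t]) tcut L T ut (s, p)}}.
  set m : R := n.+1%:R; have m0 : 0 < m by rewrite ltr0n.
  have mm : - m < m by rewrite gtrN.
  apply: (@slicing _ _ R (leb2 R) 0 T _ (bumpf2 0 L (- m) m) _ _ T0 (separating2 L0 mm) lu lut).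
  move=> i j; set th := test_family 0 T i; have tth : test1 0 T th := test_familyP 0 T i.
  rewrite /bumpf2; case: unpickle => [[a b]|]; last first.
    by rewrite -[RHS](@Rintegral0 _ _ _ (leb3 R)); apply: eq_Rintegral => z _; rewrite mul0r mulr0.
  set al := bumpf 0 L a; set be := bumpf (- m) m b.
  have ta : test1 0 L al := test1_bumpf 0 L a; have tb : test1 (- m) m be := test1_bumpf (- m) m b.
  have I1 : (leb3 R).-integrable setT (EFin \o (fun z => tcut L T u z * tens3 ('D_1 th) al be z)).
    apply: (@L2_prod _ _ _ (leb3 R)) => //.
    exact: (L2_tensor (m1 := mu) (m2 := leb2 R) (test1_L2 (test1_derive tth)) (L2_tens ta tb)).
  have I2 : (leb3 R).-integrable setT (EFin \o (fun z => tcut L T ut z * tens3 th al be z)).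
    apply: (@L2_prod _ _ _ (leb3 R)) => //.
    exact: (L2_tensor (m1 := mu) (m2 := leb2 R) (test1_L2 tth) (L2_tens ta tb)).
  transitivity (\int[leb3 R]_z (tcut L T u z * tens3 ('D_1 th) al be z + tcut L T ut z * tens3 th al be z)).
    apply: eq_Rintegral => -[t [x y]] _; rewrite /tens3 /tens /= indicE in_setX /= in_setX /= !mem_setE !in_itv/=.
    have [xL|xL] := boolP (0 <= x <= L); last first.
      by rewrite (test1_out_itv ta xL) ?mul0r ?mulr0 ?mul0r ?mulr0 ?addr0.
    have [yL|yL] := boolP (- m <= y <= m); last first.
      by rewrite (test1_out_itv tb yL) ?mul0r ?mulr0 ?mul0r ?mulr0 ?addr0.
    have [tT|tT] := boolP (0 <= t <= T); last first.
      by rewrite /tcut /= indicE mem_setE in_itv/= (negbTE tT) !mulr0 !mul0r addr0.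
    by rewrite mulr1; ring.
  rewrite RintegralD//.
  have R1 v k : test1 0 T k -> \int[leb3 R]_z (tcut L T v z * tens3 k al be z) =
      \int[leb3 R]_(z in cylinder L) (v z.1 z.2 * tens3 k al be z).
    move=> tk; rewrite [RHS]Rintegral_mkcond; apply: eq_Rintegral => -[t p] _.
    rewrite /tcut /zext !restrictE0 /tens3 /= indicE mem_setE in_itv/=.
    case: ifPn => _; rewrite ?mul0r//.
    have [tT|tT] := boolP (0 <= t <= T); first by rewrite mulr1.
    by rewrite (test1_out_itv tk tT) mulr0 !mul0r mulr0.
  rewrite R1; last exact: test1_derive.
  rewrite R1//.
  have W := wt _ (test_fun_tens3 tth ta tb).
  rewrite -[X in _ + X]opprK -W; apply/eqP; rewrite subr_eq0; apply/eqP.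
  apply: eq_Rintegral => z _; congr (_ * _); apply/esym; apply: derive_tens3.
  - exact: tth.1.
  - exact: ta.1.
  - exact: tb.1.
have /ae_foralln := H; apply: filterS => p h.
have [ps|ps] := pselect (strip L p); last first.
  have z0 v t : tcut L T v (t, p) = 0.
    by rewrite /tcut /zext restrictE0 memNset ?mul0r// => -[_].
  exists 0; apply: aeW => t _; rewrite z0 add0r.
  by under eq_Rintegral do rewrite z0; rewrite /Rintegral integral0.
apply: (h (Num.truncn `|p.2|)); split => /=.
  by move: ps; rewrite /strip/= in_itv/= => /andP[? ?]; rewrite !ltW.
by have := truncnS_gt `|p.2|; move=> /ltW; rewrite in_itv/= -ler_norml.
Qed.

End evolution.

(** * The weighted energy of a solution *)

Section solution.
Context {R : realType}.
Notation mu := (@lebesgue_measure R).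
Implicit Types (L T t : R).

Definition energy L (u : R -> R * R -> R) t : R :=
  \int[leb2 R]_p (wt L p.1 * (u t \_ (strip L)) p ^+ 2).

(** The time derivative of [energy], in the sense given by [energy_rate]. *)
Definition rate L (u ut : R -> R * R -> R) t : R :=
  \int[leb2 R]_p (2 * (wt L p.1 * (zext L u (t, p) * zext L ut (t, p)))).

Lemma wt_ge0 L x : 0 <= wt L x.
Proof.
rewrite /wt indicE mem_setE in_itv/=; have [/andP[x0 _]|_] := boolP (0 <= x <= L); last by rewrite mulr0.
by rewrite mulr1 addr_ge0.
Qed.

Lemma integrable_wt_sqr L (f : R * R -> R) : 0 < L -> L2 (leb2 R) setT f ->
  (leb2 R).-integrable setT (EFin \o (fun p => wt L p.1 * f p ^+ 2)).
Proof.
move=> L0 lf.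
have := @integrable_funM _ _ _ (leb2 R) setT (fun p => f p ^+ 2) (fun p => wt L p.1) (1 + L)
  measurableT lf.2 (measurable_fst2 (@measurable_wt _ L)) (fun p _ => wt_bound p.1 L0).
by apply: eq_integrable => // p _ /=; rewrite mulrC.
Qed.

Lemma weighted_norm_strip L (f : R * R -> R) : 0 < L -> L2 (leb2 R) setT (f \_ (strip L)) ->
  (\int[leb2 R]_(p in strip L) ((1 + p.1) * f p ^+ 2)%:E)%E =
  (\int[leb2 R]_p (wt L p.1 * (f \_ (strip L)) p ^+ 2))%:E.
Proof.
move=> L0 lf; rewrite (EFin_Rintegral measurableT (integrable_wt_sqr L0 lf)) [LHS]integral_mkcond.
apply: eq_integral => p _; rewrite patchE restrictE0; case: ifPn => [|_].
  by rewrite inE /strip/= => /andP[x0 xL]; rewrite wtE// !ltW.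
by rewrite expr0n mulr0.
Qed.

Lemma energy_rate L T (u ut : R -> R * R -> R) : 0 < L -> 0 < T -> weak_dt L u ut ->
  L2 (leb3 R) setT (tcut L T u) -> L2 (leb3 R) setT (tcut L T ut) ->
  mu.-integrable `[0, T] (EFin \o rate L u ut) /\
  exists c, {ae mu, forall t, 0 <= t <= T ->
    energy L u t = c + \int[mu]_(s in `[0, t]) rate L u ut s}.
Proof.
move=> L0 T0 wdt lu lut.
have [I [c hc]] := energy_identity T0 lu lut (measurable_fst2 (@measurable_wt _ L))
  (fun p => wt_bound p.1 L0) (time_slices L0 T0 wdt lu lut).
have rE t : 0 <= t <= T -> rate L u ut t =
    \int[leb2 R]_p (2 * (wt L p.1 * (tcut L T u (t, p) * tcut L T ut (t, p)))).
  by move=> tT; apply: eq_Rintegral => p _; rewrite !tcutE.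
split.
  apply: eq_integrable I => // t; rewrite inE/= in_itv/= => tT.
  by rewrite /= rE.
(* At [t = 0] the cut function is 0, while [energy] reads [u 0], about which nothing is known. *)
have n0 : {ae mu, forall x : R, x != 0}.
  exists [set 0]; split => //; first exact: lebesgue_measure_set1.
  by move=> x /= /negP/negPn/eqP.
exists c; apply: filterS2 hc n0 => t ht t0 tT.
have t1 : 0 < t by rewrite lt_neqAle eq_sym t0; case/andP : tT.
transitivity (\int[leb2 R]_p (wt L p.1 * tcut L T u (t, p) ^+ 2)).
  by apply: eq_Rintegral => p _; rewrite tcutE ?zextE.
apply: etrans (ht tT) _; congr (_ + _); apply: eq_Rintegral => s.
rewrite inE/= in_itv/= => /andP[s0 st]; rewrite rE// s0 (le_trans st)//.
by case/andP : tT.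
Qed.

(** [2 |b d| <= h^-1 d^2 + h b^2], from the squares of [d - h b] and [d + h b]. The free parameter
    [h] makes the part in [b], which is not small, as small as desired. *)
Lemma sqr_perturb (h b d : R) : 0 < h ->
  `|b ^+ 2 - (b + d) ^+ 2| <= (1 + h^-1) * d ^+ 2 + h * b ^+ 2.
Proof.
move=> h0; have hV : h * h^-1 = 1 by rewrite mulfV// gt_eqF.
have hV0 : 0 < h^-1 by rewrite invr_gt0.
have s1 : 0 <= h^-1 * (d - h * b) ^+ 2 by rewrite mulr_ge0 ?sqr_ge0 ?ltW.
have s2 : 0 <= h^-1 * (d + h * b) ^+ 2 by rewrite mulr_ge0 ?sqr_ge0 ?ltW.
have e1 : h^-1 * (d - h * b) ^+ 2 = h^-1 * d ^+ 2 + h * b ^+ 2 - 2 * (b * d) by field; rewrite gt_eqF.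
have e2 : h^-1 * (d + h * b) ^+ 2 = h^-1 * d ^+ 2 + h * b ^+ 2 + 2 * (b * d) by field; rewrite gt_eqF.
rewrite e1 in s1; rewrite e2 in s2; have d2 := sqr_ge0 d.
have e3 : b ^+ 2 - (b + d) ^+ 2 = - d ^+ 2 - 2 * (b * d) by ring.
rewrite e3 mulrDl mul1r ler_norml; move: s1 s2 d2.
move: (b * d) (h^-1 * d ^+ 2) (h * b ^+ 2) (d ^+ 2) => X Y Z W.
by move=> *; apply/andP; split; lra.
Qed.

Lemma restrictB L (f g : R * R -> R) p :
  ((fun p => f p - g p) \_ (strip L)) p = (f \_ (strip L)) p - (g \_ (strip L)) p.
Proof. by rewrite !restrictE0; case: ifPn; rewrite ?subr0. Qed.

Lemma L2norm_lt_L2 L (f g : R * R -> R) (e : R) : measurable_fun (strip L) f ->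
  measurable_fun (strip L) g -> (L2norm L (fun p => (f p - g p)%R) ^+ 2 < e%:E)%E ->
  L2 (leb2 R) setT ((fun p => f p - g p) \_ (strip L)) /\
  \int[leb2 R]_p (((fun p => f p - g p) \_ (strip L)) p) ^+ 2 < e.
Proof.
move=> mf mg h; apply: integrable_Rintegral_lt; last by rewrite -L2norm_sqr.
by apply/(measurable_restrictT _ (measurable_strip L)); exact: measurable_funB.
Qed.

Lemma energy_cvg (F : set_system R) {FF : Filter F} L (v : R -> R * R -> R)
    (v0 : R * R -> R) : 0 < L -> measurable_fun (strip L) v0 ->
  L2 (leb2 R) setT (v0 \_ (strip L)) ->
  (\forall s \near F, measurable_fun (strip L) (v s)) ->
  L2norm L (fun p => v s p - v0 p) @[s --> F] --> 0%E ->
  energy L v s @[s --> F] --> \int[leb2 R]_p (wt L p.1 * (v0 \_ (strip L)) p ^+ 2).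
Proof.
move=> L0 mv0 l0 mv cv; apply/cvgrPdist_lt => e e0.
set b := v0 \_ (strip L) in l0 *; pose B := \int[leb2 R]_p b p ^+ 2.
have B0 : 0 <= B by exact: Rintegral_sqr_ge0.
have L1 : 0 < 1 + L by rewrite addr_gt0.
have B1 : 0 < B + 1 by rewrite ltr_wpDl.
(* [h], and then [dl], are such that each of the two final terms is [e / 2]; [B + 1] stands for [B],
   which may be 0. *)
pose h := e / (2 * (1 + L) * (B + 1)).
have h0 : 0 < h by rewrite divr_gt0// !mulr_gt0.
have hV : 0 < 1 + h^-1 by rewrite addr_gt0// invr_gt0.
pose dl := e / (2 * (1 + L) * (1 + h^-1)).
have dl0 : 0 < dl by rewrite divr_gt0// !mulr_gt0.
have N0 s : (0 <= L2norm L (fun p => (v s p - v0 p)%R))%E by exact: Lnorm_ge0.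
have small := cvg0_lt (FF := FF) dl0 N0 cv.
apply: filterS2 mv small => s mvs hs.
have [ld dle] := L2norm_lt_L2 mvs mv0 hs.
set d := _ \_ _ in ld dle.
have aE p : (v s \_ (strip L)) p = b p + d p by rewrite /d restrictB /b addrC subrK.
have la : L2 (leb2 R) setT (v s \_ (strip L)).
  by have := L2D measurableT l0 ld; rewrite (_ : (fun x => b x + d x) = v s \_ (strip L))//; apply/funext => p; rewrite aE.
have ib := integrable_wt_sqr L0 l0; have ia := integrable_wt_sqr L0 la.
rewrite /energy -(RintegralB measurableT ib ia).
have I1 := integrable_funZ (1 + h^-1) measurableT ld.2.
have I2 := integrable_funZ h measurableT l0.2.
have I12 := integrable_funZ (1 + L) measurableT (integrable_funD measurableT I1 I2).
have I3 := integrable_funB measurableT ib ia.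
apply: (le_lt_trans (le_normr_Rintegral measurableT I3)).
apply: (@le_lt_trans _ _ (\int[leb2 R]_p ((1 + L) * ((1 + h^-1) * d p ^+ 2 + h * b p ^+ 2)))).
  apply: ae_le_Rintegral => //; first exact: integrable_norm.
  apply: aeW => p _; rewrite aE -mulrBr normrM; apply: ler_pM => //; first exact: wt_bound.
  exact: sqr_perturb.
rewrite (RintegralZl _ measurableT (integrable_funD measurableT I1 I2)) (RintegralD measurableT I1 I2).
rewrite (RintegralZl _ measurableT ld.2) (RintegralZl _ measurableT l0.2) -/B.
have e1 : (1 + L) * ((1 + h^-1) * dl + h * (B + 1)) = e.
  have a1 : (1 + L) * ((1 + h^-1) * dl) = e / 2.
    by rewrite /dl; move: (1 + h^-1) hV => k k0; field; rewrite !gt_eqF.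
  have a2 : (1 + L) * (h * (B + 1)) = e / 2 by rewrite /h; field; rewrite !gt_eqF.
  by rewrite mulrDr a1 a2; field.
by rewrite -[ltRHS]e1 ltr_pM2l// ltrD// ?ltr_pM2l// ltrDl.
Qed.

Lemma measurable_profile L (u : R -> R * R -> R) t : 0 < t -> jointly_measurable L u ->
  measurable_fun (strip L) (u t).
Proof.
move=> t0 ju; apply/(measurable_restrictT _ (measurable_strip L)).
have := measurable_fun_pair2 (T1 := measurableTypeR R) t (measurable_zext ju).
by rewrite (_ : (fun y => zext L u (t, y)) = u t \_ (strip L))//; apply/funext => p; rewrite zextE.
Qed.

(** [u s] is known to be in L^2 for almost every [s] only. By continuity in time some such [s] near
    [t] makes [u s - u t] square-integrable as well. *)
Lemma profile_L2 L (u : R -> R * R -> R) t : 0 < t -> jointly_measurable L u ->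
  {ae mu, forall s, 0 < s -> L2fun L (u s)} ->
  L2norm L (fun p => u s p - u t p) @[s --> t] --> 0%E ->
  L2 (leb2 R) setT (u t \_ (strip L)).
Proof.
move=> t0 ju hu cu.
have N0 s : (0 <= L2norm L (fun p => (u s p - u t p)%R))%E by exact: Lnorm_ge0.
have small : nbhs t (fun s => L2norm L (fun p => (u s p - u t p)%R) ^+ 2 < 1%:E)%E.
  by have := cvg0_lt (FF := nbhs_filter t) ltr01 N0 cu.
have [r /= r0 hr] := (nbhs_ballP _ _).1 small.
have tr : t < t + r / 2 by rewrite ltrDl divr_gt0.
have [s /andP[ts sr] ls] : exists2 s : R, t <= s <= t + r / 2 & 0 < s -> L2fun L (u s).
  by apply: ae_itv_ex => //; apply: filterS hu => s + _.
have s0 := lt_le_trans t0 ts; have hs := ls s0.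
have sb : (L2norm L (fun p => (u s p - u t p)%R) ^+ 2 < 1%:E)%E.
  by apply: hr; rewrite /ball/= ler0_norm ?subr_le0// opprB; lra.
have [ld _] := L2norm_lt_L2 (measurable_profile s0 ju) (measurable_profile t0 ju) sb.
have := L2B measurableT (L2fun_L2 hs) ld.
rewrite (_ : (fun x => _ - _) = u t \_ (strip L))//; apply/funext => p.
by rewrite restrictB opprB addrC subrK.
Qed.

Lemma LpH_ae L q k (f : R -> R * R -> R) : (forall T, 0 < T -> LpH L q k T f) ->
  {ae mu, forall t, 0 < t -> exists D, Hderivs L k (f t) D}.
Proof.
move=> h.
have : forall n : nat, {ae mu, forall t, 0 < t < n.+1%:R -> exists D, Hderivs L k (f t) D}.
  move=> n; have [D [_ HD _]] := h n.+1%:R (ltr0Sn _ _).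
  by apply: filterS HD => t ht tn; exists (D t); exact: ht.
move=> /ae_foralln; apply: filterS => t ht t0; apply: (ht (Num.truncn t)).
by rewrite t0 truncnS_gt.
Qed.

Lemma dissipation L A u0 u ut ux uxxx uxyy : 0 < L ->
  24 / L ^+ 2 - 1 = 2 * A ^+ 2 -> solution_data L u0 u ut ux uxxx uxyy ->
  {ae mu, forall t, 0 < t ->
    energy L u t < 9 * ((24 - L ^+ 2) ^+ 2 / (2 ^+ 9 * L ^+ 2)) ->
    rate L u ut t <= - (A ^+ 2 / (1 + L) * energy L u t)}.
Proof.
move=> L0 hA su.
have h3 := LpH_ae (rs_u_L2_H3 su); have ht := LpH_ae (rs_ut_Linf_L2 su).
have hx := rs_dx su; have hb := rs_bdry su.
have he := ae_prod1 (m1 := mu) (m2 := leb2 R) (rs_eqn su).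
apply: filterS2 (filterI h3 ht) (filterI he (filterI hx hb)).
move=> t [h3t htt] [het [hxt hbt]] t0 Et.
have [D HD] := h3t t0; have [Dt HDt] := htt t0.
have [wx wxxx wxyy] := hxt t0; have [b0 bL bx] := hbt t0.
have lut : L2fun L (ut t) by have [] := HDt 0%N 0%N isT.
have w01 := weakD_tens (HD 0%N 1%N isT); have w20 := weakD_tens (HD 2%N 0%N isT).
have w11 := weakD_tens (HD 1%N 1%N isT); have w02 := weakD_tens (HD 0%N 2%N isT).
have vx := weakD_tens wx; have vxxx := weakD_tens wxxx; have vxyy := weakD_tens wxyy.
have [lu lux _] := wx; have [_ luxxx _] := wxxx; have [_ luxyy _] := wxyy.
have [_ l01 _] := HD 0%N 1%N isT; have [_ l20 _] := HD 2%N 0%N isT.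
have [_ l11 _] := HD 1%N 1%N isT; have [_ l02 _] := HD 0%N 2%N isT.
have S := @restrict_on_strip R.
(* The zero trace of [ux] at [L] is turned into a representation of [ux] by the integral of its own
   x-derivative. *)
have vxx := weak_tens_x vx w20.
have sp : spatial L (u t \_ (strip L)) (ux t \_ (strip L)) (D 0%N 1%N \_ (strip L))
    (D 2%N 0%N \_ (strip L)) (D 1%N 1%N \_ (strip L)) (D 0%N 2%N \_ (strip L))
    (uxxx t \_ (strip L)) (uxyy t \_ (strip L)).
  split.
  - by split; split; exact: L2fun_L2.
  - by split; split; exact: S.
  - by split; [exact: weak_tens_x w20 vxxx|exact: weak_tens_x w02 vxyy].
  - split => //.
    + exact: weak_tens_y w01 w02.
    + exact: weak_tens_y vx w11.
    + exact: weak_tens_y w11 vxyy.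
  - exact: (@has_trace0_repr _ L false _ _ L0 b0 lu lux vx).
  - exact: (@has_trace0_repr _ L true _ _ L0 bL lu lux vx).
  - exact: (@has_trace0_repr _ L true _ _ L0 bx lux l20 vxx).
have pde : {ae leb2 R, forall p, (ut t \_ (strip L)) p +
    (1 + (u t \_ (strip L)) p) * (ux t \_ (strip L)) p +
    (uxxx t \_ (strip L)) p + (uxyy t \_ (strip L)) p = 0}.
  apply: filterS het => p hp; rewrite !restrictE0; case: ifPn => [|_]; last by ring.
  by rewrite inE => ps; exact: hp.
have l0 := L2fun_L2 lu.
set v := u t \_ (strip L) in sp pde l0.
set U := \int[leb2 R]_p v p ^+ 2.
have EI := integrable_wt_sqr L0 l0.
have sv p : ~~ (0 < p.1 < L) -> v p = 0 by exact: S.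
(* This inequality carries the threshold from the energy over to [U]; the next one turns the decay
   in [U] into a decay in the energy, at the cost of the factor [1 + L]. *)
have UE : U <= energy L u t.
  apply: ae_le_Rintegral => //; first exact: l0.2.
  apply: aeW => p _; have [ps|ps] := boolP (0 < p.1 < L); last first.
    by rewrite -/v sv// expr0n mulr0.
  rewrite ler_peMl ?sqr_ge0// wtE; first by case/andP : ps => p0 _; rewrite lerDl ltW.
  by case/andP : ps => ? ?; rewrite !ltW.
have EU : energy L u t <= (1 + L) * U.
  rewrite /U -(RintegralZl _ measurableT l0.2).
  apply: ae_le_Rintegral => //; first exact: (integrable_funZ (1 + L) measurableT l0.2).
  apply: aeW => p _; rewrite ler_wpM2r ?sqr_ge0//.
  exact: le_trans (ler_norm _) (wt_bound _ L0).
have U0 : 0 <= U by exact: Rintegral_sqr_ge0.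
have X0 : 0 <= \int[leb2 R]_p (ux t \_ (strip L)) p ^+ 2 by exact: Rintegral_sqr_ge0.
have Y0 : 0 <= \int[leb2 R]_p (D 0%N 1%N \_ (strip L)) p ^+ 2 by exact: Rintegral_sqr_ge0.
have N0 : 0 <= \int[leb2 R]_p `|v p| ^+ 3 by apply: Rintegral_ge0 => p _; rewrite exprn_ge0.
have := decay_algebra L0 hA U0 X0 Y0 N0 (poincare L0 sp) (cubic_bound L0 sp)
  (le_trans UE (ltW Et)).
have := energy_dissipation L0 sp (L2fun_L2 lut) pde.
rewrite (_ : \int[leb2 R]_p _ = rate L u ut t); last first.
  by apply: eq_Rintegral => p _; rewrite !zextE.
move=> h1 h2; apply: (le_trans (le_trans h1 h2)); rewrite lerN2 mulrAC ler_pdivrMr ?addr_gt0//.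
apply: (le_trans (ler_wpM2l (sqr_ge0 A) EU)); rewrite le_eqVlt; apply/orP; left; apply/eqP; ring.
Qed.

End solution.

Lemma weighted_L2 (R : realType) (L : R) (f : R * R -> R) : 0 < L -> measurable_fun (strip L) f ->
  (\int[leb2 R]_(p in strip L) ((1 + p.1) * f p ^+ 2)%:E < +oo)%E ->
  L2 (leb2 R) setT (f \_ (strip L)).
Proof.
move=> L0 mf h; have mf0 : measurable_fun setT (f \_ (strip L)).
  by apply/(measurable_restrictT _ (measurable_strip L)).
have mw : measurable_fun (strip L) (fun p : measurableTypeR R * measurableTypeR R => (1 + p.1) * f p ^+ 2).
  apply: measurable_funM; last exact: measurable_funX.
  by apply: measurable_funTS; apply: measurable_funD => //; exact: measurable_fst.
have wi : (leb2 R).-integrable (strip L) (EFin \o (fun p => (1 + p.1) * f p ^+ 2)).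
  apply/ge0_integrableP => // p /andP[p0 _].
  by rewrite mulr_ge0 ?sqr_ge0// addr_ge0// ltW.
split => //; have := @integrable_restrictT _ _ _ (leb2 R) _ (fun p => f p ^+ 2) (measurable_strip L).
move=> [+ _]; rewrite (_ : (fun p => f p ^+ 2) \_ (strip L) = (fun p => (f \_ (strip L)) p ^+ 2)).
  apply; apply: (@le_integrable_normr _ _ _ (leb2 R) _ _ (fun p => (1 + p.1) * f p ^+ 2)) => //.
  - exact: measurable_strip.
  - exact: measurable_funX.
  - move=> p /andP[p0 _]; rewrite ger0_norm ?sqr_ge0//.
    by rewrite ler_peMl ?sqr_ge0// lerDl ltW.
by apply/funext => p; rewrite !restrictE0; case: ifPn => //; rewrite expr0n.
Qed.

Theorem theorem7p2 (R : realType) (L A : R) (u0 : R * R -> R)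
    (u : R -> R * R -> R)
    (hL : 0 < L)
    (hA : 24 / L ^+ 2 - 1 = 2 * A ^+ 2)
    (hA_gt0 : 0 < 2 * A ^+ 2)
    (hu0 : measurable_fun (strip L) u0)
    (hsmall : (\int[leb2 R]_(p in strip L) ((1 + p.1) * u0 p ^+ 2)%:E
               < (9 * ((24 - L ^+ 2) ^+ 2 / (2 ^+ 9 * L ^+ 2)))%:E)%E)
    (hu : regular_solution L u0 u) :
  forall t : R, 0 < t ->
    (\int[leb2 R]_(p in strip L) (u t p ^+ 2)%:E
       <= \int[leb2 R]_(p in strip L) ((1 + p.1) * u t p ^+ 2)%:E)%E /\
    (\int[leb2 R]_(p in strip L) ((1 + p.1) * u t p ^+ 2)%:E
       <= (expR (- ((24 - L ^+ 2) / (2 * L ^+ 2 * (1 + L))) * t))%:E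
          * \int[leb2 R]_(p in strip L) ((1 + p.1) * u0 p ^+ 2)%:E)%E.
Proof.
move=> t t0; have [ut [ux [uxxx [uxyy su]]]] := hu.
have mt s : 0 < s -> measurable_fun (strip L) (u s).
  by move=> s0; exact: measurable_profile s0 (rs_meas_u su).
split.
  have m2 : measurable_fun (strip L) (fun p => u t p ^+ 2) by apply: measurable_funX; exact: mt.
  apply: ge0_le_integral.
  - exact: measurable_strip.
  - by move=> p _; rewrite lee_fin sqr_ge0.
  - exact/measurable_EFinP.
  - apply/measurable_EFinP/measurable_funM => //.
    by apply: measurable_funTS; apply: measurable_funD => //; exact: measurable_fst.
  - by move=> p /andP[p0 _]; rewrite lee_fin ler_peMl ?sqr_ge0// lerDl ltW.
have ls : {ae @lebesgue_measure R, forall s, 0 < s -> L2fun L (u s)}.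
  apply: filterS (rs_dx su) => s h s0.
  by have [[]] := h s0.
have lu s : 0 < s -> L2 (leb2 R) setT (u s \_ (strip L)).
  by move=> s0; exact: profile_L2 s0 (rs_meas_u su) ls (rs_cont su s0).
have l0 : L2 (leb2 R) setT (u0 \_ (strip L)).
  by apply: weighted_L2 => //; apply: lt_trans hsmall _; rewrite ltry.
rewrite (weighted_norm_strip hL l0) in hsmall *; rewrite (weighted_norm_strip hL (lu t t0)).
rewrite -EFinM lee_fin.
have L1 : 0 < 1 + L by rewrite addr_gt0.
(* By [hA], [24 - L ^+ 2] equals [2 * A ^+ 2 * L ^+ 2]. *)
have -> : (24 - L ^+ 2) / (2 * L ^+ 2 * (1 + L)) = A ^+ 2 / (1 + L).
  have -> : A ^+ 2 = (24 / L ^+ 2 - 1) / 2 by rewrite hA mulrC mulKf// pnatr_eq0.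
  by field; rewrite !gt_eqF.
rewrite lte_fin in hsmall.
apply: (@energy_decay _ (energy L u) (rate L u ut) _ (A ^+ 2 / (1 + L)) _ _ _ _ _ hsmall) => //.
- by rewrite divr_ge0 ?sqr_ge0// ltW.
- by move=> s _; apply: Rintegral_ge0 => p _; rewrite mulr_ge0 ?sqr_ge0 ?wt_ge0.
- move=> s s0; have ms : \forall r \near s, measurable_fun (strip L) (u r).
    by near=> r; apply: mt; near: r; exact: lt_nbhsr.
  exact: (energy_cvg hL (mt s s0) (lu s s0) ms (rs_cont su s0)).
- have ms : \forall r \near 0^'+, measurable_fun (strip L) (u r).
    by near=> r; apply: mt; near: r; exact: nbhs_right_gt.
  exact: (energy_cvg hL hu0 l0 ms (rs_init su)).
- move=> T T0; apply: energy_rate => //; first exact: rs_ut su.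
  + exact: L2_tcut hL T0 (rs_meas_u su) (rs_u_Linf_H2 su T0).
  + exact: L2_tcut hL T0 (rs_meas_ut su) (rs_ut_Linf_L2 su T0).
- exact: dissipation hL hA su.
Unshelve. all: by end_near. Qed.
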